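(* Let $G=G_X\cup_{G_A}G_Y$ be a metric graph, where $G_A=G_X\cap G_Y$ is a closed metric subgraph of the metric graphs $G_X$ and $G_Y$. Suppose that $G_A$ is a path of length $\alpha$, and that every vertex of $G_A$ besides the two endpoints has degree 2 as a vertex restricted to $G_X$. Let $\ell_X$ denote the length of the shortest cycle in $G_X$ passing through $G_A$, and similarly let $\ell_Y$ denote the length of the shortest cycle intersecting $G_A$ in $G_Y$. Let $\ell=\min\{\ell_X,\ell_Y\}$ and suppose $\alpha<\frac{\ell}{3}$. Let $X\subseteq G_X$ and $Y\subseteq G_Y$ be arbitrary subsets such that $X\cap G_Y=Y\cap G_X=X\cap Y=:A$, where $A$ contains the two endpoints of $G_A$. Suppose furthermore that $\mathrm{VR}(A;r)$ is contractible for all $r>0$. Then for any homological dimension $i\ge 0$ and field $k$, the persistence modules $\mathrm{PH}_i(\mathrm{VR}(X;r)\vee\mathrm{VR}(Y;r);k)$ and $\mathrm{PH}_i(\mathrm{VR}(X\cup_A Y;r);k)$ are isomorphic.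
   Context: A metric graph is a graph in which each edge is assigned a positive finite length; it is regarded as the metric space of all points on vertices and edges, with the distance between two points being the infimum of lengths of paths between them (assume that at each vertex the lengths of incident edges are bounded away from zero, so that this is a metric). A path (graph) has $n$ ordered vertices and $n-1$ edges joining successive vertices; it is parametrized by a closed interval, and its endpoints are the points with smallest and largest parameter. A cycle (loop) of a metric graph is (the image of) a continuous injective map $\mathbb{S}^1\to G$, and its length is the length of this image. The degree of a vertex is the number of incident edges. Metric gluing: if metric spaces $X,Y$ share a common isometric closed subspace $A=X\cap Y$, then $X\cup_A Y$ is the quotient of $X\sqcup Y$ identifying the two copies of $A$, with metric $d(s,t)=d_X(s,t)$ if $s,t\in X$, $d_Y(s,t)$ if $s,t\in Y$, and $\inf_{a\in A}\big(d_X(s,a)+d_Y(a,t)\big)$ if $s\in X$, $t\in Y$. $G_X\cup_{G_A}G_Y$ is the metric gluing of $G_X$ and $G_Y$ along $G_A$. Subsets $X\subseteq G_X$, $Y\subseteq G_Y$ carry the restricted metrics. The Vietoris--Rips complex is $\mathrm{VR}(Z;r)=\{\text{finite }\sigma\subseteq Z\mid \mathrm{diam}(\sigma)\le r\}$. The wedge sum is taken at a vertex of $A$. For a family of spaces filtered by the scale parameter $r$, $\mathrm{PH}_i(\,\cdot\,;k)$ is the persistence module consisting of the vector spaces $H_i(\,\cdot\,;k)$ at each scale $r$ with the linear maps induced by the inclusions for $r\le r'$. An isomorphism of persistence modules is a family of isomorphisms, one for each $r$, commuting with these linear maps. *)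

(* Defs.v *)
From HB Require Import structures.
From mathcomp Require Import all_boot all_order all_algebra.
From mathcomp Require Import finmap monalg.
From mathcomp Require Import all_classical all_reals all_analysis.

Set Implicit Arguments.
Unset Strict Implicit.
Unset Printing Implicit Defensive.

Import Order.TTheory GRing.Theory Num.Theory.
Import numFieldNormedType.Exports.

Local Open Scope classical_set_scope.
Local Open Scope ring_scope.

(* Loops and multiple edges are allowed; [len_bounded] says that at each vertex
   the lengths of the incident edges are bounded away from zero. *)
Record metric_graph (R : realType) := MetricGraph {
  vertex : choiceType;
  edge : choiceType;
  src : edge -> vertex;
  tgt : edge -> vertex;
  len : edge -> R;
  len_gt0 : forall e, 0 < len e;
  len_bounded : forall v, exists2 eps : R, 0 < eps &
    forall e, src e = v \/ tgt e = v -> eps <= len e }.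

Section MetricGraph.
Context {R : realType} (G : metric_graph R).

(* A point is a vertex, or a pair (e, t) in the interior of the edge e. *)
Definition gpoint : choiceType :=
  (vertex G + {p : edge G * R | 0 < p.2 < len p.1})%type.

(* The parametrization [0, len e] -> G of the closed edge e. *)
Definition edge_pt (e : edge G) (t : R) : gpoint :=
  match insub (e, t) with
  | Some p => inr p
  | None => inl (if t <= 0 then src e else tgt e)
  end.

Record subgraph := Subgraph {
  sverts : set (vertex G);
  sedges : set (edge G);
  sedges_src : forall e, sedges e -> sverts (src e);
  sedges_tgt : forall e, sedges e -> sverts (tgt e) }.

Definition subgraphI (H K : subgraph) : subgraph :=
  @Subgraph (sverts H `&` sverts K) (sedges H `&` sedges K)
    (fun e He => conj (sedges_src He.1) (sedges_src He.2))
    (fun e He => conj (sedges_tgt He.1) (sedges_tgt He.2)).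

Definition carrier (H : subgraph) : set gpoint := fun x =>
  match x with
  | inl v => sverts H v
  | inr p => sedges H (val p).1
  end.

(* Distances are computed with piecewise linear paths, which realize the infimum
   of the lengths of all paths. A walk is a list of segments (e, s, t), each of
   which runs inside the closed edge e from parameter s to parameter t. *)
Fixpoint is_walk (H : subgraph) (x : gpoint) (w : seq (edge G * R * R))
    (y : gpoint) : Prop :=
  match w with
  | [::] => carrier H x /\ x = y
  | (e, s, t) :: w' =>
      [/\ sedges H e, 0 <= s <= len e, 0 <= t <= len e, x = edge_pt e s
        & is_walk H (edge_pt e t) w' y]
  end.

Definition walk_length (w : seq (edge G * R * R)) : R :=
  \sum_(p <- w) `|p.2 - p.1.2|.

(* The metric of H as a metric graph in its own right; it is +oo between points
   in different components of H. *)
Definition gdist (H : subgraph) (x y : gpoint) : \bar R :=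
  ereal_inf [set (walk_length w)%:E | w in [set w | is_walk H x w y]].

Definition incident_edges (H : subgraph) (v : vertex G) : set (edge G) :=
  [set e | sedges H e /\ (src e = v \/ tgt e = v)].

Definition degree_is (H : subgraph) (v : vertex G) (n : nat) : Prop :=
  (incident_edges H v #= `I_n)%card.

Fixpoint successive (u : vertex G) (vs : seq (vertex G))
    (es : seq (edge G)) : Prop :=
  match vs, es with
  | [::], [::] => True
  | v :: vs', e :: es' =>
      (src e = u /\ tgt e = v \/ src e = v /\ tgt e = u)
      /\ successive v vs' es'
  | _, _ => False
  end.

(* H is a path with ordered vertices u :: vs and edges es; its endpoints are u
   and last u vs. *)
Definition is_path (H : subgraph) (u : vertex G) (vs : seq (vertex G))
    (es : seq (edge G)) : Prop :=
  [/\ uniq (u :: vs), successive u vs es,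
      sverts H = [set` u :: vs] & sedges H = [set` es]].

(* S^1 is modelled as [0, 1] with its endpoints identified. *)
Definition is_cycle (H : subgraph) (gamma : R -> gpoint) : Prop :=
  [/\ forall t, 0 <= t <= 1 -> carrier H (gamma t),
      gamma 0 = gamma 1,
      forall s t, 0 <= s < 1 -> 0 <= t < 1 -> gamma s = gamma t -> s = t
    & forall t, 0 <= t <= 1 -> forall eps : R, 0 < eps ->
      exists2 delta : R, 0 < delta & forall s, 0 <= s <= 1 ->
        `|s - t| < delta -> (gdist H (gamma t) (gamma s) < eps%:E)%E].

Definition polygon_length (H : subgraph) (gamma : R -> gpoint)
    (s : seq R) : \bar R :=
  (\sum_(i < size s) gdist H (gamma (nth 0%R (0%R :: s) i))
                            (gamma (nth 0%R s i)))%E.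

Definition curve_length (H : subgraph) (gamma : R -> gpoint) : \bar R :=
  ereal_sup [set polygon_length H gamma s | s in itv_partition 0 1].

Definition cycle_image (gamma : R -> gpoint) : set gpoint :=
  [set gamma t | t in `[0, 1]].

(* The infimum is +oo if there is no such cycle. *)
Definition shortest_cycle_through (H K : subgraph) : \bar R :=
  ereal_inf [set curve_length H gamma | gamma in
    [set gamma | is_cycle H gamma /\ carrier K `<=` cycle_image gamma]].

Definition shortest_cycle_meeting (H K : subgraph) : \bar R :=
  ereal_inf [set curve_length H gamma | gamma in
    [set gamma | is_cycle H gamma /\ carrier K `&` cycle_image gamma !=set0]].

End MetricGraph.

(* Metric gluing of (X, dX) and (Y, dY) along A, on the union of X and Y. *)
Definition glue_dist (R : realType) (T : Type) (dX dY : T -> T -> \bar R)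
    (X Y A : set T) (s t : T) : \bar R :=
  if `[< X s /\ X t >] then dX s t
  else if `[< Y s /\ Y t >] then dY s t
  else if `[< X s /\ Y t >] then
    ereal_inf [set (dX s a + dY a t)%E | a in A]
  else ereal_inf [set (dX t a + dY a s)%E | a in A].

Record complex (V : choiceType) := Complex {
  simplex : set {fset V};
  simplex_neq0 : forall s, simplex s -> s != fset0;
  simplex_sub : forall s t, simplex s -> (t `<=` s)%fset -> t != fset0 ->
    simplex t }.

Section VietorisRips.
Context {R : realType} {V : choiceType} (d : V -> V -> \bar R) (Z : set V).

Definition diam (s : {fset V}) : \bar R :=
  ereal_sup [set d p.1 p.2 | p in [set p | p.1 \in s /\ p.2 \in s]].

Definition vr_simplex (r : R) : set {fset V} := fun s =>
  [/\ s != fset0, [set` s] `<=` Z & (diam s <= r%:E)%E].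

Lemma vr_simplex_sub r (s t : {fset V}) :
  vr_simplex r s -> (t `<=` s)%fset -> t != fset0 -> vr_simplex r t.
Proof.
move=> [_ sZ sr] /fsubsetP ts t0; split=> //.
  by move=> x /= /ts xs; apply: sZ.
apply: le_trans sr; apply: le_ereal_sup => _ [p [p1 p2] <-].
by exists p => //; split; apply: ts.
Qed.

Definition VR (r : R) : complex V :=
  @Complex V (vr_simplex r) (fun s '(And3 s0 _ _) => s0) (@vr_simplex_sub r).

End VietorisRips.

(* The quotient of the disjoint union V + W identifying v0 and w0 is modelled on
   the elements inl v and the elements inr w with w != w0. *)
Section Wedge.
Context {V W : choiceType} (K : complex V) (L : complex W) (v0 : V) (w0 : W).

Definition wedge_inr (w : W) : V + W := if w == w0 then inl v0 else inr w.

Definition wedge_simplex : set {fset V + W} := fun s =>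
  (exists2 t, simplex K t & s = [fset (inl x : V + W) | x in t]%fset) \/
  (exists2 t, simplex L t & s = [fset wedge_inr x | x in t]%fset).

Lemma sub_imfset (T U : choiceType) (f : T -> U) (t : {fset T}) (s : {fset U}) :
  (s `<=` f @` t)%fset -> exists2 t', (t' `<=` t)%fset & s = (f @` t')%fset.
Proof.
move=> /fsubsetP st; exists [fset x in t | f x \in s]%fset.
  by apply/fsubsetP => x; rewrite !inE => /andP[].
apply/fsetP => y; apply/idP/imfsetP => /=.
  move=> ys; have /imfsetP[x /= xt yE] := st _ ys.
  by exists x => //; rewrite !inE xt -yE.
by move=> [x]; rewrite !inE => /andP[_ fxs] ->.
Qed.

Lemma wedge_simplex_neq0 s : wedge_simplex s -> s != fset0.
Proof.
have im_neq0 (T : choiceType) (f : T -> V + W) (t : {fset T}) :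
    t != fset0 -> (f @` t)%fset != fset0.
  case/fset0Pn=> x xt; apply/fset0Pn; exists (f x).
  by apply/imfsetP; exists x.
by move=> [[t Kt ->]|[t Lt ->]]; apply: im_neq0;
  [exact: simplex_neq0 Kt|exact: simplex_neq0 Lt].
Qed.

Lemma wedge_simplex_sub s t :
  wedge_simplex s -> (t `<=` s)%fset -> t != fset0 -> wedge_simplex t.
Proof.
have pre_neq0 (T : choiceType) (f : T -> V + W) (u : {fset T}) :
    (f @` u)%fset != fset0 -> u != fset0.
  by apply: contraNneq => ->; rewrite imfset0.
move=> [[u Ku ->]|[u Lu ->]] /sub_imfset[u' u'u ->] /pre_neq0 u'0; [left|right];
  by exists u' => //; apply: simplex_sub u'u u'0.
Qed.

Definition wedge : complex (V + W)%type :=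
  Complex wedge_simplex_neq0 wedge_simplex_sub.

End Wedge.

Section Realization.
Context (R : realType) {V : choiceType} (K : complex V).

(* b is the family of barycentric coordinates of a point. *)
Definition geom_pt : set {fsfun V -> R with 0} := fun b =>
  [/\ simplex K (finsupp b), forall v, 0 <= b v
    & \sum_(v <- finsupp b) b v = 1].

Definition realization : Type := {b | `[< geom_pt b >]}.

HB.instance Definition _ := Choice.on realization.

(* The weak topology: U is open iff its intersection with each closed simplex s
   is open in s for the Euclidean topology. *)
Definition weak_open (U : set realization) : Prop :=
  forall s, simplex K s -> forall b : realization, U b ->
  (finsupp (val b) `<=` s)%fset ->
  exists2 eps : R, 0 < eps & forall b' : realization,
    (finsupp (val b') `<=` s)%fset ->
    (forall v, v \in s -> `|val b v - val b' v| < eps) -> U b'.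

Lemma weak_openT : weak_open setT.
Proof. by move=> s _ b _ _; exists 1. Qed.

Lemma weak_openI : setI_closed weak_open.
Proof.
move=> U U' oU oU' s Ks b [Ub U'b] bs.
have [e e0 He] := oU s Ks b Ub bs; have [e' e'0 He'] := oU' s Ks b U'b bs.
exists (Num.min e e'); first by rewrite lt_min e0.
move=> b' b's bb'; split; [apply: He|apply: He'] => // v vs;
  by have := bb' v vs; rewrite lt_min => /andP[].
Qed.

Lemma weak_open_bigU (I : Type) (f : I -> set realization) :
  (forall i, weak_open (f i)) -> weak_open (\bigcup_i f i).
Proof.
move=> of_ s Ks b [i _ fib] bs; have [e e0 He] := of_ i s Ks b fib bs.
by exists e => // b' b's bb'; exists i => //; apply: He.
Qed.

HB.instance Definition _ :=
  isOpenTopological.Build realization weak_openT weak_openI weak_open_bigU.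

End Realization.

Definition contractible (R : realType) (T : topologicalType) : Prop :=
  exists (x0 : T) (h : T * R -> T),
    [/\ {within [set p | 0 <= p.2 <= 1], continuous h},
        forall x, h (x, 0) = x & forall x, h (x, 1) = x0].

Section LmodQuotient.
Context {R : nzRingType} {V : lmodType R} (I : submodClosed V).
Local Open Scope quotient_scope.

(* [submodClosed] does not provide closure under opposite, which
   [Quotient.quot] needs. *)
Definition submod_pred : V -> bool := fun x => x \in I.

Lemma submod_pred_zmod_closed : zmod_closed submod_pred.
Proof.
by split=> [|x y xI yI]; rewrite /submod_pred unfold_in ?rpred0 //;
  rewrite -scaleN1r rpredD // rpredZ.
Qed.

HB.instance Definition _ :=
  GRing.isZmodClosed.Build V submod_pred submod_pred_zmod_closed.

Definition submod_zmod : zmodClosed V :=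
  GRing.ZmodClosed.clone V submod_pred _.

Definition lmod_quot : Type := Quotient.quot submod_zmod.

HB.instance Definition _ := Choice.on lmod_quot.
HB.instance Definition _ := GRing.Zmodule.on lmod_quot.

Definition lmod_pi (x : V) : lmod_quot := \pi_(Quotient.quot submod_zmod) x.
Definition lmod_repr (q : lmod_quot) : V := repr (q : Quotient.quot submod_zmod).

Lemma lmod_reprK : cancel lmod_repr lmod_pi.
Proof. exact: reprK. Qed.

Lemma lmod_piE x y : lmod_pi x = lmod_pi y <-> x - y \in I.
Proof.
rewrite (_ : (x - y \in I) = (x - y \in submod_zmod))//.
by rewrite Quotient.idealrBE; split=> /eqP.
Qed.

Lemma lmod_piD x y : lmod_pi (x + y) = lmod_pi x + lmod_pi y.
Proof. exact: raddfD. Qed.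

Definition quot_scale (a : R) (q : lmod_quot) : lmod_quot :=
  lmod_pi (a *: lmod_repr q).

Lemma quot_scale_pi a x : quot_scale a (lmod_pi x) = lmod_pi (a *: x).
Proof.
apply/lmod_piE; rewrite -scalerBr; apply: rpredZ.
by apply/lmod_piE; rewrite lmod_reprK.
Qed.

Lemma quot_scaleA a b q : quot_scale a (quot_scale b q) = quot_scale (a * b) q.
Proof. by rewrite -[q]lmod_reprK !quot_scale_pi scalerA. Qed.

Lemma quot_scale1 : left_id 1 quot_scale.
Proof. by move=> q; rewrite -[q]lmod_reprK quot_scale_pi scale1r. Qed.

Lemma quot_scaleDr : right_distributive quot_scale +%R.
Proof.
move=> a p q; rewrite -[p]lmod_reprK -[q]lmod_reprK -lmod_piD !quot_scale_pi.
by rewrite scalerDr lmod_piD.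
Qed.

Lemma quot_scaleDl q : {morph quot_scale^~ q : a b / a + b}.
Proof. by move=> a b; rewrite -[q]lmod_reprK !quot_scale_pi scalerDl lmod_piD. Qed.

HB.instance Definition _ := GRing.Zmodule_isLmodule.Build R lmod_quot
  quot_scaleA quot_scale1 quot_scaleDr quot_scaleDl.

Lemma lmod_pi_is_linear : linear lmod_pi.
Proof. by move=> a x y; rewrite lmod_piD -quot_scale_pi. Qed.

HB.instance Definition _ := GRing.isLinear.Build R V lmod_quot *:%R lmod_pi
  lmod_pi_is_linear.

End LmodQuotient.

Section Homology.
Context (k : fieldType) {V : choiceType}.

(* Homology is that of the ordered simplicial chain complex, computed inside the
   free module on finite sequences of vertices; a sequence of size n+1 is an
   ordered, possibly degenerate, n-simplex. *)
Definition chain : lmodType k := {malg k[seq V]}.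

Definition seq_face (i : nat) (s : seq V) : seq V := take i s ++ drop i.+1 s.

(* Sequences of size at most 1 have no boundary: homology is not reduced. *)
Definition seq_boundary (s : seq V) : chain :=
  if (size s <= 1)%N then 0
  else \sum_(i < size s) (-1) ^+ i *: << seq_face i s >>.

Definition boundary (c : chain) : chain :=
  \sum_(s <- msupp c) c@_s *: seq_boundary s.

Lemma boundaryE (D : {fset seq V}) (c : chain) : (msupp c `<=` D)%fset ->
  boundary c = \sum_(s <- D) c@_s *: seq_boundary s.
Proof.
move=> cD; rewrite /boundary (big_fset_incl _ cD)//= => s _ /mcoeff_outdom ->.
by rewrite scale0r.
Qed.

Lemma boundary_is_linear : linear boundary.
Proof.
move=> a c c'; pose D := (msupp c `|` msupp c')%fset.
rewrite (@boundaryE D c) ?fsubsetUl// (@boundaryE D c') ?fsubsetUr//.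
rewrite (@boundaryE D); last first.
  apply: fsubset_trans (msuppD_le _ _) _; apply: fsetSU; exact: msuppZ_le.
rewrite scaler_sumr -big_split/=; apply: eq_bigr => s _.
by rewrite mcoeffD mcoeffZ scalerDl scalerA.
Qed.

HB.instance Definition _ := GRing.isLinear.Build k chain chain *:%R boundary
  boundary_is_linear.

Lemma boundaryD : {morph boundary : c c' / c + c'}.
Proof. exact: linearD. Qed.

Lemma boundaryZ a : {morph boundary : c / a *: c}.
Proof. exact: linearZZ. Qed.

Definition is_chain (K : complex V) (n : nat) (c : chain) : Prop :=
  forall s, s \in msupp c -> size s = n.+1 /\ simplex K [fset x in s]%fset.

Definition cycles (K : complex V) (n : nat) : chain -> bool :=
  fun c => `[< is_chain K n c /\ boundary c = 0 >].

Definition boundaries (K : complex V) (n : nat) : chain -> bool :=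
  fun c => `[< exists2 b, is_chain K n.+1 b & c = boundary b >].

Lemma is_chain0 K n : is_chain K n 0.
Proof. by move=> s; rewrite msupp0. Qed.

Lemma is_chainD K n c c' : is_chain K n c -> is_chain K n c' ->
  is_chain K n (c + c').
Proof.
move=> Kc Kc' s /(fsubsetP (msuppD_le _ _)); rewrite inE.
by move=> /orP[/Kc|/Kc'].
Qed.

Lemma is_chainZ K n a c : is_chain K n c -> is_chain K n (a *: c).
Proof. by move=> Kc s /(fsubsetP (msuppZ_le _ _)) /Kc. Qed.

Lemma cycles_submod K n : GRing.subsemimod_closed (cycles K n).
Proof.
split; [split|].
- by apply/asboolP; split; [exact: is_chain0|rewrite linear0].
- move=> c c' /asboolP[Kc bc] /asboolP[Kc' bc']; apply/asboolP.
  by split; [exact: is_chainD|rewrite boundaryD bc bc' addr0].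
- move=> a c /asboolP[Kc bc]; apply/asboolP.
  by split; [exact: is_chainZ|rewrite boundaryZ bc scaler0].
Qed.

HB.instance Definition _ K n :=
  GRing.isSubmodClosed.Build k chain (cycles K n) (cycles_submod K n).

Lemma boundaries_submod K n : GRing.subsemimod_closed (boundaries K n).
Proof.
split; [split|].
- by apply/asboolP; exists 0; [exact: is_chain0|rewrite linear0].
- move=> _ _ /asboolP[b Kb ->] /asboolP[b' Kb' ->]; apply/asboolP.
  by exists (b + b'); [exact: is_chainD|rewrite boundaryD].
- move=> a _ /asboolP[b Kb ->]; apply/asboolP.
  by exists (a *: b); [exact: is_chainZ|rewrite boundaryZ].
Qed.

HB.instance Definition _ K n :=
  GRing.isSubmodClosed.Build k chain (boundaries K n) (boundaries_submod K n).

Definition cycle_mod (K : complex V) (n : nat) : Type :=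
  {c : chain | cycles K n c}.

HB.instance Definition _ K n := SubChoice.on (cycle_mod K n).
HB.instance Definition _ K n := [SubChoice_isSubLmodule of cycle_mod K n by <:].

Definition bounding (K : complex V) (n : nat) : cycle_mod K n -> bool :=
  fun z => boundaries K n (val z).

Lemma bounding_submod K n : GRing.subsemimod_closed (@bounding K n).
Proof.
have [[B0 BD] BZ] := boundaries_submod K n.
split; [split|].
- exact: B0.
- move=> z z' Bz Bz'; exact: BD _ _ Bz Bz'.
- move=> a z Bz; exact: BZ a _ Bz.
Qed.

HB.instance Definition _ K n := GRing.isSubmodClosed.Build k (cycle_mod K n)
  (@bounding K n) (bounding_submod K n).

Definition homology (K : complex V) (n : nat) : lmodType k :=
  lmod_quot (GRing.SubmodClosed.clone k (cycle_mod K n) (@bounding K n) _).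

End Homology.

Arguments chain k V : clear implicits.

Section Persistence.
Context (k : fieldType).

Record persistence_module d (T : porderType d) := PersistenceModule {
  pm_space : T -> lmodType k;
  pm_map : forall r s : T, (r <= s)%O -> {linear pm_space r -> pm_space s};
  pm_map_id : forall r (h : (r <= r)%O) x, pm_map h x = x;
  pm_map_comp : forall r s t (h1 : (r <= s)%O) (h2 : (s <= t)%O)
    (h3 : (r <= t)%O) x, pm_map h3 x = pm_map h2 (pm_map h1 x) }.

Definition pm_iso d (T : porderType d) (M N : persistence_module T) : Prop :=
  exists f : forall r, {linear pm_space M r -> pm_space N r},
    (forall r, bijective (f r)) /\
    forall r s (h : (r <= s)%O) (x : pm_space M r),
      f s (pm_map M h x) = pm_map N h (f r x).

Context {R : realType}.

(* Filtrations are indexed by positive scales. *)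
Record filtration (V : choiceType) := Filtration {
  stage :> {posnum R} -> complex V;
  stage_mono : forall r s, r <= s -> simplex (stage r) `<=` simplex (stage s) }.

Section InducedMap.
Context {V : choiceType} (n : nat) (K L : complex V).
Hypothesis KL : simplex K `<=` simplex L.

Lemma is_chain_incl m (c : chain k V) : is_chain K m c -> is_chain L m c.
Proof. by move=> Kc s /Kc[? /KL]. Qed.

Lemma cycles_incl (z : cycle_mod k K n) : cycles L n (val z).
Proof.
have /asboolP[Kz bz] := valP z.
by apply/asboolP; split=> //; exact: is_chain_incl.
Qed.

Definition cycle_incl (z : cycle_mod k K n) : cycle_mod k L n :=
  Sub (val z) (cycles_incl z).

Definition homology_incl (x : homology k K n) : homology k L n :=
  lmod_pi _ (cycle_incl (lmod_repr x)).

Lemma homology_incl_pi (z : cycle_mod k K n) :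
  homology_incl (lmod_pi _ z) = lmod_pi _ (cycle_incl z).
Proof.
apply/lmod_piE.
have : lmod_repr (lmod_pi (GRing.SubmodClosed.clone k _ (@bounding k V K n) _) z)
    - z \in @bounding k V K n.
  by apply/lmod_piE; rewrite lmod_reprK.
move=> /asboolP[b Kb e]; apply/asboolP.
by exists b; [exact: is_chain_incl|].
Qed.

Lemma homology_incl_is_linear : linear homology_incl.
Proof.
move=> a x y; rewrite -[x]lmod_reprK -[y]lmod_reprK -linearP.
rewrite !homology_incl_pi -linearP; congr (lmod_pi _ _).
exact: val_inj.
Qed.

HB.instance Definition _ := GRing.isLinear.Build k _ _ _ homology_incl
  homology_incl_is_linear.

End InducedMap.

Section PH.
Context {V : choiceType} (F : filtration V) (i : nat).

Definition PH_map (r s : {posnum R}) (h : r <= s) :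
    {linear homology k (F r) i -> homology k (F s) i} :=
  homology_incl (@stage_mono _ F _ _ h).

Lemma PH_map_id r (h : r <= r) x : PH_map h x = x.
Proof.
rewrite -[x]lmod_reprK /PH_map/= homology_incl_pi; congr (lmod_pi _ _).
exact: val_inj.
Qed.

Lemma PH_map_comp r s t (h1 : r <= s) (h2 : s <= t) (h3 : r <= t) x :
  PH_map h3 x = PH_map h2 (PH_map h1 x).
Proof.
rewrite -[x]lmod_reprK /PH_map/=; move: (lmod_repr x) => z.
rewrite (homology_incl_pi (stage_mono h1)) !homology_incl_pi.
congr (lmod_pi _ _); exact: val_inj.
Qed.

Definition PH : persistence_module {posnum R} :=
  PersistenceModule PH_map_id PH_map_comp.

End PH.
End Persistence.

Section Filtrations.
Context {R : realType}.

Lemma VR_mono (V : choiceType) (d : V -> V -> \bar R) (Z : set V)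
    (r s : {posnum R}) :
  r <= s -> simplex (VR d Z r%:num) `<=` simplex (VR d Z s%:num).
Proof.
move=> rs t [t0 tZ tr]; split=> //; apply: le_trans tr _.
by rewrite lee_fin.
Qed.

Definition VR_filtration (V : choiceType) (d : V -> V -> \bar R) (Z : set V) :
    filtration V :=
  Filtration (@VR_mono V d Z).

Lemma wedge_mono (V W : choiceType) (F : filtration V) (F' : filtration W)
    (v0 : V) (w0 : W) (r s : {posnum R}) :
  r <= s -> simplex (wedge (F r) (F' r) v0 w0) `<=`
            simplex (wedge (F s) (F' s) v0 w0).
Proof.
move=> rs t [[u Fu ->]|[u Fu ->]]; [left|right]; exists u => //;
  exact: stage_mono Fu.
Qed.

Definition wedge_filtration (V W : choiceType) (F : filtration V)
    (F' : filtration W) (v0 : V) (w0 : W) : filtration (V + W)%type :=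
  Filtration (@wedge_mono V W F F' v0 w0).

End Filtrations.

(* Main.v *)
(* The fold map from the wedge VR(X;r) v VR(Y;r) to VR(X u Y;r) is simplicial
   and commutes with the inclusions in r, so it is enough to show that it is
   bijective on homology for each r. By Mayer-Vietoris bookkeeping on ordered
   chains this follows from two relative statements: the pair
   (VR(X u Y;r), VR(X;r) u VR(Y;r)) and the pair (VR(A;r), a0) have no relative
   homology. Both come from coning off simplices, grouped by their vertices
   outside a subset B, with an apex in B depending only on the group.

   For the first pair B = A. The simplices with vertex set S outside A, where S
   meets both X and Y, need a point of A that is within r of S and of every
   point of A within r of S. Let gm : [0, alpha] -> G_A be the arc length
   parametrization. A walk leaving G_A at a vertex and coming back at another
   closes up, along G_A, to a cycle; so its length exceeds 2 alpha (in G_Y; in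
   G_X only for walks between the two ends, but these are the only exits by the
   degree condition). Hence distances in G_A are |s - t|; a point of X \ A sees
   G_A through its ends only, with distances p, q to them such that
   p + q >= 2 alpha or |p - q| = alpha; and a point y of Y \ A at distances
   m, n < alpha from the ends sees G_A through a single vertex. If neither end
   of G_A is within r of S, the last case occurs and any point of A with
   parameter in [alpha - n, m] will do. Such a point exists because A is dense
   in G_A, VR(A;r) being connected for all r > 0. Density is also what makes
   (VR(A;r), a0) relatively acyclic. *)

Require Import Defs.
From HB Require Import structures.
From mathcomp Require Import all_boot all_order all_algebra.
From mathcomp Require Import finmap monalg.
From mathcomp Require Import all_classical all_reals all_analysis.
From mathcomp Require Import ring lra.

Set Implicit Arguments.
Unset Strict Implicit.
Unset Printing Implicit Defensive.

Import Order.TTheory GRing.Theory Num.Theory.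
Import numFieldNormedType.Exports.

Local Open Scope classical_set_scope.
Local Open Scope ring_scope.

(** * Chains and the augmented boundary *)

Section Chains.
Context {k : fieldType}.

(** The constant 3 is spent as 2 + 1: closing up an excursion along G_A costs at most [alpha], so
    more than [2 * alpha] remains for the excursion itself. In Y this forbids two walks shorter than
    [alpha] from one point to enter G_A at different vertices; in X it makes any two points of A
    within r of a common point of X \ A lie within r of each other, which reduces the requirements
    on the apex to being close to S. The interval [alpha - n, m] has to be nondegenerate, since
    density gives no point of A at a prescribed parameter; hence the strict bound alpha < m + n,
    which for a vertex y rests on the lower bound for the lengths of its incident edges. An apex
    that depends only on the group is what makes coning work: a face in the same group is coned with
    the same apex and cancels, and every other term lies in a group with fewer vertices. The
    complexes may be infinite, but each chain is finite, so finitely many rounds suffice. *)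

Definition linear_extension {V W : choiceType} (g : V -> {malg k[W]})
    (c : {malg k[V]}) : {malg k[W]} :=
  \sum_(s <- msupp c) c@_s *: g s.

Section LinearExtension.
Context {V W : choiceType}.
Implicit Types (g : V -> {malg k[W]}) (c : {malg k[V]}).

Lemma linear_extensionE g (D : {fset V}) c : (msupp c `<=` D)%fset ->
  linear_extension g c = \sum_(s <- D) c@_s *: g s.
Proof.
move=> cD; rewrite /linear_extension (big_fset_incl _ cD)//=.
by move=> s _ /mcoeff_outdom ->; rewrite scale0r.
Qed.

Lemma linear_extension_is_linear g : linear (linear_extension g).
Proof.
move=> a c c'; pose D := (msupp c `|` msupp c')%fset.
rewrite (@linear_extensionE g D c) ?fsubsetUl//.
rewrite (@linear_extensionE g D c') ?fsubsetUr// (@linear_extensionE g D).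
  rewrite scaler_sumr -big_split/=; apply: eq_bigr => s _.
  by rewrite mcoeffD mcoeffZ scalerDl scalerA.
by apply: fsubset_trans (msuppD_le _ _) _; apply: fsetSU; exact: msuppZ_le.
Qed.

HB.instance Definition _ g := GRing.isLinear.Build k {malg k[V]} {malg k[W]}
  *:%R (linear_extension g) (linear_extension_is_linear g).

Lemma linear_extensionU g s : linear_extension g << s >> = g s.
Proof.
rewrite /linear_extension msuppU oner_eq0 big_seq_fset1 mcoeffUU.
by rewrite scale1r.
Qed.

Lemma eq_linear_extension g g' c : {in msupp c, g =1 g'} ->
  linear_extension g c = linear_extension g' c.
Proof. by move=> gg'; apply: eq_big_seq => s /gg' ->. Qed.

End LinearExtension.

Lemma linear_extension_id {V : choiceType} (c : {malg k[V]}) :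
  linear_extension (fun s => << s >>) c = c.
Proof.
rewrite [RHS]monalgE; apply: eq_bigr => s _.
by apply/malgP => t; rewrite mcoeffZ !mcoeffU mulrnAr mulr1.
Qed.

Lemma linear_extension_comp {V W U : choiceType}
    (f : {linear {malg k[W]} -> {malg k[U]}}) (g : V -> {malg k[W]}) c :
  f (linear_extension g c) = linear_extension (f \o g) c.
Proof. by rewrite linear_sum; apply: eq_bigr => s _; rewrite linearZ. Qed.

Definition carried {V : choiceType} (P : V -> Prop) (c : {malg k[V]}) :=
  forall s, s \in msupp c -> P s.

Section Carried.
Context {V : choiceType}.
Implicit Types (P : V -> Prop) (c : {malg k[V]}).

Lemma carried0 P : carried P 0.
Proof. by move=> s; rewrite msupp0. Qed.

Lemma carriedU P s : P s -> carried P << s >>.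
Proof. by move=> Ps t; rewrite msuppU oner_eq0 inE => /eqP ->. Qed.

Lemma carriedD P c c' : carried P c -> carried P c' -> carried P (c + c').
Proof.
by move=> Pc Pc' s /(fsubsetP (msuppD_le _ _)); rewrite inE => /orP[/Pc|/Pc'].
Qed.

Lemma carriedZ P a c : carried P c -> carried P (a *: c).
Proof. by move=> Pc s /(fsubsetP (msuppZ_le _ _)) /Pc. Qed.

Lemma carriedN P c : carried P c -> carried P (- c).
Proof. by move=> Pc s; rewrite msuppN => /Pc. Qed.

Lemma carriedB P c c' : carried P c -> carried P c' -> carried P (c - c').
Proof. by move=> Pc /carriedN; exact: carriedD. Qed.

Lemma carried_sum P (I : eqType) (r : seq I) (Q : pred I)
    (F : I -> {malg k[V]}) :
  (forall i, i \in r -> Q i -> carried P (F i)) ->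
  carried P (\sum_(i <- r | Q i) F i).
Proof.
move=> PF; rewrite big_seq_cond; apply: (big_ind (carried P)).
- exact: carried0.
- by move=> c c'; exact: carriedD.
- by move=> i /andP[]; exact: PF.
Qed.

Lemma sub_carried P P' c : (forall s, P s -> P' s) ->
  carried P c -> carried P' c.
Proof. by move=> PP' Pc s /Pc /PP'. Qed.

End Carried.

Lemma carried_linear_extension {V W : choiceType} (P : V -> Prop)
    (P' : W -> Prop) (g : V -> {malg k[W]}) c :
  (forall s, P s -> carried P' (g s)) -> carried P c ->
  carried P' (linear_extension g c).
Proof.
by move=> Pg Pc; apply: carried_sum => s /Pc /Pg ? _; exact: carriedZ.
Qed.

Section Augmented.
Context {V : choiceType}.
Implicit Types (s t : seq V) (c : chain k V).

Definition aug_seq_boundary s : chain k V :=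
  \sum_(i < size s) (-1) ^+ i *: << seq_face i s >>.

(* The boundary of the augmented complex, in which the empty sequence spans
   degree -1. *)
Definition aug_boundary : chain k V -> chain k V :=
  linear_extension aug_seq_boundary.

HB.instance Definition _ := GRing.Linear.on aug_boundary.

Definition cone (v : V) : chain k V -> chain k V :=
  linear_extension (fun s => << v :: s >>).

HB.instance Definition _ v := GRing.Linear.on (cone v).

(** Face 0 drops the cone point and the other faces keep it, shifted by one place, whence the minus
    sign. Counting [[::]] as a face of a single vertex makes this valid in every degree. *)
Lemma aug_seq_boundary_cons v s :
  aug_seq_boundary (v :: s) = << s >> - cone v (aug_seq_boundary s).
Proof.
rewrite /aug_seq_boundary big_ord_recl expr0 scale1r /seq_face /= drop0.
congr (_ + _); rewrite (linear_sum (cone v)) -sumrN; apply: eq_bigr => i _ /=.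
by rewrite linearZ/= /cone linear_extensionU exprS mulN1r scaleNr.
Qed.

Lemma aug_boundary_cone v c :
  aug_boundary (cone v c) = c - cone v (aug_boundary c).
Proof.
rewrite /aug_boundary {1}/cone linear_extension_comp.
rewrite (linear_extension_comp (cone v)) -[X in X - _]linear_extension_id.
rewrite /linear_extension -sumrB; apply: eq_bigr => s _ /=.
rewrite -scalerBr -/(linear_extension _ _) linear_extensionU.
by rewrite aug_seq_boundary_cons.
Qed.

(** The cone formula replaces the usual pairing of double faces: applied twice to [v :: s] it leaves
    the cone on the double boundary of [s], which vanishes by induction. *)
Lemma aug_boundaryK c : aug_boundary (aug_boundary c) = 0.
Proof.
rewrite {2}/aug_boundary linear_extension_comp.
rewrite /linear_extension big1// => s _ /=.
suff -> : aug_boundary (aug_seq_boundary s) = 0 by rewrite scaler0.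
elim: s => [|v s IH]; first by rewrite /aug_seq_boundary big_ord0 linear0.
rewrite aug_seq_boundary_cons linearB /= aug_boundary_cone IH linear0 subr0.
by rewrite /aug_boundary linear_extensionU subrr.
Qed.

Lemma size_seq_face i s : (i < size s)%N -> size (seq_face i s) = (size s).-1.
Proof.
move=> lt_is; rewrite /seq_face size_cat size_drop size_takel; last exact: ltnW.
by rewrite -subn1 -[in RHS](subnKC lt_is) addSn subn1.
Qed.

Lemma mem_seq_face i s x : x \in seq_face i s -> x \in s.
Proof. by rewrite /seq_face mem_cat => /orP[/mem_take|/mem_drop]. Qed.

Lemma boundaryS n c : carried (fun s => size s = n.+2) c ->
  boundary c = aug_boundary c.
Proof.
move=> cn; rewrite /boundary /aug_boundary /linear_extension.
apply: eq_big_seq => s /cn ns.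
by rewrite /seq_boundary {1}ns.
Qed.

Lemma boundary_size1 c : carried (fun s => size s = 1%N) c -> boundary c = 0.
Proof.
move=> cn; rewrite /boundary big_seq big1// => s /cn ns.
by rewrite /seq_boundary ns scaler0.
Qed.

Lemma aug_boundary_size1 c : carried (fun s => size s = 1%N) c ->
  carried (fun s => s = [::]) (aug_boundary c).
Proof.
apply: carried_linear_extension; case=> [|x [|y s]]// _.
rewrite /aug_seq_boundary big_ord1 expr0 scale1r.
by apply: carriedU.
Qed.

Lemma carried_aug_boundary (P P' : seq V -> Prop) c :
  (forall s i, P s -> (i < size s)%N -> P' (seq_face i s)) ->
  carried P c -> carried P' (aug_boundary c).
Proof.
move=> PP'; apply: carried_linear_extension => s Ps.
apply: carried_sum => i _ _; apply: carriedZ; apply: carriedU.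
exact: (PP' _ _ Ps).
Qed.

End Augmented.
End Chains.

(** * Coning off simplices *)

Section Collapse.
Context {k : fieldType} {V : choiceType}.
Implicit Types (K L : complex V) (s t : seq V) (c : chain k V).

Lemma mem_fset_seq s x : (x \in [fset y in s]%fset) = (x \in s).
Proof. by rewrite inE. Qed.

Lemma mem_fset_seq_if s (P : pred V) x :
  (x \in [fset y in s | P y]%fset) = (x \in s) && P x.
Proof. by rewrite !inE. Qed.

Lemma fset_seq_neq0 s : s != [::] -> [fset x in s]%fset != fset0.
Proof.
case: s => [//|x s] _; apply/fset0Pn; exists x.
by rewrite mem_fset_seq mem_head.
Qed.

Lemma simplex_sub_seq K s t : simplex K [fset x in s]%fset ->
  {subset t <= s} -> t != [::] -> simplex K [fset x in t]%fset.
Proof.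
move=> Ks ts t0; apply: simplex_sub Ks _ (fset_seq_neq0 t0).
by apply/fsubsetP => x; rewrite !mem_fset_seq; exact: ts.
Qed.

Lemma seq_face_simplex K s i : simplex K [fset x in s]%fset ->
  seq_face i s != [::] -> simplex K [fset x in seq_face i s]%fset.
Proof. by move=> Ks; apply: simplex_sub_seq Ks _ => x /mem_seq_face. Qed.

Lemma is_chain_boundary K n c : is_chain K n.+1 c -> is_chain K n (boundary c).
Proof.
move=> Kc; rewrite (@boundaryS _ _ n); last by move=> s /Kc[].
apply: (@carried_aug_boundary k V _ _ c _ Kc) => s i [sn Ks] lt_is.
have fn : size (seq_face i s) = n.+1 by rewrite size_seq_face// sn.
by split=> //; apply: seq_face_simplex => //; rewrite -size_eq0 fn.
Qed.

Lemma boundaryK K n c : is_chain K n.+1 c -> boundary (boundary c) = 0.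
Proof.
move=> Kc; have Kbc := is_chain_boundary Kc.
case: n Kc Kbc => [|n] Kc Kbc.
  by apply: boundary_size1 => s /Kbc[].
rewrite (@boundaryS _ _ n); last by move=> s /Kbc[].
rewrite (@boundaryS _ _ n.+1); last by move=> s /Kc[].
exact: aug_boundaryK.
Qed.

(* The chain map id - dh - hd, where h cones off each simplex of bad type with
   an apex in B depending only on its type, strictly lowers the number of
   vertices outside B of the simplices of bad type. *)
Lemma collapse K (B : set V) (good : set {fset V}) (apex : {fset V} -> V) :
  let type s := [fset x in s | x \notin B]%fset in
  (forall T T' : {fset V}, good T -> (T' `<=` T)%fset -> good T') ->
  good fset0 ->
  (forall s, simplex K [fset x in s]%fset -> ~ good (type s) ->
    B (apex (type s)) /\ simplex K [fset x in apex (type s) :: s]%fset) ->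
  forall n c, is_chain K n c ->
  carried (fun s => good (type s)) (boundary c) ->
  exists l b, [/\ is_chain K n l, carried (fun s => good (type s)) l,
    is_chain K n.+1 b & c = l + boundary b].
Proof.
move=> type good_sub good0 apexP n.
pose h s : chain k V :=
  if `[< good (type s) >] then 0 else << apex (type s) :: s >>.
(* Rank 0 is equivalent to being good: [fset0] is good, so a bad type is nonempty. *)
pose rank s := if `[< good (type s) >] then 0%N else #|` type s|.
have h_good s : good (type s) -> h s = 0.
  by move=> gs; rewrite /h; case: asboolP.
have type_face s i : (type (seq_face i s) `<=` type s)%fset.
  apply/fsubsetP => x; rewrite !mem_fset_seq_if.
  by move=> /andP[/mem_seq_face -> ->].
have type_cons a s : B a -> type (a :: s) = type s.
  move=> Ba; apply/fsetP => x; rewrite !mem_fset_seq_if in_cons.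
  by case: eqVneq => [->|//]; rewrite (mem_set Ba) /= andbF.
have type_nil : type [::] = fset0.
  by apply/fsetP => x; rewrite mem_fset_seq_if inE.
have h_chain s m : size s = m.+1 -> simplex K [fset x in s]%fset ->
    is_chain K m.+1 (h s).
  move=> sm Ks; rewrite /h; case: asboolP => bad; first exact: is_chain0.
  by apply: carriedU; rewrite /= sm; split=> //; apply: (apexP _ _ _).2.
(* For bad [s] with apex [a], face 0 of the cone cancels [s], which leaves the signed sum of
   [a :: t] minus [h t] over the faces [t] of [s]. *)
pose phi s : chain k V := << s >> - aug_boundary (h s)
  - linear_extension h (aug_seq_boundary s).
pose low m s := [/\ size s = n.+1, simplex K [fset x in s]%fset
  & (rank s <= m)%N].
have phiP s : size s = n.+1 -> simplex K [fset x in s]%fset ->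
    carried (low (rank s).-1) (phi s).
  move=> sn Ks; rewrite /phi.
  have [gs|bs] := pselect (good (type s)).
    rewrite h_good// linear0 subr0 /aug_seq_boundary.
    rewrite (linear_sum (linear_extension h)) big1.
      rewrite subr0; apply: carriedU; split=> //.
      by rewrite /rank; case: asboolP.
    move=> i _; rewrite linearZ/= linear_extensionU h_good ?scaler0//.
    exact: good_sub gs (type_face _ _).
  rewrite {1}/h; case: asboolP => // _.
  rewrite /aug_boundary linear_extensionU aug_seq_boundary_cons.
  rewrite opprB addrCA subrr addr0 /aug_seq_boundary.
  rewrite (linear_sum (cone _)) (linear_sum (linear_extension h)) -sumrB.
  apply: carried_sum => i _ _.
  rewrite !linearZ/= /cone !linear_extensionU -scalerDr; apply: carriedZ.
  set t := seq_face i s.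
  have tn : size t = n by rewrite /t size_seq_face ?ltn_ord// sn.
  have Bapex := apexP _ Ks bs.
  (* A face of the same type has the same apex, so its two terms cancel; any other face has a
     strictly smaller type. *)
  have [tt|ntt] := eqVneq (type t) (type s).
    rewrite /h tt; case: asboolP => // _; rewrite subrr; exact: carried0.
  have lt_ts : (#|` type t| < #|` type s|)%N.
    apply: fproper_ltn_card; rewrite fproperEneq ntt /=; exact: type_face.
  have rank_t a : B a -> (rank (a :: t) <= (rank s).-1)%N.
    move=> Ba; rewrite {2}/rank; case: asboolP => // _.
    rewrite -ltnS prednK ?(leq_trans _ lt_ts)//.
    by rewrite /rank type_cons//; case: ifP => // _; exact: leq_trans lt_ts.
  apply: carriedB.
    apply: carriedU; split; [by rewrite /= tn| |exact: rank_t Bapex.1].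
    apply: simplex_sub_seq Bapex.2 _ _ => // x.
    rewrite !in_cons => /orP[->//|/mem_seq_face ->].
    by rewrite orbT.
  rewrite /h; case: asboolP => bt; first exact: carried0.
  have t0 : t != [::] by apply: contra_not_neq bt => ->; rewrite type_nil.
  have Kt := seq_face_simplex Ks t0.
  have [Bt Kat] := apexP _ Kt bt.
  apply: carriedU; split; [by rewrite /= tn|exact: Kat|exact: rank_t].
suff main m c : carried (low m) c ->
    carried (fun s => good (type s)) (boundary c) ->
    exists l b, [/\ is_chain K n l, carried (fun s => good (type s)) l,
    is_chain K n.+1 b & c = l + boundary b].
  move=> c Kc; apply: (main (\max_(s <- msupp c) rank s)%N) => s cs.
  by have [? ?] := Kc _ cs; split=> //; apply: leq_bigmax_seq.
elim: m c => [|m IH] c cm good_c.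
  exists c, 0; split; last by rewrite linear0 addr0.
  - by move=> s /cm[].
  - move=> s /cm[sn Ks]; rewrite leqn0 /rank; case: asboolP => // bs.
    rewrite cardfs_eq0 => /eqP T0; by case: bs; rewrite T0.
  - exact: is_chain0.
pose b := linear_extension h c.
have Kc : is_chain K n c by move=> s /cm[].
have Kb : is_chain K n.+1 b.
  apply: (carried_linear_extension _ Kc) => s [sn Ks]; exact: h_chain.
(* The homotopy kills good sequences. In degree 0 the augmented boundary is a multiple of [[::]],
   whose type [fset0] is good. *)
have hbc : linear_extension h (aug_boundary c) = 0.
  suff : carried (fun s => good (type s)) (aug_boundary c).
    move=> g; rewrite /linear_extension big_seq big1// => s /g gs.
    by rewrite h_good ?scaler0.
  case: (n) Kc => [|n'] Kc.
    apply: sub_carried (aug_boundary_size1 _); last by move=> s /Kc[].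
    by move=> s ->; rewrite type_nil.
  by rewrite -(@boundaryS _ _ n')// => s /Kc[].
have phic : linear_extension phi c = c - boundary b.
  rewrite (@boundaryS _ _ n); last by move=> s /Kb[].
  transitivity (c - aug_boundary b - linear_extension h (aug_boundary c));
    last by rewrite hbc subr0.
  rewrite /b (linear_extension_comp aug_boundary).
  rewrite (linear_extension_comp (linear_extension h)).
  rewrite -[X in X - _ - _]linear_extension_id.
  rewrite /linear_extension -!sumrB; apply: eq_bigr => s _ /=.
  by rewrite -!scalerBr.
have [||l [b' [Kl gl Kb' e]]] := IH (linear_extension phi c).
- apply: carried_sum => s sc _; apply: carriedZ.
  have [sn Ks sm] := cm _ sc.
  apply: sub_carried (phiP _ sn Ks) => u [un Ku um]; split=> //.
  by apply: leq_trans um _; rewrite -(leq_add2r 1) !addn1; case: (rank s) sm.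
- rewrite phic linearB /= (boundaryK Kb) subr0; exact: good_c.
exists l, (b' + b); split=> //; first exact: is_chainD.
by rewrite linearD /= addrA -e phic subrK.
Qed.

End Collapse.

(** * The fold map of a wedge *)

Section PushForward.
Context {k : fieldType}.

Lemma carried_or {V : choiceType} (P Q : V -> Prop) (c : {malg k[V]}) :
  carried (fun s => P s \/ Q s) c ->
  exists a b, [/\ carried P a, carried Q b & c = a + b].
Proof.
move=> PQc.
exists (linear_extension (fun s => if `[< P s >] then << s >> else 0) c).
exists (linear_extension (fun s => if `[< P s >] then 0 else << s >>) c).
split.
- apply: carried_linear_extension PQc => s PQ; case: asboolP => Ps.
    exact: carriedU.
  exact: carried0.
- apply: carried_linear_extension PQc => s PQ; case: asboolP => Ps.
    exact: carried0.
  by apply: carriedU; case: PQ.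
- rewrite -[LHS]linear_extension_id /linear_extension -big_split/=.
  by apply: eq_bigr => s _; rewrite -scalerDr; case: asboolP;
    rewrite ?addr0 ?add0r.
Qed.

Definition push {V W : choiceType} (g : V -> W) : chain k V -> chain k W :=
  linear_extension (fun s => << map g s >>).

HB.instance Definition _ (V W : choiceType) (g : V -> W) :=
  GRing.Linear.on (push g).

Lemma push_comp {V W U : choiceType} (g : V -> W) (h : W -> U) c :
  push h (push g c) = push (h \o g) c.
Proof.
rewrite {2}/push (linear_extension_comp (push h)).
apply: eq_linear_extension => s _ /=.
by rewrite /push linear_extensionU map_comp.
Qed.

Lemma push_carried_id {V : choiceType} (g : V -> V) c :
  carried (fun s => map g s = s) c -> push g c = c.
Proof.
move=> gc; rewrite -[RHS]linear_extension_id.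
by apply: eq_linear_extension => s /gc ->.
Qed.

Lemma push_id {V : choiceType} (g : V -> V) c : g =1 id -> push g c = c.
Proof. by move=> gid; apply: push_carried_id => s _; rewrite map_id_in. Qed.

Lemma carried_push {V W : choiceType} (g : V -> W) (P : seq V -> Prop)
    (Q : seq W -> Prop) c :
  (forall s, P s -> Q (map g s)) -> carried P c -> carried Q (push g c).
Proof.
move=> PQ; apply: carried_linear_extension => s Ps.
by apply: carriedU; exact: PQ.
Qed.

Lemma push_boundary {V W : choiceType} (g : V -> W) c :
  boundary (push g c) = push g (boundary c).
Proof.
transitivity (linear_extension (push g \o @seq_boundary k _) c);
  last by rewrite -linear_extension_comp.
rewrite (linear_extension_comp (@boundary k W)).
apply: eq_linear_extension => s _ /=.
transitivity (@seq_boundary k _ (map g s)).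
  exact: linear_extensionU.
rewrite /seq_boundary size_map; case: ifP => _; first by rewrite linear0.
rewrite linear_sum; apply: eq_bigr => i _.
rewrite linearZ /= /push linear_extensionU; congr (_ *: << _ >>).
by rewrite /seq_face map_cat map_take map_drop.
Qed.

Lemma fset_map {V W : choiceType} (g : V -> W) s :
  [fset x in map g s]%fset = [fset g x | x in [fset x in s]]%fset.
Proof.
apply/fsetP => y; rewrite mem_fset_seq; apply/mapP/imfsetP => /=.
  by move=> [x xs ->]; exists x => //; rewrite mem_fset_seq.
by move=> [x]; rewrite mem_fset_seq => xs ->; exists x.
Qed.

Lemma is_chain_push {V W : choiceType} (g : V -> W) (K : complex V)
    (L : complex W) :
  (forall s, simplex K s -> simplex L (g @` s)%fset) ->
  forall n c, is_chain K n c -> is_chain L n (push g c).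
Proof.
move=> KL n c; apply: carried_push => s [sn Ks].
by split; [rewrite size_map|rewrite fset_map; exact: KL].
Qed.

Section HomologyPush.
Context {V W : choiceType} (g : V -> W) (K : complex V) (L : complex W).
Hypothesis KL : forall s, simplex K s -> simplex L (g @` s)%fset.
Variable n : nat.

Lemma cycles_push (z : cycle_mod k K n) : cycles L n (push g (val z)).
Proof.
have /asboolP[Kz bz] := valP z.
apply/asboolP; split; first exact: is_chain_push Kz.
by rewrite push_boundary bz linear0.
Qed.

Definition cycle_push (z : cycle_mod k K n) : cycle_mod k L n :=
  Sub (push g (val z)) (cycles_push z).

Definition homology_push (x : homology k K n) : homology k L n :=
  lmod_pi _ (cycle_push (lmod_repr x)).

Lemma homology_push_pi (z : cycle_mod k K n) :
  homology_push (lmod_pi _ z) = lmod_pi _ (cycle_push z).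
Proof.
apply/lmod_piE.
have : lmod_repr (lmod_pi (GRing.SubmodClosed.clone k _ (@bounding k V K n) _) z)
    - z \in @bounding k V K n.
  by apply/lmod_piE; rewrite lmod_reprK.
move=> /asboolP[b Kb e]; apply/asboolP.
exists (push g b); first exact: is_chain_push Kb.
by rewrite push_boundary -e /= linearB.
Qed.

Lemma homology_push_is_linear : linear homology_push.
Proof.
move=> a x y; rewrite -[x]lmod_reprK -[y]lmod_reprK -linearP.
rewrite !homology_push_pi -linearP; congr (lmod_pi _ _).
by apply: val_inj; rewrite /= linearP.
Qed.

HB.instance Definition _ := GRing.isLinear.Build k _ _ _ homology_push
  homology_push_is_linear.

Lemma homology_push_bij :
  (forall c, is_chain K n c -> boundary c = 0 ->
    forall b, is_chain L n.+1 b -> push g c = boundary b ->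
    exists2 b', is_chain K n.+1 b' & c = boundary b') ->
  (forall c, is_chain L n c -> boundary c = 0 ->
    exists z b, [/\ is_chain K n z, boundary z = 0, is_chain L n.+1 b
      & c = push g z + boundary b]) ->
  bijective homology_push.
Proof.
move=> inj surj.
have homology_push_inj : injective homology_push.
  suff ker0 (x : homology k K n) : homology_push x = 0 -> x = 0.
    exact: raddf_inj.
  rewrite -[x]lmod_reprK homology_push_pi; move: (lmod_repr x) => z.
  rewrite -(linear0 (@lmod_pi k _ _)) => /lmod_piE /asboolP[b Lb].
  rewrite subr0 /= => e; have /asboolP[Kz bz] := valP z.
  have [b' Kb' e'] := inj _ Kz bz b Lb e.
  rewrite -(linear0 (@lmod_pi k _ _)); apply/lmod_piE/asboolP.
  by exists b' => //; rewrite subr0.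
have homology_push_surj y : exists x, homology_push x == y.
  rewrite -[y]lmod_reprK; move: (lmod_repr y) => w.
  have /asboolP[Lw bw] := valP w.
  have [z [b [Kz bz Lb e]]] := surj _ Lw bw.
  have cz : cycles K n z by apply/asboolP.
  exists (lmod_pi _ (Sub z cz : cycle_mod k K n)); apply/eqP.
  rewrite homology_push_pi; apply/lmod_piE/asboolP.
  exists (- b); first by rewrite -scaleN1r; exact: is_chainZ.
  by rewrite /= e opprD addNKr linearN.
exists (fun y => xchoose (homology_push_surj y)) => [x|y].
  apply: homology_push_inj; apply/eqP.
  exact: (xchooseP (homology_push_surj _)).
by apply/eqP; exact: (xchooseP (homology_push_surj _)).
Qed.

End HomologyPush.
Lemma homology_push_incl {V W : choiceType} (g : V -> W) (K K' : complex V)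
    (L L' : complex W) (KL : forall s, simplex K s -> simplex L (g @` s)%fset)
    (KL' : forall s, simplex K' s -> simplex L' (g @` s)%fset)
    (KK' : simplex K `<=` simplex K') (LL' : simplex L `<=` simplex L') n
    (x : homology k K n) :
  homology_push KL' (homology_incl KK' x) =
  homology_incl LL' (homology_push KL x).
Proof.
rewrite -[x]lmod_reprK; move: (lmod_repr x) => z.
rewrite homology_push_pi !homology_incl_pi homology_push_pi.
by congr (lmod_pi _ _); apply: val_inj.
Qed.

End PushForward.

Section WedgeFold.
Context {V : choiceType} (a0 : V).

Definition wedge_fold (x : V + V) : V :=
  match x with inl v => v | inr v => v end.

Lemma wedge_fold_inr v : wedge_fold (wedge_inr a0 a0 v) = v.
Proof. by rewrite /wedge_inr; case: eqP => [->|]. Qed.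

Definition union_simplex (K L : complex V) (s : seq V) : Prop :=
  simplex K [fset x in s]%fset \/ simplex L [fset x in s]%fset.

Definition inter_simplex (K L : complex V) (s : seq V) : Prop :=
  simplex K [fset x in s]%fset /\ simplex L [fset x in s]%fset.

Definition at_base (s : seq V) : Prop := forall x, x \in s -> x = a0.

Section Stage.
Context {k : fieldType} (KX KY K : complex V).
Hypothesis KX_K : simplex KX `<=` simplex K.
Hypothesis KY_K : simplex KY `<=` simplex K.

Lemma wedge_fold_simplex s : simplex (wedge KX KY a0 a0) s ->
  simplex K (wedge_fold @` s)%fset.
Proof.
have fold_im (g : V -> V + V) t : (forall v, wedge_fold (g v) = v) ->
    (wedge_fold @` [fset g x | x in t] = t)%fset.
  move=> gK; apply/fsetP => y; apply/imfsetP/idP => /=.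
    by move=> [_ /imfsetP[/= x xt ->] ->]; rewrite gK.
  move=> yt; exists (g y); last by rewrite gK.
  by apply/imfsetP; exists y.
move=> [[t Kt ->]|[t Kt ->]]; rewrite fold_im//; [exact: KX_K|exact: KY_K|].
exact: wedge_fold_inr.
Qed.

Hypothesis relK : forall n (c : chain k V), is_chain K n c ->
  carried (union_simplex KX KY) (boundary c) ->
  exists l b, [/\ is_chain K n l, carried (union_simplex KX KY) l,
    is_chain K n.+1 b & c = l + boundary b].
Hypothesis rel_inter : forall n (c : chain k V),
  carried (fun s => size s = n.+1 /\ inter_simplex KX KY s) c ->
  carried at_base (boundary c) ->
  exists e a, [/\ carried (fun s => size s = n.+1 /\ at_base s) e,
    carried (fun s => size s = n.+2 /\ inter_simplex KX KY s) a
    & c = e + boundary a].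

Let i1 (v : V) : V + V := inl v.
Let i2 (v : V) : V + V := wedge_inr a0 a0 v.

Let push_fold1 c : push wedge_fold (push i1 c) = c :> chain k V.
Proof. by rewrite push_comp push_id. Qed.

Let push_fold2 c : push wedge_fold (push i2 c) = c :> chain k V.
Proof. by rewrite push_comp push_id// => v; exact: wedge_fold_inr. Qed.

Let W := wedge KX KY a0 a0.

Let i1_simplex s : simplex KX s -> simplex W (i1 @` s)%fset.
Proof. by move=> Ks; left; exists s. Qed.

Let i2_simplex s : simplex KY s -> simplex W (i2 @` s)%fset.
Proof. by move=> Ks; right; exists s. Qed.

Let push_at_base n (c : chain k V) :
  carried (fun s => size s = n.+1 /\ at_base s) c -> push i1 c = push i2 c.
Proof.
move=> ac; apply: eq_linear_extension => s /ac[_ sa0]; congr << _ >>.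
by apply/eq_in_map => x /sa0 ->; rewrite /i1 /i2 /wedge_inr eqxx.
Qed.

Let split_union n c : is_chain K n c -> carried (union_simplex KX KY) c ->
  exists x y, [/\ is_chain KX n x, is_chain KY n y & c = x + y :> chain k V].
Proof.
move=> Kc uc; apply: carried_or => s cs.
have [sn _] := Kc _ cs.
by have [] := uc _ cs => Ks; [left|right].
Qed.

Let split_wedge n c : is_chain W n c -> exists x y,
  [/\ is_chain KX n x, is_chain KY n y & c = push i1 x + push i2 y :> chain k _].
Proof.
move=> Wc.
(* [wedge_fold] is a left inverse of both inclusions, so a sequence in the image of one of them is
   recovered by folding and including again. *)
have im_case (g : V -> V + V) (L : complex V) s t :
    (forall v, wedge_fold (g v) = v) -> simplex L t ->
    [fset x in s]%fset = [fset g x | x in t]%fset ->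
    simplex L [fset x in map wedge_fold s]%fset /\
    map (g \o wedge_fold) s = s.
  move=> gK Lt st.
  have sg x : x \in s -> exists2 y, y \in t & x = g y.
    by rewrite -mem_fset_seq st => /imfsetP.
  split; last first.
    by rewrite map_id_in// => x /sg[y _ ->] /=; rewrite gK.
  suff -> : [fset x in map wedge_fold s]%fset = t by [].
  apply/fsetP => y; rewrite mem_fset_seq; apply/mapP/idP => /=.
    by move=> [_ /sg[x xt ->] ->]; rewrite gK.
  move=> yt; exists (g y); last by rewrite gK.
  by rewrite -mem_fset_seq st; apply/imfsetP; exists y.
have [] := @carried_or k _
  (fun s => (size s = n.+1 /\ simplex KX [fset x in map wedge_fold s]%fset)
    /\ map (i1 \o wedge_fold) s = s)
  (fun s => (size s = n.+1 /\ simplex KY [fset x in map wedge_fold s]%fset)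
    /\ map (i2 \o wedge_fold) s = s) c.
  move=> s /Wc[sn [[t Kt st]|[t Kt st]]]; [left|right].
    by have [] := im_case i1 KX s t (fun=> erefl) Kt st.
  by have [] := im_case i2 KY s t wedge_fold_inr Kt st.
move=> x [y [cx cy ->]]; exists (push wedge_fold x), (push wedge_fold y).
split.
- by apply: carried_push cx => s [[sn Ks] _]; rewrite size_map.
- by apply: carried_push cy => s [[sn Ks] _]; rewrite size_map.
- rewrite !push_comp (push_carried_id (fun s h => (cx s h).2)).
  by rewrite (push_carried_id (fun s h => (cy s h).2)).
Qed.

(** Splitting a chain of the union into an X part and a Y part is ambiguous by a chain of the
    intersection. Relative acyclicity of the intersection pushes this ambiguity to [a0], where the
    two inclusions into the wedge agree. *)
Lemma wedge_fold_bij n :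
  bijective (@homology_push k _ _ _ W K wedge_fold_simplex n).
Proof.
apply: homology_push_bij => [c Wc bc b Kb cb|c Kc bc].
  have [x [y [Kx Ky cE]]] := split_wedge Wc.
  have fc : push wedge_fold c = x + y.
    by rewrite cE linearD /= push_fold1 push_fold2.
  have [l [b1 [Kl ul Kb1 bE]]] : exists l b1, [/\ is_chain K n.+1 l,
      carried (union_simplex KX KY) l, is_chain K n.+2 b1 & b = l + boundary b1].
    apply: relK => //; rewrite -cb fc; apply: carriedD.
      by apply: sub_carried Kx => s [_ ?]; left.
    by apply: sub_carried Ky => s [_ ?]; right.
  have [bx [By [Kbx Kby lE]]] := split_union Kl ul.
  have bl : boundary b = boundary bx + boundary By.
    by rewrite bE linearD /= (boundaryK Kb1) addr0 lE linearD.
  (* The second form of [d], given by [dE], shows that it also lives in [KY], hence in the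
     intersection. *)
  pose d := x - boundary bx.
  have dE : d = boundary By - y.
    apply/eqP; rewrite /d subr_eq addrAC eq_sym subr_eq addrC -bl -cb.
    by rewrite fc.
  have Xd : is_chain KX n d by apply: carriedB => //; exact: is_chain_boundary.
  have Yd : is_chain KY n d.
    by rewrite dE; apply: carriedB => //; exact: is_chain_boundary.
  have bd : boundary d = boundary x.
    by rewrite linearB /= (boundaryK Kbx) subr0.
  (* The boundaries of the two parts cancel in the wedge, so this one lies in the images of both
     inclusions, which meet only in the base point. *)
  have bx_base : carried at_base (boundary x).
    rewrite -(push_fold1 (boundary x)).
    have e : push i1 (boundary x) = - push i2 (boundary y).
      apply/eqP; rewrite -addr_eq0 -!push_boundary -linearD /=.
      by rewrite -cE bc.
    have P1 : carried
        (fun s : seq (V + V) => forall z, z \in s -> exists v, z = i1 v)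
        (push i1 (boundary x)).
      apply: (@carried_push _ _ _ _ (fun=> True)) => // s _ z.
      by move=> /mapP[v _ ->]; exists v.
    have P2 : carried
        (fun s : seq (V + V) => forall z, z \in s -> exists v, z = i2 v)
        (push i1 (boundary x)).
      rewrite e; apply: carriedN.
      apply: (@carried_push _ _ _ _ (fun=> True)) => // s _ z.
      by move=> /mapP[v _ ->]; exists v.
    apply: (@carried_push _ _ _ _
      (fun s : seq (V + V) => forall z, z \in s -> z = i1 a0)).
      by move=> s sa0 _ /mapP[z /sa0 -> ->].
    move=> s sx z zs; have [v zv] := P1 _ sx _ zs; have [v'] := P2 _ sx _ zs.
    by rewrite zv /i1 /i2 /wedge_inr; case: eqP => // _ [->].
  have [e [a [be ia dE']]] : exists e a,
     [/\ carried (fun s => size s = n.+1 /\ at_base s) e,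
      carried (fun s => size s = n.+2 /\ inter_simplex KX KY s) a
      & d = e + boundary a].
    apply: rel_inter; last by rewrite bd.
    by move=> s ds; have [sn ?] := Xd _ ds; have [_ ?] := Yd _ ds.
  have Xa : is_chain KX n.+1 a by apply: sub_carried ia => s [? []].
  have Ya : is_chain KY n.+1 a by apply: sub_carried ia => s [? []].
  have xE : x = boundary (bx + a) + e.
    by rewrite linearD /= -addrA [_ a + e]addrC -dE' addrC /d subrK.
  have yE : y = boundary (By - a) - e.
    rewrite linearB /= -addrA -opprD [_ a + e]addrC -dE' dE.
    by rewrite opprB addrC subrK.
  (* The remainder [e] occurs with opposite signs in [x] and [y], and both inclusions send it to the
     same chain. *)
  exists (push i1 (bx + a) + push i2 (By - a)).
    apply: is_chainD.
      by apply: (is_chain_push i1_simplex); exact: is_chainD.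
    by apply: (is_chain_push i2_simplex); exact: carriedB.
  rewrite linearD /= !push_boundary cE xE yE [push i1 _]linearD.
  rewrite [push i2 (_ - _)]linearB /= (push_at_base be).
  by rewrite addrACA subrr addr0.
have [l [b [Kl ul Kb cE]]] : exists l b, [/\ is_chain K n l,
    carried (union_simplex KX KY) l, is_chain K n.+1 b & c = l + boundary b].
  by apply: relK => //; rewrite bc; exact: carried0.
have [x [y [Kx Ky lE]]] := split_union Kl ul.
have bl : boundary l = 0.
  by move: bc; rewrite cE linearD /= (boundaryK Kb) addr0.
have bxy : boundary x = - boundary y.
  by apply/eqP; rewrite -addr_eq0 -linearD /= -lE bl.
(* [x] and [y] need not lift to a cycle of the wedge; moving a chain [a] of the intersection from
   one part to the other corrects this without changing the sum. *)
suff [a [Xa Ya bza]] : exists a, [/\ is_chain KX n a, is_chain KY n a &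
    boundary (push i1 (x - a) + push i2 (y + a)) = 0].
  exists (push i1 (x - a) + push i2 (y + a)), b; split=> //.
    apply: is_chainD.
      by apply: (is_chain_push i1_simplex); exact: carriedB.
    by apply: (is_chain_push i2_simplex); exact: is_chainD.
  by rewrite linearD /= push_fold1 push_fold2 addrACA addNr addr0 -lE.
(* Homology is not reduced, so in degree 0 every chain is a cycle and there is nothing to
   correct. *)
case: n Kc Kl Kb Kx Ky => [|m] Kc Kl Kb Kx Ky.
  exists 0; split; [exact: is_chain0|exact: is_chain0|].
  apply: boundary_size1; apply: carriedD.
    apply: carried_push (carriedB Kx (@carried0 _ _ _)) => s [? _].
    by rewrite size_map.
  apply: carried_push (carriedD Ky (@carried0 _ _ _)) => s [? _].
  by rewrite size_map.
have [e [a [be ia dE]]] : exists e a,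
   [/\ carried (fun s => size s = m.+1 /\ at_base s) e,
    carried (fun s => size s = m.+2 /\ inter_simplex KX KY s) a
    & boundary x = e + boundary a].
  apply: rel_inter.
    have Xd := is_chain_boundary Kx.
    have Yd : is_chain KY m (boundary x).
      by rewrite bxy; apply: carriedN; exact: is_chain_boundary.
    by move=> s ds; have [sn ?] := Xd _ ds; have [_ ?] := Yd _ ds.
  by rewrite (boundaryK Kx); exact: carried0.
exists a; split.
- by apply: sub_carried ia => s [? []].
- by apply: sub_carried ia => s [? []].
rewrite linearD /= !push_boundary [boundary (x - a)]linearB.
rewrite [boundary (y + a)]linearD /= -[boundary y]opprK -bxy dE addrK.
by rewrite opprD subrK [push i2 _]linearN /= (push_at_base be) subrr.
Qed.

End Stage.

Lemma wedge_fold_pm_iso (R : realType) (k : fieldType)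
    (FX FY F : @filtration R V) i :
  (forall r, simplex (FX r) `<=` simplex (F r)) ->
  (forall r, simplex (FY r) `<=` simplex (F r)) ->
  (forall r n (c : chain k V), is_chain (F r) n c ->
    carried (union_simplex (FX r) (FY r)) (boundary c) ->
    exists l b, [/\ is_chain (F r) n l,
      carried (union_simplex (FX r) (FY r)) l,
      is_chain (F r) n.+1 b & c = l + boundary b]) ->
  (forall r n (c : chain k V),
    carried (fun s => size s = n.+1 /\ inter_simplex (FX r) (FY r) s) c ->
    carried at_base (boundary c) ->
    exists e a, [/\ carried (fun s => size s = n.+1 /\ at_base s) e,
      carried (fun s => size s = n.+2 /\ inter_simplex (FX r) (FY r) s) a
      & c = e + boundary a]) ->
  pm_iso (PH k (wedge_filtration FX FY a0 a0) i) (PH k F i).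
Proof.
move=> FXF FYF relF relI.
exists (fun r => @homology_push k _ _ _ _ _
    (wedge_fold_simplex (FXF r) (FYF r)) i :
  {linear homology k (wedge_filtration FX FY a0 a0 r) i -> homology k (F r) i}).
split=> [r|r s rs x].
  apply: wedge_fold_bij; [exact: relF|exact: relI].
exact: homology_push_incl.
Qed.

End WedgeFold.

(** * Walks and distances *)

Section Walks.
Context {R : realType} {G : metric_graph R}.
Implicit Types (H K : subgraph G) (e : edge G) (x y z : gpoint G)
  (w : seq (edge G * R * R)).

Lemma edge_pt_src e : edge_pt e 0 = inl (src e).
Proof. by rewrite /edge_pt insubF /= ?ltxx ?lexx. Qed.

Lemma edge_pt_tgt e : edge_pt e (len e) = inl (tgt e).
Proof. by rewrite /edge_pt insubF /= ?ltxx ?andbF// leNgt len_gt0. Qed.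

Lemma edge_pt_inner e t : 0 < t < len e ->
  exists2 p, edge_pt e t = inr p & val p = (e, t).
Proof. by move=> tP; rewrite /edge_pt insubT/=; eexists. Qed.

Variant edge_pt_spec e t : Prop :=
| EdgeSrc of t = 0 & edge_pt e t = inl (src e)
| EdgeTgt of t = len e & edge_pt e t = inl (tgt e)
| EdgeInner p of 0 < t < len e & edge_pt e t = inr p & val p = (e, t).

Lemma edge_ptP e t : 0 <= t <= len e -> edge_pt_spec e t.
Proof.
move=> /andP[t0 tl].
have [t0'|t0'] := eqVneq t 0.
  by apply: EdgeSrc; rewrite // t0' edge_pt_src.
have [tl'|tl'] := eqVneq t (len e).
  by apply: EdgeTgt; rewrite // tl' edge_pt_tgt.
have tP : 0 < t < len e by rewrite !lt_neqAle t0 tl tl' eq_sym t0'.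
by have [p pE vE] := edge_pt_inner tP; exact: (EdgeInner tP pE vE).
Qed.

Lemma edge_pt_inj e s e' s' : 0 < s < len e ->
  edge_pt e s = edge_pt e' s' -> e = e' /\ s = s'.
Proof.
move=> sP; have [p -> pE] := edge_pt_inner sP.
rewrite /edge_pt; case: insubP => // q _ qE [pq].
by move: qE; rewrite -pq pE => -[].
Qed.

Lemma carrier_edge_pt H e t : sedges H e -> carrier H (edge_pt e t).
Proof.
move=> He; rewrite /edge_pt; case: insubP => [p _ pE|_] /=; first by rewrite pE.
by case: ifP => _; [exact: sedges_src He|exact: sedges_tgt He].
Qed.

Lemma is_walk_carrier H x w y : is_walk H x w y -> carrier H y.
Proof.
by elim: w x => [x [Hx <-]//|[[e s] t] w IH x /= [_ _ _ _ /IH]].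
Qed.

Lemma is_walk_cat H x w y w' z :
  is_walk H x w y -> is_walk H y w' z -> is_walk H x (w ++ w') z.
Proof.
elim: w x => [x [_ ->]//|[[e s] t] w IH x /= [? ? ? ? wP] w'P].
by split=> //; exact: IH.
Qed.

Definition rev_walk w := rev [seq (p.1.1, p.2, p.1.2) | p <- w].

Lemma is_walk_rev H x w y : is_walk H x w y -> is_walk H y (rev_walk w) x.
Proof.
elim: w x => [x [Hx <-]//|[[e s] t] w IH x /= [He sP tP xE wP]].
rewrite /rev_walk /= rev_cons -cats1; apply: is_walk_cat (IH _ wP) _.
by split=> //; split; [exact: carrier_edge_pt|rewrite xE].
Qed.

Lemma walk_length_cons p w :
  walk_length (p :: w) = `|p.2 - p.1.2| + walk_length w.
Proof. by rewrite /walk_length big_cons. Qed.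

Lemma walk_length_nil : @walk_length R G [::] = 0.
Proof. by rewrite /walk_length big_nil. Qed.

Lemma walk_length_cat w w' :
  walk_length (w ++ w') = walk_length w + walk_length w'.
Proof. by rewrite /walk_length big_cat. Qed.

Lemma walk_length_rev w : walk_length (rev_walk w) = walk_length w.
Proof.
rewrite /walk_length /rev_walk (perm_big _ (permEl (perm_rev _))) big_map.
by apply: eq_bigr => p _ /=; rewrite distrC.
Qed.

Lemma walk_length_ge0 w : 0 <= walk_length w.
Proof. by rewrite /walk_length; apply: sumr_ge0. Qed.

Lemma is_walk_sub H K x w y : sverts H `<=` sverts K ->
  sedges H `<=` sedges K -> is_walk H x w y -> is_walk K x w y.
Proof.
move=> vHK eHK; elim: w x => [x [Hx <-]|[[e s] t] w IH x /= [? ? ? ? /IH ?]].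
  by split=> //; case: x Hx => [v|p] /=; [exact: vHK|exact: eHK].
by split=> //; exact: eHK.
Qed.

Lemma gdist_walk H x w y : is_walk H x w y ->
  (gdist H x y <= (walk_length w)%:E)%E.
Proof. by move=> wP; apply: ereal_inf_lbound; exists w. Qed.

Lemma gdist_lt H x y c : (gdist H x y < c)%E ->
  exists2 w, is_walk H x w y & ((walk_length w)%:E < c)%E.
Proof. by move=> /ereal_inf_lt[_ [w wP <-] wc]; exists w. Qed.

Lemma gdist_geP H x y c :
  (forall w, is_walk H x w y -> (c <= (walk_length w)%:E)%E) ->
  (c <= gdist H x y)%E.
Proof. by move=> cP; apply/ereal_infP => _ [w wP <-]; exact: cP. Qed.

Lemma gdist_ge0 H x y : (0 <= gdist H x y)%E.
Proof. by apply: gdist_geP => w _; rewrite lee_fin walk_length_ge0. Qed.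

Lemma gdistxx H x : carrier H x -> gdist H x x = 0%E.
Proof.
move=> Hx; apply/eqP; rewrite eq_le gdist_ge0 andbT.
by have := @gdist_walk H x [::] x; rewrite walk_length_nil; exact.
Qed.

Lemma gdistC H x y : gdist H x y = gdist H y x.
Proof.
suff le x' y' : (gdist H x' y' <= gdist H y' x')%E.
  by apply/eqP; rewrite eq_le !le.
apply: gdist_geP => w /is_walk_rev wP.
by rewrite -walk_length_rev; exact: gdist_walk.
Qed.

Lemma gdist_triangle H x y z :
  (gdist H x z <= gdist H x y + gdist H y z)%E.
Proof.
have lty_fin c : (0 <= c)%E -> (c < +oo)%E -> exists r : R, c = r%:E.
  by case: c => [r|//|//] _ _; exists r.
have [|xy] := leP +oo%E (gdist H x y).
  rewrite leye_eq => /eqP ->; rewrite addye ?leey// gt_eqF//.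
  by rewrite (lt_le_trans _ (gdist_ge0 _ _ _)).
have [|yz] := leP +oo%E (gdist H y z).
  rewrite leye_eq => /eqP ->; rewrite addey ?leey// gt_eqF//.
  by rewrite (lt_le_trans _ (gdist_ge0 _ _ _)).
have [a aE] := lty_fin _ (gdist_ge0 H x y) xy.
have [b bE] := lty_fin _ (gdist_ge0 H y z) yz.
apply/lee_addgt0Pr => eps eps0; rewrite aE bE.
have [|w wP wa] := @gdist_lt H x y (a + eps / 2)%:E.
  by rewrite aE lte_fin ltrDl divr_gt0.
have [|w' w'P w'b] := @gdist_lt H y z (b + eps / 2)%:E.
  by rewrite bE lte_fin ltrDl divr_gt0.
apply: le_trans (gdist_walk (is_walk_cat wP w'P)) _.
rewrite -!EFinD lee_fin walk_length_cat.
rewrite !lte_fin in wa w'b; lra.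
Qed.

End Walks.

(** * Oriented edge paths and cycles *)

Section Curves.
Context {R : realType} {G : metric_graph R}.
Implicit Types (H : subgraph G) (e : edge G) (x y : vertex G)
  (a : edge G * bool) (p q : seq (edge G * bool)).

Definition ostart a : vertex G := if a.2 then src a.1 else tgt a.1.
Definition oend a : vertex G := if a.2 then tgt a.1 else src a.1.

Fixpoint opath x p : bool :=
  if p is a :: p' then (ostart a == x) && opath (oend a) p' else true.

Definition olast x p : vertex G := last x (map oend p).
Definition oflip a : edge G * bool := (a.1, ~~ a.2).
Definition orev p := rev (map oflip p).
Definition plen p : R := \sum_(a <- p) len a.1.

Lemma plen_cons a p : plen (a :: p) = len a.1 + plen p.
Proof. by rewrite /plen big_cons. Qed.

Lemma plen_nil : plen [::] = 0.
Proof. by rewrite /plen big_nil. Qed.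

Lemma plen_cat p q : plen (p ++ q) = plen p + plen q.
Proof. by rewrite /plen big_cat. Qed.

Lemma plen_ge0 p : 0 <= plen p.
Proof. by apply: sumr_ge0 => a _; exact/ltW/len_gt0. Qed.

Lemma plen_rev p : plen (orev p) = plen p.
Proof. by rewrite /plen /orev (perm_big _ (permEl (perm_rev _))) big_map. Qed.

Lemma opath_cat x p q : opath x (p ++ q) = opath x p && opath (olast x p) q.
Proof. by elim: p x => [//|a p IH] x /=; rewrite IH andbA. Qed.

Lemma olast_cat x p q : olast x (p ++ q) = olast (olast x p) q.
Proof. by rewrite /olast map_cat last_cat. Qed.

Lemma ostart_flip a : ostart (oflip a) = oend a.
Proof. by case: a => e []. Qed.

Lemma oend_flip a : oend (oflip a) = ostart a.
Proof. by case: a => e []. Qed.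

Lemma opath_rev x p : opath x p ->
  opath (olast x p) (orev p) /\ olast (olast x p) (orev p) = x.
Proof.
elim: p x => [//|a p IH] x /= /andP[/eqP ax /IH[rp rl]].
rewrite /orev map_cons rev_cons -cats1 opath_cat olast_cat.
have -> : olast x (a :: p) = olast (oend a) p by [].
by rewrite rp rl /= ostart_flip eqxx /olast /= oend_flip ax.
Qed.

Lemma map_fst_rev p : map fst (orev p) = rev (map fst p).
Proof. by rewrite /orev map_rev -map_comp. Qed.

Lemma opath_verts_rev x p : opath x p ->
  olast x p :: map oend (orev p) = rev (x :: map oend p).
Proof.
elim: p x => [//|a p IH] x /= /andP[/eqP ax /IH e].
rewrite rev_cons -{}e /orev map_cons rev_cons map_rcons -rcons_cons.
by rewrite oend_flip ax.
Qed.

Lemma map_ostart x p : opath x p -> map ostart p = belast x (map oend p).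
Proof. by elim: p x => [//|a p IH] x /= /andP[/eqP -> /IH ->]. Qed.

Lemma opath_sub H x p : opath x p -> sverts H x ->
  {in map fst p, forall e, sedges H e} ->
  forall y, y \in x :: map oend p -> sverts H y.
Proof.
elim: p x => [|a p IH] x /= xp Hx Hp y.
  by rewrite inE => /eqP ->.
rewrite inE => /orP[/eqP ->//|]; case/andP: xp => _ xp; apply: IH => //.
  have Ha : sedges H a.1 by apply: Hp; rewrite mem_head.
  by rewrite /oend; case: a.2; [exact: sedges_tgt Ha|exact: sedges_src Ha].
by move=> e ep; apply: Hp; rewrite in_cons ep orbT.
Qed.

Definition oedge_pt a (t : R) : gpoint G :=
  edge_pt a.1 (if a.2 then t else len a.1 - t).

Lemma oedge_pt0 a : oedge_pt a 0 = inl (ostart a).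
Proof.
by case: a => e []; rewrite /oedge_pt /ostart /= ?subr0 ?edge_pt_src ?edge_pt_tgt.
Qed.

Lemma oedge_pt_len a : oedge_pt a (len a.1) = inl (oend a).
Proof.
by case: a => e []; rewrite /oedge_pt /oend /= ?subrr ?edge_pt_src ?edge_pt_tgt.
Qed.

(* Parametrized by arc length, and constant beyond plen p. *)
Fixpoint curve x p (t : R) : gpoint G :=
  if p is a :: p' then
    if t < len a.1 then oedge_pt a t else curve (oend a) p' (t - len a.1)
  else inl x.

Lemma curve0 x p : opath x p -> curve x p 0 = inl x.
Proof.
by case: p => [//|a p] /= /andP[/eqP <- _]; rewrite len_gt0 oedge_pt0.
Qed.

Lemma curve_end x p t : plen p <= t -> curve x p t = inl (olast x p).
Proof.
elim: p x t => [//|a p IH] x t /=; rewrite plen_cons => pt.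
have a0 := len_gt0 a.1; have p0 := plen_ge0 p.
by rewrite ltNge IH ?lerBrDl// (le_trans _ pt)//= lerDl.
Qed.

Lemma gdist_curve H x p s t : opath x p -> sverts H x ->
  {in map fst p, forall e, sedges H e} -> 0 <= s -> s <= t ->
  (gdist H (curve x p s) (curve x p t) <= (t - s)%:E)%E.
Proof.
elim: p x s t => [|a p IH] x s t /= xp Hx Hp s0 st.
  by rewrite gdistxx// lee_fin subr_ge0.
have Ha : sedges H a.1 by apply: Hp; rewrite mem_head.
have Hp' : {in map fst p, forall e, sedges H e}.
  by move=> e ep; apply: Hp; rewrite in_cons ep orbT.
case/andP: xp => _ xp.
have Hy : sverts H (oend a).
  by rewrite /oend; case: a.2; [exact: sedges_tgt Ha|exact: sedges_src Ha].
have seg s' t' : 0 <= s' -> s' <= t' -> t' <= len a.1 ->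
    (gdist H (oedge_pt a s') (oedge_pt a t') <= (t' - s')%:E)%E.
  move=> s'0 st' ta.
  pose w := [:: (a.1, if a.2 then s' else len a.1 - s',
                      if a.2 then t' else len a.1 - t')].
  have wP : is_walk H (oedge_pt a s') w (oedge_pt a t').
    split=> //; [| |split=> //; exact: carrier_edge_pt];
      case: a.2; apply/andP; split; lra.
  apply: le_trans (gdist_walk wP) _.
  rewrite /w walk_length_cons walk_length_nil addr0 lee_fin /=.
  case: a.2; last rewrite opprB addrC addrA subrK; rewrite ler_norml; lra.
have [sa|sa] := ltP s (len a.1); have [ta|ta] := ltP t (len a.1).
- by apply: seg => //; exact: ltW.
- apply: le_trans (gdist_triangle _ _ (inl (oend a)) _) _.
  rewrite -(oedge_pt_len a) (_ : t - s = (len a.1 - s) + (t - len a.1)); last by lra.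
  rewrite EFinD; apply: leeD; first by apply: seg => //; exact: ltW.
  rewrite oedge_pt_len -(curve0 xp) -[X in (_ <= X%:E)%E]subr0.
  by apply: IH => //; rewrite subr_ge0.
- by move: (lt_le_trans ta sa); rewrite ltNge st.
- rewrite (_ : t - s = (t - len a.1) - (s - len a.1)); last by lra.
  by apply: IH => //; rewrite ?subr_ge0// lerB.
Qed.

Lemma oedge_pt_inj a s t : 0 <= s < len a.1 -> 0 <= t < len a.1 ->
  oedge_pt a s = oedge_pt a t -> s = t.
Proof.
have inner r : 0 <= r < len a.1 -> r != 0 ->
    0 < (if a.2 then r else len a.1 - r) < len a.1.
  move=> /andP[r0 ra] r0'; have {r0 r0'} r0 : 0 < r by rewrite lt_neqAle eq_sym r0'.
  by case: a.2; apply/andP; split; lra.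
have pos r : 0 <= r < len a.1 -> r != 0 -> exists z, oedge_pt a r = inr z.
  move=> ra r0; have [z ? _] := edge_pt_inner (inner r ra r0); by exists z.
move=> sP tP st.
have [s0|s0] := eqVneq s 0; have [t0|t0] := eqVneq t 0.
- by rewrite s0 t0.
- by have [q] := pos t tP t0; rewrite -st s0 oedge_pt0.
- by have [q] := pos s sP s0; rewrite st t0 oedge_pt0.
- have [_] := edge_pt_inj (inner s sP s0) st.
  by case: a.2 => //; lra.
Qed.

Lemma oedge_pt_in a s : 0 <= s < len a.1 ->
  match oedge_pt a s with
  | inl y => y = ostart a
  | inr q => (val q).1 = a.1
  end.
Proof.
move=> /andP[s0 sa]; have [->|s0'] := eqVneq s 0; first by rewrite oedge_pt0.
have {s0 s0'} s0 : 0 < s by rewrite lt_neqAle eq_sym s0'.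
have [|q qE vE] := @edge_pt_inner R G a.1 (if a.2 then s else len a.1 - s).
  by case: a.2; apply/andP; split; lra.
by rewrite /oedge_pt qE vE.
Qed.

Lemma curve_in x p s : 0 <= s < plen p ->
  match curve x p s with
  | inl y => y \in map ostart p
  | inr q => (val q).1 \in map fst p
  end.
Proof.
elim: p x s => [|a p IH] x s /=; rewrite ?plen_nil ?plen_cons => /andP[s0 sp].
  by move: (le_lt_trans s0 sp); rewrite ltxx.
have [sa|sa] := ltP s (len a.1).
  have := @oedge_pt_in a s; rewrite s0 sa => /(_ isT).
  by case: oedge_pt => [y ->|q ->]; rewrite mem_head.
have := IH (oend a) (s - len a.1); rewrite subr_ge0 sa ltrBlDl sp => /(_ isT).
by case: curve => [y|q] yp; rewrite in_cons yp orbT.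
Qed.

Lemma curve_inj x p s t : uniq (map ostart p) -> uniq (map fst p) ->
  0 <= s < plen p -> 0 <= t < plen p -> curve x p s = curve x p t -> s = t.
Proof.
wlog st : s t / s <= t.
  move=> W up ue sP tP st; have [le_st|/ltW le_ts] := leP s t; first exact: W.
  by apply/esym/W => //; exact: esym.
elim: p x s t st => [|a p IH] x s t st /=; rewrite ?plen_nil ?plen_cons.
  by move=> _ _ /andP[s0 s0']; move: (le_lt_trans s0 s0'); rewrite ltxx.
move=> /andP[ap up] /andP[ae ue] /andP[s0 sp] /andP[t0 tp].
have t'P : len a.1 <= t -> 0 <= t - len a.1 < plen p by move=> ?; lra.
have [sa|sa] := ltP s (len a.1); have [ta|ta] := ltP t (len a.1).
- by apply: oedge_pt_inj; rewrite ?s0 ?t0.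
- have := @oedge_pt_in a s; rewrite s0 sa => /(_ isT).
  have := @curve_in (oend a) p _ (t'P ta).
  move=> + + e; rewrite -e; case: oedge_pt => [y yp ya|q qp qa].
    by move: ap; rewrite -ya yp.
  by move: ae; rewrite -qa qp.
- by move: (lt_le_trans ta sa); rewrite ltNge st.
- move=> /IH e; suff : s - len a.1 = t - len a.1 by lra.
  by apply: e => //; [rewrite lerB|lra|exact: t'P].
Qed.

Lemma curve_edge x p a : opath x p -> a \in p ->
  exists s, [/\ 0 <= s, s + len a.1 <= plen p & forall t, 0 <= t <= len a.1 ->
    oedge_pt a t = curve x p (s + t)].
Proof.
elim: p x => [//|b p IH] x /= /andP[_ xp]; rewrite inE plen_cons.
have [-> _|ab /= ap] := eqVneq a b.
  exists 0; split=> //; first by rewrite add0r lerDl plen_ge0.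
  move=> t /andP[t0 tb]; rewrite add0r; case: ltP => // bt.
  have -> : t = len b.1 by apply/eqP; rewrite eq_le tb.
  by rewrite subrr curve0// oedge_pt_len.
have [s [s0 sp sE]] := IH _ xp ap; have b0 := len_gt0 b.1.
exists (len b.1 + s); split; [lra|lra|move=> t tP].
rewrite ltNge (_ : len b.1 <= _); last by case/andP: tP; lra.
by rewrite /= sE//; congr curve; lra.
Qed.

(** The arc length parametrization, rescaled to [0, 1], is Lipschitz with constant [L], which gives
    continuity and bounds every inscribed polygon. Distinct starting vertices do not exclude running
    back and forth along one edge, so the edges have to be distinct as well. *)
Lemma closed_path_cycle H x p : opath x p -> olast x p = x -> p != [::] ->
  uniq (map ostart p) -> uniq (map fst p) ->
  {in map fst p, forall e, sedges H e} ->
  exists gamma, [/\ is_cycle H gamma,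
    (curve_length H gamma <= (plen p)%:E)%E &
    forall a t, a \in p -> 0 <= t <= len a.1 ->
      cycle_image gamma (edge_pt a.1 t)].
Proof.
move=> xp px p0 up ue Hp; pose L := plen p.
have L0 : 0 < L.
  rewrite /L; case: p p0 {xp px up ue Hp L} => [//|a p] _; rewrite plen_cons.
  by apply: ltr_pwDl; [exact: len_gt0|exact: plen_ge0].
have Hx : sverts H x.
  case: p xp p0 Hp {px up ue L L0} => [//|a p] /= /andP[/eqP <- _] _ Hp.
  have Ha : sedges H a.1 by apply: Hp; rewrite mem_head.
  by rewrite /ostart; case: a.2; [exact: sedges_src Ha|exact: sedges_tgt Ha].
pose gamma t := curve x p (L * t).
have lip s t : 0 <= s -> s <= t -> (gdist H (gamma s) (gamma t) <= (L * (t - s))%:E)%E.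
  move=> s0 st; rewrite mulrBr; apply: gdist_curve => //.
    by apply: mulr_ge0 => //; exact: ltW.
  by rewrite ler_pM2l.
have carrier_gamma t : 0 <= t -> carrier H (gamma t).
  move=> t0; have [|w /is_walk_carrier//] := @gdist_lt _ _ H (gamma 0) (gamma t) +oo%E.
  by apply: le_lt_trans (lip 0 t (lexx _) t0) _; rewrite ltry.
exists gamma; split.
- split.
  + by move=> t /andP[t0 _]; exact: carrier_gamma.
  + by rewrite /gamma mulr0 mulr1 curve0// curve_end// px.
  + move=> s t /andP[s0 s1] /andP[t0 t1] /curve_inj e.
    apply: (mulfI (lt0r_neq0 L0)); apply: e => //.
      by rewrite mulr_ge0 ?(ltW L0)//= -[ltRHS]mulr1 ltr_pM2l.
    by rewrite mulr_ge0 ?(ltW L0)//= -[ltRHS]mulr1 ltr_pM2l.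
  + move=> t /andP[t0 t1] eps eps0; exists (eps / L); first exact: divr_gt0.
    move=> s /andP[s0 s1] st.
    have le : (gdist H (gamma t) (gamma s) <= (L * `|s - t|)%:E)%E.
      have [ts|/ltW ts] := leP t s.
        by rewrite ger0_norm ?subr_ge0//; exact: lip.
      by rewrite gdistC distrC ger0_norm ?subr_ge0//; exact: lip.
    by apply: le_lt_trans le _; rewrite lte_fin mulrC -ltr_pdivlMr.
- apply: ge_ereal_sup => _ [s [sp /eqP sl] <-].
  have main (u : R) : 0 <= u -> path <%R u s ->
    ((\sum_(i < size s) gdist H (gamma (nth 0%R (u :: s) i)) (gamma (nth 0%R s i)))
       <= (L * (last u s - u))%:E)%E.
    elim: s u {sp sl} => [|v s IH] u u0 /=.
      by rewrite big_ord0 subrr mulr0.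
    move=> /andP[uv vs]; rewrite big_ord_recl /=.
    rewrite (_ : last v s - u = (v - u) + (last v s - v)); last by lra.
    rewrite mulrDr EFinD; apply: leeD; first by apply: lip => //; exact: ltW.
    by apply: IH vs; apply: le_trans u0 (ltW uv).
  by have := main 0 (lexx _) sp; rewrite sl subr0 mulr1.
- move=> a t ap tP.
  have [s [s0 sp sE]] := curve_edge xp ap.
  pose t' := if a.2 then t else len a.1 - t.
  have t'P : 0 <= t' <= len a.1.
    by move: tP; rewrite /t'; case: a.2 => // /andP[? ?]; apply/andP; split; lra.
  have tE : edge_pt a.1 t = oedge_pt a t'.
    rewrite /oedge_pt /t'; case: a.2 => //; congr edge_pt; lra.
  exists ((s + t') / L).
    rewrite /= in_itv /= ler_pdivrMr// mul1r divr_ge0 ?(ltW L0)//=.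
      by case/andP: t'P => ? ?; apply: le_trans sp; rewrite lerD2l.
    by case/andP: t'P => ? ?; exact: addr_ge0.
  by rewrite tE sE// /gamma mulrC divfK// lt0r_neq0.
Qed.

End Curves.

(** * Straightening walks into simple edge paths *)

Section Paths.
Context {R : realType} {G : metric_graph R}.
Implicit Types (H K : subgraph G) (e : edge G) (x y v : vertex G)
  (a : edge G * bool) (p q : seq (edge G * bool)).

Lemma opath_split x p y : opath x p -> y \in x :: map oend p ->
  exists p1 p2, [/\ p = p1 ++ p2, opath x p1, olast x p1 = y & opath y p2].
Proof.
elim: p x => [|a p IH] x /=.
  by rewrite inE => _ /eqP ->; exists [::], [::].
move=> /andP[ax ap]; rewrite inE => /orP[/eqP ->|].
  by exists [::], (a :: p); split=> //=; rewrite ax.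
move=> /IH[//|p1 [p2 [-> p1P p1y p2P]]].
by exists (a :: p1), p2; split=> //=; rewrite ax.
Qed.

Lemma opath_loopfree x p : opath x p ->
  exists q, [/\ opath x q, olast x q = olast x p,
    {subset map fst q <= map fst p}, plen q <= plen p
    & uniq (x :: map oend q)].
Proof.
elim: p x => [|a p IH] x /=; first by exists [::].
move=> /andP[ax ap]; have [q [qP ql qs qp qu]] := IH _ ap.
have aP : opath x (a :: q) by rewrite /= ax.
have [xq|xq] := boolP (x \in map oend (a :: q)); last first.
  exists (a :: q); split=> //; last by rewrite cons_uniq xq.
    by move=> e; rewrite /= !in_cons => /orP[->//|/qs ->]; rewrite orbT.
  by rewrite !plen_cons lerD2l.
have [q1 [q2 [qE q1P q1x q2P]]] := opath_split qP xq.
exists q2; split=> //.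
- by rewrite -[RHS]ql qE olast_cat q1x.
- move=> e eq; rewrite in_cons qs ?orbT//.
  by rewrite qE map_cat mem_cat eq orbT.
- have := plen_ge0 q1; have := len_gt0 a.1; rewrite plen_cons.
  by move: qp; rewrite qE plen_cat; lra.
- move: qu; rewrite qE map_cat -cat_cons lastI cat_rcons cat_uniq.
  by rewrite -/(olast _ q1) q1x => /and3P[].
Qed.

(** An edge used again later would bring back the vertex [x], which is one of its ends. *)
Lemma opath_uniq_edges x p : opath x p -> uniq (x :: map oend p) ->
  uniq (map fst p).
Proof.
elim: p x => [//|a p IH] x /= /andP[/eqP ax ap] /andP[xp up].
rewrite (IH _ ap)// andbT; apply/mapP => -[b bp ab].
have : x \in [:: ostart b; oend b].
  move: ax; rewrite /ostart /oend ab !inE => <-.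
  by case: a.2; case: b.2; rewrite eqxx ?orbT.
have bs : ostart b \in oend a :: map oend p.
  have /(map_f ostart) := bp; rewrite (map_ostart ap).
  exact: mem_belast.
have be : oend b \in oend a :: map oend p by rewrite in_cons map_f ?orbT.
by rewrite !inE => /orP[]/eqP xE; move: xp; rewrite xE ?bs ?be.
Qed.

(** Cut at intermediate visits to [S] until there are none. As [map ostart q] omits the last vertex,
    away from [x] the result meets [S] only at its end. *)
Lemma opath_first_return (S : set (vertex G)) x p : opath x p ->
  uniq (x :: map oend p) -> S (olast x p) -> olast x p <> x ->
  exists q, [/\ opath x q, S (olast x q), olast x q <> x,
    {subset map fst q <= map fst p} & plen q <= plen p] /\
    uniq (x :: map oend q) /\ forall y, y \in map ostart q -> S y -> y = x.
Proof.
have [n] := ubnP (size p); elim: n p => [//|n IH] p /ltnSE pn xp up Sp px.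
have [ok|] := pselect (forall y, y \in map ostart p -> S y -> y = x).
  by exists p; split; split.
move=> /existsNP[y] /not_implyP[yp] /not_implyP[Sy yx].
move: yp; rewrite (map_ostart xp) => yp.
have [p1 [p2 [pE p1P p1y p2P]]] := opath_split xp (mem_belast yp).
have p20 : (0 < size p2)%N.
  rewrite lt0n; apply/negP => /nilP p2E; move: pE; rewrite p2E cats0 => pE.
  move: up; rewrite lastI rcons_uniq => /andP[+ _].
  by rewrite -/(olast x p) [X in olast x X]pE p1y yp.
have [||||q [[? ? ? qs ?] ?]] := IH p1 _ p1P.
- by apply: leq_trans pn; rewrite pE size_cat -addn1 leq_add2l.
- by move: up; rewrite pE map_cat -cat_cons cat_uniq => /and3P[].
- by rewrite p1y.
- by rewrite p1y.
exists q; split=> //; split=> //.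
  by move=> e /qs; rewrite pE map_cat mem_cat => ->.
by rewrite pE plen_cat (le_trans _ (_ : plen p1 <= _))// lerDl plen_ge0.
Qed.

Lemma plen_le_sum p (es : seq (edge G)) : uniq (map fst p) -> uniq es ->
  {subset map fst p <= es} -> plen p <= \sum_(e <- es) len e.
Proof.
move=> up ues pes; rewrite (bigID (mem (map fst p))) /=.
rewrite -big_filter (perm_big (map fst p)).
  by rewrite big_map lerDl sumr_ge0// => e _; exact/ltW/len_gt0.
apply: uniq_perm; rewrite ?filter_uniq// => e; rewrite mem_filter.
by apply: andb_idr; exact: pes.
Qed.

Lemma successive_opath u vs es : successive u vs es ->
  exists p : seq (edge G * bool),
    [/\ opath u p, map oend p = vs & map fst p = es].
Proof.
elim: vs u es => [|v vs IH] u [|e es]//=; first by exists [::].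
move=> [ev /IH[p [vp pvs pes]]].
case: ev => -[eu ev]; [exists ((e, true) :: p)|exists ((e, false) :: p)];
  by rewrite /= /ostart /oend /= eu ev eqxx pvs pes.
Qed.

(* The invariant that straightens a walk, which may turn back anywhere inside an
   edge, into a path of whole edges that is not longer. *)
Definition reach H x (z : gpoint G) (c : R) : Prop :=
  match z with
  | inl y => exists p, [/\ opath x p, {in map fst p, forall e, sedges H e},
      olast x p = y & plen p <= c]
  | inr t => exists p, [/\ opath x p, {in map fst p, forall e, sedges H e}
      & olast x p = src (val t).1 /\ plen p + (val t).2 <= c \/
        olast x p = tgt (val t).1 /\
        plen p + (len (val t).1 - (val t).2) <= c]
  end.

(** Some end of [e] is reached with enough of [c] left to go on to [s]. Only arrival at the other
    end appends a whole edge, and then [|t - s|] pays for the rest of it. *)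
Lemma reach_step H x e s t c : sedges H e -> 0 <= s <= len e ->
  0 <= t <= len e -> reach H x (edge_pt e s) c ->
  reach H x (edge_pt e t) (c + `|t - s|).
Proof.
move=> He sP tP sc.
have [p [xp Hp pc]] : exists p, [/\ opath x p,
    {in map fst p, forall e, sedges H e}
    & olast x p = src e /\ plen p + s <= c \/
      olast x p = tgt e /\ plen p + (len e - s) <= c].
  case: (edge_ptP sP) sc => [-> ->|-> ->|q _ -> qE] /= [p].
  - by move=> [? ? ? ?]; exists p; rewrite addr0; split=> //; left.
  - by move=> [? ? ? ?]; exists p; rewrite subrr addr0; split=> //; right.
  - by rewrite qE => -[? ? ?]; exists p.
have ext (b : bool) : olast x p = ostart (e, b) ->
    exists q, [/\ opath x q, {in map fst q, forall e, sedges H e},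
      olast x q = oend (e, b) & plen q <= plen p + len e].
  move=> pb; exists (rcons p (e, b)); rewrite -cats1; split.
  - by rewrite opath_cat xp /= pb eqxx.
  - move=> f; rewrite map_cat mem_cat inE => /orP[/Hp//|/eqP ->//].
  - by rewrite olast_cat /olast.
  - by rewrite plen_cat plen_cons plen_nil addr0.
have st := ler_norm (t - s); have := ler_norm (s - t); rewrite distrC => ts.
case: (edge_ptP tP) => [t0 ->|t0 ->|q _ -> qE] /=; rewrite ?qE /=.
- case: pc => -[px pc]; first by exists p; split=> //; lra.
  have [q [? ? ? ?]] := ext false px; exists q; split=> //; lra.
- case: pc => -[px pc]; last by exists p; split=> //; lra.
  have [q [? ? ? ?]] := ext true px; exists q; split=> //; lra.
- exists p; split=> //; case: pc => -[px pc]; [left|right]; split=> //; lra.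
Qed.

Lemma walk_reach H x w z : is_walk H (inl x) w z ->
  reach H x z (walk_length w).
Proof.
suff main z' c : is_walk H z' w z -> reach H x z' c ->
    reach H x z (c + walk_length w).
  move=> wP; have := main (inl x) 0 wP; rewrite add0r; apply.
  by exists [::]; rewrite plen_nil.
elim: w z' c => [|[[e s] t] w IH] z' c /=.
  by move=> [_ ->]; rewrite walk_length_nil addr0.
move=> [He sP tP -> /IH wP] zc; rewrite walk_length_cons addrA; apply: wP.
exact: reach_step zc.
Qed.

Lemma walk_opath H x w y : is_walk H (inl x) w (inl y) ->
  exists p, [/\ opath x p, {in map fst p, forall e, sedges H e},
    olast x p = y & plen p <= walk_length w].
Proof. exact: walk_reach. Qed.

(** For a vertex [delta] comes from [len_bounded]; for a point inside an edge it is the distance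
    along that edge to the nearer end. It makes the inequality [alpha < m + n] in [gdist_near_both]
    strict. *)
Lemma reach_pos (z : gpoint G) : exists2 delta : R, 0 < delta &
  forall H x c, inl x <> z -> reach H x z c -> delta <= c.
Proof.
case: z => [y|[[e t] tP]].
  have [eps eps0 epsP] := len_bounded y; exists eps => // H x c xy [p].
  case: (lastP p) => [|p' a]; rewrite /olast /=.
    by move=> [_ _ yx]; case: xy; rewrite yx.
  move=> [_ _ + pc]; rewrite map_rcons last_rcons => ay.
  apply: le_trans (le_trans (epsP a.1 _) _) pc.
    by move: ay; rewrite /oend; case: a.2; [right|left].
  by rewrite -cats1 plen_cat plen_cons plen_nil addr0 lerDr plen_ge0.
have [/= t0 te] := andP tP; exists (Num.min t (len e - t)).
  by rewrite lt_min t0 subr_gt0.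
move=> H x c _ [p [_ _ /= pc]]; rewrite ge_min.
have := plen_ge0 p; case: pc => -[_ pc] p0; apply/orP; [left|right]; lra.
Qed.

End Paths.

(** * Excursions outside the path *)

(** The vertices of [K] stay, so that excursions can begin and end on them. *)
Definition outside {R : realType} {G : metric_graph R} (H K : subgraph G) :
    subgraph G :=
  @Subgraph R G (sverts H) (sedges H `\` sedges K)
    (fun e He => sedges_src He.1) (fun e He => sedges_tgt He.1).

Section Excursions.
Context {R : realType} {G : metric_graph R} (H K : subgraph G).
Context (u : vertex G) (vs : seq (vertex G)) (es : seq (edge G)).
Hypothesis pathK : is_path K u vs es.
Hypothesis vertsKH : sverts K `<=` sverts H.
Hypothesis edgesKH : sedges K `<=` sedges H.

Let alpha : R := \sum_(e <- es) len e.

Lemma path_verts v : sverts K v <-> v \in u :: vs.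
Proof. by have [_ _ -> _] := pathK. Qed.

Lemma path_edges e : sedges K e <-> e \in es.
Proof. by have [_ _ _ ->] := pathK. Qed.

Lemma path_opath : exists p, [/\ opath u p, map oend p = vs & map fst p = es].
Proof. by apply: successive_opath; have [] := pathK. Qed.

Lemma path_uniq_edges : uniq es.
Proof.
have [p [up pvs <-]] := path_opath; apply: opath_uniq_edges up _.
by rewrite pvs; have [] := pathK.
Qed.

(** Going back from [y] to [u], then on to [y'], and removing loops gives an arc with distinct
    edges, all in [K]; hence its length is at most [alpha]. *)
Lemma path_arc y y' : sverts K y -> sverts K y' -> exists q, [/\ opath y q,
  olast y q = y', {in map fst q, forall e, sedges K e},
  uniq (y :: map oend q) & plen q <= alpha].
Proof.
have [p [up pvs pes]] := path_opath; rewrite !path_verts -pvs.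
move=> /(opath_split up)[p1 [p2 [pE p1P p1y _]]].
move=> /(opath_split up)[p3 [p4 [pE' p3P p3y _]]].
have [rp1 rl1] := opath_rev p1P; rewrite p1y in rp1 rl1.
have [|q [yq qy' qs _ uq]] := @opath_loopfree _ _ y (orev p1 ++ p3).
  by rewrite opath_cat rp1 rl1.
have qes : {subset map fst q <= es}.
  move=> e /qs; rewrite map_cat mem_cat map_fst_rev mem_rev -pes.
  by move=> /orP[ep|ep]; [rewrite pE|rewrite pE'];
    rewrite map_cat mem_cat ep.
exists q; split=> //.
- by rewrite qy' olast_cat rl1.
- by move=> e /qes /path_edges.
- by apply: plen_le_sum => //; [exact: opath_uniq_edges uq|exact: path_uniq_edges].
Qed.

(** No starting vertex repeats, because [p] meets [K] at most in its two ends while [q] stays in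
    [K]; no edge repeats, because the edges of [p] are off [K]. *)
Lemma close_up x p q : opath x p -> opath (olast x p) q ->
  olast (olast x p) q = x -> olast x p <> x ->
  uniq (x :: map oend p) -> uniq (olast x p :: map oend q) ->
  {in map fst p, forall e, sedges (outside H K) e} ->
  {in map fst q, forall e, sedges K e} ->
  sverts K (olast x p) ->
  (forall y, y \in map ostart p -> sverts K y -> y = x) ->
  exists gamma, [/\ is_cycle H gamma,
    (curve_length H gamma <= (plen p + plen q)%:E)%E &
    forall a t, a \in p ++ q -> 0 <= t <= len a.1 ->
      cycle_image gamma (edge_pt a.1 t)].
Proof.
move=> xp xq qx px up uq Hp Kq Kl pK; rewrite -plen_cat.
apply: (@closed_path_cycle _ _ _ x).
- by rewrite opath_cat xp.
- by rewrite olast_cat.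
- by case: (p) px => //=.
- rewrite map_cat cat_uniq (map_ostart xp) (map_ostart xq).
  move: (up) (uq); rewrite [x :: _]lastI [olast _ _ :: _]lastI !rcons_uniq.
  move=> /andP[_ ->] /andP[qb ->]; rewrite andbT /=.
  apply/hasPn => y yq; apply/negP => yp.
  have Ky : sverts K y.
    exact: (opath_sub xq Kl Kq) (mem_belast yq).
  have yx : y = x by apply: pK => //; rewrite (map_ostart xp).
  by move: qb; rewrite -/(olast (olast x p) q) qx -[X in X \in _]yx yq.
- rewrite map_cat cat_uniq (opath_uniq_edges xp up) (opath_uniq_edges xq uq).
  by rewrite andbT; apply/hasPn => e /Kq Ke; apply/negP => /Hp[].
- by move=> e; rewrite map_cat mem_cat => /orP[/Hp[]//|/Kq /edgesKH].
Qed.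

Lemma edge_of_ostart (gamma : R -> gpoint G) x p : opath x p -> p != [::] ->
  (forall a t, a \in p -> 0 <= t <= len a.1 ->
     cycle_image gamma (edge_pt a.1 t)) -> cycle_image gamma (inl x).
Proof.
case: p => [//|a p] /= /andP[/eqP <- _] _ im.
rewrite -oedge_pt0; apply: im; first by rewrite mem_head.
by case: a.2; rewrite ?subr0 lexx ltW ?len_gt0.
Qed.

(** A cycle longer than [3 * alpha] whose return along [K] takes at most [alpha] leaves more than
    [2 * alpha] to the excursion. The walk may pass other vertices of [K], so it is first cut down
    to a simple path that stops at its first return. *)
Lemma excursion_meeting : ((3 * alpha)%:E < shortest_cycle_meeting H K)%E ->
  forall x y w, sverts K x -> sverts K y -> x <> y ->
  is_walk (outside H K) (inl x) w (inl y) -> 2 * alpha < walk_length w.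
Proof.
move=> short x y w Kx Ky xy /walk_opath[p0 [xp0 Hp0 p0y p0w]].
have [p1 [xp1 p1y p1s p1l up1]] := opath_loopfree xp0.
have [||p [[xp Kp px ps pl] [up pK]]] :=
  opath_first_return (S := sverts K) xp1 up1.
- by rewrite p1y p0y.
- by rewrite p1y p0y; exact/nesym.
have [q [yq qx Kq uq qa]] := path_arc Kp Kx.
have Hp : {in map fst p, forall e, sedges (outside H K) e}.
  by move=> e /ps /p1s /Hp0.
have [gamma [cyc lg im]] := close_up xp yq qx px up uq Hp Kq Kp pK.
have : ((3 * alpha)%:E < (plen p + plen q)%:E)%E.
  apply: lt_le_trans short _; apply: le_trans lg.
  apply: ereal_inf_lbound; exists gamma => //; split=> //.
  exists (inl x); split=> //; apply: (edge_of_ostart xp).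
    by case: (p) px => //=.
  by move=> a t ap; apply: im; rewrite mem_cat ap.
by rewrite lte_fin; lra.
Qed.

(** Only cycles containing all of [K] are known to be long, so the return must be the whole path;
    the excursion must then join its two ends, which the hypothesis on exits guarantees. *)
Lemma excursion_through : ((3 * alpha)%:E < shortest_cycle_through H K)%E ->
  (forall e v, sedges (outside H K) e -> src e = v \/ tgt e = v ->
    sverts K v -> v = u \/ v = last u vs) ->
  u <> last u vs -> forall w,
  is_walk (outside H K) (inl u) w (inl (last u vs)) ->
  2 * alpha < walk_length w.
Proof.
move=> short ends ul w /walk_opath[p0 [xp0 Hp0 p0y p0w]].
have Ku : sverts K u by apply/path_verts; rewrite mem_head.
have Kv : sverts K (last u vs) by apply/path_verts; rewrite mem_last.
have [p1 [xp1 p1y p1s p1l up1]] := opath_loopfree xp0.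
have [||p [[xp Kp px ps pl] [up pK]]] :=
  opath_first_return (S := sverts K) xp1 up1.
- by rewrite p1y p0y.
- by rewrite p1y p0y; exact/nesym.
have Hp : {in map fst p, forall e, sedges (outside H K) e}.
  by move=> e /ps /p1s /Hp0.
have pv : olast u p = last u vs.
  case: (lastP p) xp px Hp Kp {ps pl up pK} => [//|p' a] xp px Hp Kp.
  have la : olast u (rcons p' a) = oend a by rewrite /olast map_rcons last_rcons.
  have Ha : sedges (outside H K) a.1.
    by apply: Hp; rewrite map_rcons mem_rcons mem_head.
  rewrite la in px Kp *; have [|//|//|//] := ends a.1 (oend a) Ha.
  by rewrite /oend; case: a.2; [right|left].
have [pA [upA pAvs pAes]] := path_opath.
have [rq rl] := opath_rev upA.
have lA : olast u pA = last u vs by rewrite /olast pAvs.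
have Kq : {in map fst (orev pA), forall e, sedges K e}.
  by move=> e; rewrite map_fst_rev mem_rev pAes => /path_edges.
have [|||gamma [cyc lg im]] := @close_up u p (orev pA) xp _ _ px up _ Hp Kq Kp pK.
- by rewrite pv -lA.
- by rewrite pv -lA.
- by rewrite pv -lA (opath_verts_rev upA) rev_uniq pAvs; have [] := pathK.
have : ((3 * alpha)%:E < (plen p + plen (orev pA))%:E)%E.
  apply: lt_le_trans short _; apply: le_trans lg.
  apply: ereal_inf_lbound; exists gamma => //; split=> //.
  have imA a t : a \in pA -> 0 <= t <= len a.1 ->
      cycle_image gamma (edge_pt a.1 t).
    move=> aA; apply: (im (oflip a)).
    by rewrite mem_cat /orev mem_rev map_f ?orbT.
  have pA0 : pA != [::].
    by apply: contra_not_neq ul => pA0; rewrite -lA pA0.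
  have iu : cycle_image gamma (inl u) by apply: (edge_of_ostart upA).
  move=> [v /path_verts|[[e t] tP] /path_edges] /=.
    rewrite inE => /orP[/eqP ->//|]; rewrite -pAvs => /mapP[a aA ->].
    rewrite -oedge_pt_len; apply: imA => //.
    by case: a.2; rewrite ?subrr lexx ltW ?len_gt0.
  rewrite -pAes => /mapP[a aA ea].
  have [q qE /esym vq] := edge_pt_inner tP.
  rewrite (_ : exist _ _ _ = q); last exact: val_inj.
  rewrite -qE ea; apply: imA => //.
  by rewrite -ea; case/andP: tP => /= ? ?; rewrite !ltW.
rewrite lte_fin plen_rev.
have -> : plen pA = alpha by rewrite /alpha -pAes /plen big_map.
lra.
Qed.

End Excursions.

(** * Distances along the path *)

Section PathMetric.
Context {R : realType} {G : metric_graph R} (K : subgraph G).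
Context (u : vertex G) (vs : seq (vertex G)) (es : seq (edge G)).
Context (p : seq (edge G * bool)).
Hypothesis pathK : is_path K u vs es.
Hypothesis up : opath u p.
Hypothesis pvs : map oend p = vs.
Hypothesis pes : map fst p = es.

Let alpha : R := \sum_(e <- es) len e.
Let gm : R -> gpoint G := curve u p.

Let plen_alpha : plen p = alpha.
Proof. by rewrite /alpha -pes /plen big_map. Qed.

Lemma path_length_ge0 : 0 <= alpha.
Proof. by rewrite -plen_alpha plen_ge0. Qed.

Lemma curve_path0 : gm 0 = inl u.
Proof. exact: curve0. Qed.

Lemma curve_path_end : gm alpha = inl (last u vs).
Proof. by rewrite /gm curve_end ?plen_alpha// /olast pvs. Qed.

Lemma carrier_curve_path a : 0 <= a <= alpha -> carrier K (gm a).
Proof.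
move=> /andP[a0]; rewrite le_eqVlt => /orP[/eqP ->|aa].
  by rewrite curve_path_end; apply/(path_verts pathK); exact: mem_last.
have := @curve_in _ _ u p a; rewrite a0 plen_alpha aa => /(_ isT).
rewrite -/(gm a); case: (gm a) => [y|q] /=.
  rewrite (map_ostart up) pvs => /mem_belast.
  by move/(path_verts pathK).
by rewrite pes => /(path_edges pathK).
Qed.

Lemma curve_path_inj a b : 0 <= a <= alpha -> 0 <= b <= alpha ->
  gm a = gm b -> a = b.
Proof.
have uvs : uniq (u :: vs) by have [] := pathK.
have upe : uniq (map fst p) by rewrite pes; exact: path_uniq_edges pathK.
have last_out c : 0 <= c < alpha -> gm c <> gm alpha.
  move=> cP; rewrite curve_path_end => cE.
  have := @curve_in _ _ u p c; rewrite plen_alpha cP => /(_ isT).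
  rewrite -/(gm c) cE (map_ostart up) pvs => lb.
  by move: uvs; rewrite lastI rcons_uniq lb.
move=> /andP[a0 aP] /andP[b0 bP] ab.
move: aP bP; rewrite !le_eqVlt => /orP[/eqP aE|aP] /orP[/eqP bE|bP].
- by rewrite aE bE.
- by case: (last_out b); rewrite ?b0// -ab aE.
- by case: (last_out a); rewrite ?a0// ab bE.
- apply: (curve_inj _ upe _ _ ab); rewrite ?plen_alpha ?a0 ?b0//.
  rewrite (map_ostart up) pvs.
  by move: uvs; rewrite lastI rcons_uniq => /andP[].
Qed.

Lemma curve_path_edge e : sedges K e -> exists f : R -> R,
  (forall s, 0 <= s <= len e -> 0 <= f s <= alpha /\ edge_pt e s = gm (f s)) /\
  forall s t, `|f s - f t| = `|s - t|.
Proof.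
move=> /(path_edges pathK); rewrite -pes => /mapP[a ap ->].
have [c [c0 ca cE]] := curve_edge up ap; rewrite plen_alpha in ca.
exists (fun s => c + (if a.2 then s else len a.1 - s)); split=> [s /andP[s0 sa]|s t].
  split; first by case: a.2; apply/andP; split; lra.
  rewrite /gm -cE; last by case: a.2; apply/andP; split; lra.
  by rewrite /oedge_pt; case: a.2 => //; congr edge_pt; lra.
by case: a.2; last rewrite distrC; congr `|_|; lra.
Qed.

Lemma curve_path_surj z : carrier K z -> exists2 a, 0 <= a <= alpha & z = gm a.
Proof.
case: z => [v /(path_verts pathK)|[[e t] tP] /= Ke].
  rewrite inE => /orP[/eqP ->|].
    by exists 0; rewrite ?curve_path0// lexx path_length_ge0.
  rewrite -pvs => /mapP[a ap ->].
  have [c [c0 ca cE]] := curve_edge up ap; rewrite plen_alpha in ca.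
  have a0 := len_gt0 a.1; exists (c + len a.1); first by apply/andP; split; lra.
  by rewrite /gm -cE ?oedge_pt_len// lexx ltW.
have [f [fP _]] := curve_path_edge Ke.
have [|ft e'] := fP t; first by case/andP: tP => /= ? ?; rewrite !ltW.
exists (f t) => //; rewrite -e'.
have [q -> vq] := edge_pt_inner tP; congr inr; exact/esym/val_inj.
Qed.

Section Ambient.
Context (H : subgraph G).
Hypothesis vertsKH : sverts K `<=` sverts H.
Hypothesis edgesKH : sedges K `<=` sedges H.

Lemma gdist_curve_path_le a b : 0 <= a -> 0 <= b ->
  (gdist H (gm a) (gm b) <= `|a - b|%:E)%E.
Proof.
have Hu : sverts H u by apply/vertsKH/(path_verts pathK); exact: mem_head.
have Hp : {in map fst p, forall e, sedges H e}.
  by move=> e; rewrite pes => /(path_edges pathK) /edgesKH.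
move=> a0 b0; have [ab|/ltW ba] := leP a b.
  by rewrite distrC ger0_norm ?subr_ge0//; exact: gdist_curve.
by rewrite gdistC ger0_norm ?subr_ge0//; exact: gdist_curve.
Qed.

Lemma vertex_outside e s : ~ sedges K e -> carrier K (edge_pt e s) ->
  exists v, [/\ edge_pt e s = inl v, sverts K v & src e = v \/ tgt e = v].
Proof.
rewrite /edge_pt; case: insubP => [q _ qE /= + |_] /=.
  by rewrite qE.
by move=> _; case: ifP => _ Kv; eexists; (split; first reflexivity) => //;
  [left|right].
Qed.

Lemma is_walk1 (L : subgraph G) e s t : sedges L e -> 0 <= s <= len e ->
  0 <= t <= len e -> is_walk L (edge_pt e s) [:: (e, s, t)] (edge_pt e t).
Proof. by move=> Le sP tP; split=> //; split=> //; exact: carrier_edge_pt. Qed.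

(** An edge not in [K] meets [K] only in its ends, so the first point of [K] on the walk is a
    vertex. The edge of arrival is recorded for the degree condition. *)
Lemma walk_first_hit z w y : is_walk H z w y -> ~ carrier K z -> carrier K y ->
  exists v w1 w2 e, [/\ sverts K v, is_walk (outside H K) z w1 (inl v),
    is_walk H (inl v) w2 y, walk_length w = walk_length w1 + walk_length w2
    & sedges (outside H K) e /\ (src e = v \/ tgt e = v)].
Proof.
elim: w z => [z [_ ->] //|[[e s] t] w IH z /= [He sP tP -> wP] Kz Ky].
have Ke : ~ sedges K e by move=> Ke; apply: Kz; exact: carrier_edge_pt.
have oe : sedges (outside H K) e by [].
have [Kt|Kt] := pselect (carrier K (edge_pt e t)).
  have [v [tv Kv ev]] := vertex_outside Ke Kt; rewrite tv in wP.
  exists v, [:: (e, s, t)], w, e; split=> //.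
    by rewrite -tv; exact: is_walk1.
  by rewrite !walk_length_cons walk_length_nil addr0.
have [v [w1 [w2 [e' [Kv w1P w2P wl e'P]]]]] := IH _ wP Kt Ky.
exists v, ((e, s, t) :: w1), w2, e'; split=> //.
by rewrite !walk_length_cons wl addrA.
Qed.

Hypothesis excursion : forall x y w, sverts K x -> sverts K y -> x <> y ->
  is_walk (outside H K) (inl x) w (inl y) -> alpha <= walk_length w.

(* Cut the walk at its visits to K: each excursion outside K between distinct
   points costs at least alpha, hence at least their distance along K. *)
Lemma walk_ge w z b : is_walk H z w (gm b) -> 0 <= b <= alpha ->
  (forall a, 0 <= a <= alpha -> z = gm a -> `|a - b| <= walk_length w) /\
  (~ carrier K z -> forall v a w0, sverts K v -> 0 <= a <= alpha ->
     inl v = gm a -> is_walk (outside H K) (inl v) w0 z ->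
     `|a - b| <= walk_length w0 + walk_length w).
Proof.
move=> + bP.
(* Points of [K] are at most [alpha] apart along it. An excursion back to its starting vertex may be
   short, but then [a = a']. *)
have hop v a w0 v' a' : sverts K v -> 0 <= a <= alpha -> inl v = gm a ->
    sverts K v' -> 0 <= a' <= alpha -> inl v' = gm a' ->
    is_walk (outside H K) (inl v) w0 (inl v') -> `|a - a'| <= walk_length w0.
  move=> Kv aP va Kv' a'P va' w0P; have [vv|vv] := pselect (v = v').
    have -> : a = a' by apply: curve_path_inj => //; rewrite -va -va' vv.
    by rewrite subrr normr0 walk_length_ge0.
  apply: le_trans (excursion Kv Kv' vv w0P).
  by rewrite ler_norml; case/andP: aP; case/andP: a'P; lra.
(* The second claim carries the part [w0], walked since the last exit from [K], through the
   induction. *)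
elim: w z => [z [Hz zb]|[[e s] t] w IH z].
  split=> [a aP za|Kz]; last by case: Kz; rewrite zb; exact: carrier_curve_path.
  have -> : a = b by apply: curve_path_inj => //; rewrite -za.
  by rewrite subrr normr0 walk_length_nil.
move=> [He sP tP zE wP]; have [IH1 IH2] := IH _ wP.
rewrite walk_length_cons /=.
have [Ke|Ke] := pselect (sedges K e).
  split; last by case; rewrite zE; exact: carrier_edge_pt.
  move=> a aP za; have [f [fP fD]] := curve_path_edge Ke.
  have [fsP fs] := fP s sP; have [ftP ft] := fP t tP.
  have -> : a = f s by apply: curve_path_inj => //; rewrite -za -fs.
  have := ler_distD (f t) (f s) b; have := IH1 _ ftP ft.
  by rewrite fD (distrC s t); lra.
have oe : sedges (outside H K) e by [].
have tail v a w0 : sverts K v -> 0 <= a <= alpha -> inl v = gm a ->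
    is_walk (outside H K) (inl v) w0 z ->
    `|a - b| <= walk_length w0 + (`|t - s| + walk_length w).
  move=> Kv aP va w0P.
  have w0t : is_walk (outside H K) (inl v) (w0 ++ [:: (e, s, t)]) (edge_pt e t).
    by apply: is_walk_cat w0P _; rewrite zE; exact: is_walk1.
  have lE : walk_length (w0 ++ [:: (e, s, t)]) = walk_length w0 + `|t - s|.
    by rewrite walk_length_cat walk_length_cons walk_length_nil addr0.
  rewrite addrA -lE; have [Kt|Kt] := pselect (carrier K (edge_pt e t)).
    have [v' [tv' Kv' _]] := vertex_outside Ke Kt.
    have [a' a'P va'] := curve_path_surj (z := inl v') Kv'.
    rewrite tv' in w0t.
    apply: le_trans (ler_distD a' _ _) _; apply: lerD.
      exact: (hop v a _ v' a').
    by apply: IH1 => //; rewrite tv'.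
  exact: (IH2 Kt v a).
split=> [a aP za|_ v a w0]; last exact: tail.
have Kz : carrier K (edge_pt e s) by rewrite -zE za; exact: carrier_curve_path.
have [v [sv Kv _]] := vertex_outside Ke Kz.
have := tail v a [::] Kv aP; rewrite walk_length_nil add0r; apply.
  by rewrite -sv -zE.
by rewrite zE sv; split=> //; exact: vertsKH.
Qed.

Lemma walk_curve_path_ge w a b : 0 <= a <= alpha -> 0 <= b <= alpha ->
  is_walk H (gm a) w (gm b) -> `|a - b| <= walk_length w.
Proof. by move=> aP bP /walk_ge /(_ bP)[W _]; exact: W. Qed.

Lemma gdist_curve_path a b : 0 <= a <= alpha -> 0 <= b <= alpha ->
  gdist H (gm a) (gm b) = `|a - b|%:E.
Proof.
move=> aP bP; apply/eqP; rewrite eq_le; apply/andP; split.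
  by apply: gdist_curve_path_le; [case/andP: aP|case/andP: bP].
by apply: gdist_geP => w /walk_curve_path_ge; rewrite lee_fin; apply.
Qed.

End Ambient.
End PathMetric.

(** * Distances from a point off the path *)

Section Attachment.
Context {R : realType} {G : metric_graph R} (H K : subgraph G).
Context (u : vertex G) (vs : seq (vertex G)) (es : seq (edge G)).
Context (p : seq (edge G * bool)).
Hypothesis pathK : is_path K u vs es.
Hypothesis up : opath u p.
Hypothesis pvs : map oend p = vs.
Hypothesis pes : map fst p = es.

Let alpha : R := \sum_(e <- es) len e.
Let gm : R -> gpoint G := curve u p.
Let v := last u vs.

Hypothesis gdist_gm : forall a b, 0 <= a <= alpha -> 0 <= b <= alpha ->
  gdist H (gm a) (gm b) = `|a - b|%:E.

Let gm0 : inl u = gm 0.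
Proof. by rewrite /gm (curve_path0 up). Qed.

Let gm1 : inl v = gm alpha.
Proof. by rewrite /gm (curve_path_end u pvs pes). Qed.

Let alpha0 : 0 <= alpha.
Proof. exact: (path_length_ge0 pes). Qed.

Let in0 : 0 <= (0 : R) <= alpha. Proof. by rewrite lexx alpha0. Qed.
Let in1 : 0 <= alpha <= alpha. Proof. by rewrite lexx alpha0. Qed.

Let outside_walk z w z' : is_walk (outside H K) z w z' -> is_walk H z w z'.
Proof. by apply: is_walk_sub => // e []. Qed.

Lemma gdist_gmu a : 0 <= a <= alpha -> gdist H (gm a) (inl u) = a%:E.
Proof.
move=> aP; rewrite gm0 gdist_gm// subr0 ger0_norm//; by case/andP: aP.
Qed.

Lemma gdist_gmv a : 0 <= a <= alpha -> gdist H (gm a) (inl v) = (alpha - a)%:E.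
Proof.
move=> aP; rewrite gm1 gdist_gm// distrC ger0_norm// subr_ge0.
by case/andP: aP.
Qed.

Let walk_ge_real x y w c : gdist H x y = c%:E -> is_walk H x w y ->
  c <= walk_length w.
Proof. by move=> xy /gdist_walk; rewrite xy lee_fin. Qed.

Section AtEnds.
Hypothesis ends : forall e x, sedges (outside H K) e ->
  src e = x \/ tgt e = x -> sverts K x -> x = u \/ x = v.

(** The distances are left extended, as [x] may a priori lie in another component than [K];
    [gdist_ends] is the finite version. *)
Lemma gdist_via_ends x z : ~ carrier K x -> carrier K z ->
  (mine (gdist H x (inl u) + gdist H (inl u) z)
        (gdist H x (inl v) + gdist H (inl v) z) <= gdist H x z)%E.
Proof.
move=> Kx Kz; apply: gdist_geP => w wP.
have [y [w1 [w2 [e [Ky w1P w2P -> [oe ey]]]]]] := walk_first_hit wP Kx Kz.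
have {}w1P := outside_walk w1P; rewrite EFinD ge_min.
by apply/orP; case: (ends oe ey Ky) => yE; [left|right]; rewrite yE in w1P w2P;
  apply: leeD; exact: gdist_walk.
Qed.

Lemma gdist_ends x px qx a : ~ carrier K x -> gdist H x (inl u) = px%:E ->
  gdist H x (inl v) = qx%:E -> 0 <= a <= alpha ->
  gdist H x (gm a) = (Num.min (px + a) (qx + (alpha - a)))%:E.
Proof.
move=> Kx pxE qxE aP; apply/eqP; rewrite eq_le EFin_min; apply/andP; split.
  rewrite le_min; apply/andP; split.
    apply: le_trans (gdist_triangle _ _ (inl u) _) _.
    by rewrite pxE gdistC gdist_gmu.
  apply: le_trans (gdist_triangle _ _ (inl v) _) _.
  by rewrite qxE gdistC gdist_gmv.
have Ka : carrier K (gm a) by exact: (carrier_curve_path pathK up pvs pes).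
apply: le_trans (gdist_via_ends Kx Ka).
by rewrite pxE qxE !(gdistC _ (inl _) (gm a)) gdist_gmu// gdist_gmv.
Qed.

Hypothesis through : u <> v -> forall w,
  is_walk (outside H K) (inl u) w (inl v) -> 2 * alpha < walk_length w.

(** If [|px - qx| < alpha], nearly shortest walks from [x] to [u] and to [v] first hit [K] at [u]
    and at [v] respectively, a detour through the other end being too long. Joined at [x] they form
    an excursion between the ends, so [px + qx] cannot be below [2 * alpha]. *)
Lemma gdist_ends_far x px qx : ~ carrier K x -> gdist H x (inl u) = px%:E ->
  gdist H x (inl v) = qx%:E -> 2 * alpha <= px + qx \/ `|px - qx| = alpha.
Proof.
move=> Kx pxE qxE.
have uv_dist : gdist H (inl u) (inl v) = alpha%:E.
  by rewrite gm0 gdist_gmv// subr0.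
have tri : `|px - qx| <= alpha.
  have := gdist_triangle H x (inl u) (inl v).
  have := gdist_triangle H x (inl v) (inl u).
  rewrite pxE qxE (gdistC _ (inl v)) uv_dist -!EFinD !lee_fin => ? ?.
  by rewrite ler_norml; apply/andP; split; lra.
have [|far] := leP (2 * alpha) (px + qx); first by left.
right; apply/eqP; rewrite eq_le tri leNgt; apply/negP => lt_tri.
have uv : u <> v.
  move=> uv; have : gdist H (inl u) (inl u) = 0%E.
    by rewrite gm0 gdist_gm// subrr normr0.
  rewrite {2}uv uv_dist => -[a0]; move: lt_tri; rewrite a0.
  by rewrite ltNge normr_ge0.
(* Both strict gaps survive when [px] and [qx] are each exceeded by less than [eps]. *)
pose eps := Num.min (alpha - `|px - qx|) (2 * alpha - (px + qx)) / 2.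
have eps0 : 0 < eps by rewrite divr_gt0// lt_min !subr_gt0 lt_tri.
have eps1 : 2 * eps <= alpha - `|px - qx|.
  by rewrite mulrC divfK// ge_min lexx.
have eps2 : 2 * eps <= 2 * alpha - (px + qx).
  by rewrite mulrC divfK// ge_min lexx orbT.
have [|w1 w1P w1l] := @gdist_lt _ _ H x (inl u) (px + eps)%:E.
  by rewrite pxE lte_fin ltrDl.
have [|w2 w2P w2l] := @gdist_lt _ _ H x (inl v) (qx + eps)%:E.
  by rewrite qxE lte_fin ltrDl.
rewrite !lte_fin in w1l w2l.
have := ler_norm (px - qx); have := ler_norm (qx - px); rewrite distrC => n1 n2.
have Ku : carrier K (inl u) by apply/(path_verts pathK); exact: mem_head.
have Kv : carrier K (inl v) by apply/(path_verts pathK); exact: mem_last.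
have [y1 [h1 [r1 [e1 [Ky1 h1P r1P l1 [oe1 ey1]]]]]] := walk_first_hit w1P Kx Ku.
have [y2 [h2 [r2 [e2 [Ky2 h2P r2P l2 [oe2 ey2]]]]]] := walk_first_hit w2P Kx Kv.
have r10 := walk_length_ge0 r1; have r20 := walk_length_ge0 r2.
case: (ends oe1 ey1 Ky1) => yE; rewrite yE in h1P r1P; last first.
  have := walk_ge_real qxE (outside_walk h1P).
  by rewrite gdistC in uv_dist; have := walk_ge_real uv_dist r1P; lra.
case: (ends oe2 ey2 Ky2) => yE2; rewrite yE2 in h2P r2P.
  have := walk_ge_real pxE (outside_walk h2P).
  by have := walk_ge_real uv_dist r2P; lra.
have := through uv (is_walk_cat (is_walk_rev h1P) h2P).
by rewrite walk_length_cat walk_length_rev; lra.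
Qed.

End AtEnds.

Hypothesis meeting : forall x y w, sverts K x -> sverts K y -> x <> y ->
  is_walk (outside H K) (inl x) w (inl y) -> 2 * alpha < walk_length w.

(* Short walks from y to both ends of K must enter K at the same vertex. *)
Lemma gdist_near_both y m n : ~ carrier K y -> gdist H y (inl u) = m%:E ->
  gdist H y (inl v) = n%:E -> m < alpha -> n < alpha ->
  alpha < m + n /\
  forall a, 0 <= a <= alpha -> (gdist H y (gm a) <= (Num.max m n)%:E)%E.
Proof.
move=> Ky mE nE ma na.
have [delta delta0 deltaP] := reach_pos y.
have Ku : carrier K (inl u) by apply/(path_verts pathK); exact: mem_head.
have Kv : carrier K (inl v) by apply/(path_verts pathK); exact: mem_last.
(* [b] is the parameter of the common entry vertex; [c1] and [c2] are the lengths of the two walks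
   up to it. *)
have entry c c' : m < c <= alpha -> n < c' <= alpha ->
    exists b c1 c2, [/\ 0 <= b <= alpha, delta <= c1, delta <= c2,
      c1 + b < c /\ c2 + (alpha - b) < c' &
      (gdist H y (gm b) <= c1%:E)%E /\ (gdist H y (gm b) <= c2%:E)%E].
  move=> /andP[mc ca] /andP[nc ca'].
  have [|w1 w1P w1l] := @gdist_lt _ _ H y (inl u) c%:E; first by rewrite mE.
  have [|w2 w2P w2l] := @gdist_lt _ _ H y (inl v) c'%:E; first by rewrite nE.
  rewrite !lte_fin in w1l w2l.
  have [y1 [h1 [r1 [_ [Ky1 h1P r1P l1 _]]]]] := walk_first_hit w1P Ky Ku.
  have [y2 [h2 [r2 [_ [Ky2 h2P r2P l2 _]]]]] := walk_first_hit w2P Ky Kv.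
  have r10 := walk_length_ge0 r1; have r20 := walk_length_ge0 r2.
  have yy : y1 = y2.
    apply: contrapT => yy.
    have := meeting Ky1 Ky2 yy (is_walk_cat (is_walk_rev h1P) h2P).
    by rewrite walk_length_cat walk_length_rev; lra.
  rewrite -yy in h2P r2P.
  have [b bP bE] := curve_path_surj pathK up pvs pes (z := inl y1) Ky1.
  have pos o : is_walk (outside H K) y o (inl y1) -> delta <= walk_length o.
    move=> oP; have {}oP := is_walk_rev oP; rewrite -walk_length_rev.
    apply: deltaP (walk_reach oP) => yE.
    by apply: Ky; rewrite -yE.
  exists b, (walk_length h1), (walk_length h2); split; rewrite ?pos//.
    rewrite bE in r1P r2P; split.
      by have := walk_ge_real (gdist_gmu bP) r1P; lra.
    by have := walk_ge_real (gdist_gmv bP) r2P; lra.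
  by rewrite /gm -bE; split; apply/gdist_walk/outside_walk.
split.
  (* Adding the two estimates of [entry] gives [alpha + 2 * delta < m + n + 2 * eps], so
     [eps <= delta] suffices; the other bounds keep the budgets within [alpha]. *)
  pose eps := Num.min delta (Num.min (alpha - m) (alpha - n)).
  have eps0 : 0 < eps by rewrite !lt_min delta0 !subr_gt0 ma.
  have e1 : eps <= delta by rewrite ge_min lexx.
  have e2 : eps <= alpha - m by rewrite !ge_min lexx orbT.
  have e3 : eps <= alpha - n by rewrite !ge_min lexx !orbT.
  have [||b [c1 [c2 [/andP[? ?] ? ? [? ?] _]]]] := entry (m + eps) (n + eps);
    try (by apply/andP; split; lra).
  lra.
move=> a aP; apply/lee_addgt0Pr => eps eps0.
pose c := Num.min (Num.max m n + eps) alpha.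
have cP : Num.max m n < c by rewrite lt_min ltrDl eps0 gt_max ma.
have ca : c <= alpha by rewrite ge_min lexx orbT.
have [mc nc] : m < c /\ n < c by move: cP; rewrite gt_max => /andP.
have [||b [c1 [c2 [bP _ _ [b1 b2] [d1 d2]]]]] := entry c c; rewrite ?mc ?nc//.
apply: (@le_trans _ _ c%:E); last by rewrite -EFinD lee_fin ge_min lexx.
apply: le_trans (gdist_triangle _ _ (gm b) _) _; rewrite gdist_gm//.
(* Going on from [b] towards [u] costs at most [b], and towards [v] at most [alpha - b]; [b1] and
   [b2] have room for exactly these amounts. *)
have [ab|ba] := leP a b.
  rewrite ger0_norm ?subr_ge0//; apply: le_trans (leeD d1 (lexx _)) _.
  by rewrite -EFinD lee_fin; case/andP: aP; lra.
rewrite ltr0_norm ?subr_lt0//; apply: le_trans (leeD d2 (lexx _)) _.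
by rewrite -EFinD lee_fin; case/andP: aP; lra.
Qed.

End Attachment.

(** * Contractible realizations *)

Section Contractible.
Context {R : realType} {V : choiceType} (K : complex V).
Let T : topologicalType := realization R K.

Definition vertex_pt (a : V) : {fsfun V -> R with 0} :=
  [fsfun x in [fset a]%fset => 1].

Lemma finsupp_vertex_pt a : finsupp (vertex_pt a) = [fset a]%fset.
Proof.
apply/fsetP => x; rewrite mem_finsupp fsfunE !inE.
by case: (x == a); rewrite ?oner_neq0 ?eqxx.
Qed.

Lemma vertex_pt_geom a :
  simplex K [fset a]%fset -> `[< geom_pt K (vertex_pt a) >].
Proof.
move=> Ka; apply/asboolP; split.
- by rewrite finsupp_vertex_pt.
- by move=> v; rewrite fsfunE; case: ifP; rewrite ?ler01.
- by rewrite finsupp_vertex_pt big_seq_fset1 fsfunE inE eqxx.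
Qed.

(** A point closer to [b] than the coordinate of [b] at [z] still has [z] in its support, and one
    vertex decides the side of the whole simplex. *)
Lemma weak_open_split (D : set V) :
  (forall s, simplex K s -> forall x y, x \in s -> y \in s -> D x -> D y) ->
  weak_open [set b : realization R K | forall v, v \in finsupp (val b) -> D v].
Proof.
move=> split_D s Ks b Db bs.
have /asboolP[Kb b0 b1] := valP b.
have /fset0Pn[z zb] : finsupp (val b) != fset0 by exact: simplex_neq0 Kb.
have bz : 0 < val b z by rewrite lt_neqAle b0 eq_sym -mem_finsupp zb.
exists (val b z) => // b' _ near_b v vb'.
have /asboolP[Kb' b'0 _] := valP b'.
have zb' : z \in finsupp (val b').
  rewrite mem_finsupp; apply/eqP => b'z.
  have := near_b z (fsubsetP bs _ zb).
  by rewrite b'z subr0 ger0_norm ?ltxx// b0.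
exact: split_D Kb' _ _ zb' vb' (Db _ zb).
Qed.

(** The homotopy joins every point to [x0] by a path, and both sides of the split are open and
    closed. With a vertex on either side, [x0] would lie on both. *)
Lemma contractible_no_split (D : set V) : contractible R T ->
  (forall s, simplex K s -> forall x y, x \in s -> y \in s -> D x -> D y) ->
  forall a b, simplex K [fset a]%fset -> simplex K [fset b]%fset -> D a -> D b.
Proof.
move=> [x0 [h [h_cont h0 h1]]] split_D a b Ka Kb Da; apply: contrapT => Db.
pose U E := [set b : T | forall v, v \in finsupp (val b) -> E v].
have oD : open (U D) by exact: weak_open_split.
have oDC : open (U (~` D)).
  apply: weak_open_split => s Ks x y xs ys Dx Dy; apply: Dx.
  exact: split_D Ks _ _ ys xs Dy.
have UC : U (~` D) = ~` U D.
  apply/seteqP; split => c /=.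
    have /asboolP[Kc _ _] := valP c.
    have /fset0Pn[z zc] : finsupp (val c) != fset0 by exact: simplex_neq0 Kc.
    by move=> /(_ z zc) Dz /(_ z zc).
  move=> /existsNP[z] /not_implyP[zc Dz] v vc Dv; apply: Dz.
  have /asboolP[Kc _ _] := valP c.
  exact: split_D Kc _ _ vc zc Dv.
have constant_side (E : set V) (c : T) : open (U E) -> closed (U E) ->
    U E c -> U E x0.
  move=> oE cE Ec; pose f t := h (c, t).
  have fc : {within `[(0 : R), 1], continuous f}.
    apply/subspace_continuousP => t tI.
    move/subspace_continuousP : h_cont => /(_ (c, t)) /=.
    rewrite /= in_itv /= in tI; move=> /(_ tI) hc.
    move=> P /hc[[A B] [/= cA tB] AB].
    apply: filterS tB => s sB sI; apply: (AB (c, s)).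
      by split=> //=; exact: nbhs_singleton.
    by rewrite /= in_itv /= in sI.
  have fconn := connected_continuous_connected (@segment_connected R 0 1) fc.
  have f0 : (f @` `[(0 : R), 1]) c.
    by exists 0; [rewrite /= in_itv /= lexx ler01|exact: h0].
  have f1 : (f @` `[(0 : R), 1]) x0.
    by exists 1; [rewrite /= in_itv /= lexx ler01|exact: h1].
  have e : f @` `[(0 : R), 1] `&` U E = f @` `[(0 : R), 1].
    by apply: fconn; [exists c|exists (U E)|exists (U E)].
  by move: f1; rewrite -e => -[].
have cD : closed (U D) by rewrite -openC -UC.
have cDC : closed (U (~` D)) by rewrite UC closedC.
pose pa : T := Sub (vertex_pt a) (vertex_pt_geom Ka).
pose pb : T := Sub (vertex_pt b) (vertex_pt_geom Kb).
have Dx0 : U D x0.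
  apply: (constant_side D pa) => // v.
  by rewrite /= finsupp_vertex_pt inE => /eqP ->.
have : U (~` D) x0.
  apply: (constant_side _ pb) => // v.
  by rewrite /= finsupp_vertex_pt inE => /eqP ->.
by rewrite UC.
Qed.

End Contractible.

(** * Vietoris-Rips complexes of subsets of a line *)

Lemma vr_simplexP (R : realType) (V : choiceType) (d : V -> V -> \bar R) (Z : set V)
    (r : R) (s : {fset V}) : simplex (VR d Z r) s <->
  [/\ s != fset0, forall x, x \in s -> Z x &
    forall x y, x \in s -> y \in s -> (d x y <= r%:E)%E].
Proof.
split=> -[s0 sZ sr]; split=> //.
  move=> x y xs ys; apply: le_trans sr; apply: ereal_sup_ubound.
  by exists (x, y).
by apply: ge_ereal_sup => _ [[x y] /= [xs ys] <-]; exact: sr.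
Qed.

Section VRLine.
Context {R : realType} {k : fieldType} {V : choiceType}.
Context (d : V -> V -> \bar R) (A : set V) (pos : V -> R) (a0 : V).
Hypothesis Aa0 : A a0.
Hypothesis d_pos : forall a b, A a -> A b -> d a b = `|pos a - pos b|%:E.
Hypothesis pos_inj : forall a b, A a -> A b -> pos a = pos b -> a = b.

Variable r : R.
Hypothesis r0 : 0 < r.

Definition towards (b b' : V) : Prop :=
  `|pos b - pos b'| <= r /\
  (pos a0 <= pos b' < pos b \/ pos b < pos b' <= pos a0).

(** A finite substitute for [A]: a chain has finitely many vertices, and the hops back to [a0] allow
    the vertices to be removed one by one, the farthest first. *)
Definition linked (F : {fset V}) : Prop :=
  [/\ a0 \in F, [set` F] `<=` A &
    forall b, b \in F -> b != a0 -> exists2 b', b' \in F & towards b b'].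

Hypothesis dense : forall b, A b -> r < `|pos b - pos a0| ->
  exists b', [/\ A b', towards b b' & r / 2 <= `|pos b - pos b'|].

Lemma linked1 : linked [fset a0]%fset.
Proof.
split; first by rewrite inE.
  by move=> x /=; rewrite inE => /eqP ->.
by move=> b; rewrite inE => /eqP ->; rewrite eqxx.
Qed.

Lemma linkedU F F' : linked F -> linked F' -> linked (F `|` F')%fset.
Proof.
move=> [aF FA Fl] [_ FA' Fl']; split; first by rewrite inE aF.
  by move=> x /=; rewrite inE => /orP[/FA|/FA'].
move=> b; rewrite inE => /orP[/Fl|/Fl'] bl /bl[b' b'F bb']; exists b' => //;
  by rewrite inE b'F ?orbT.
Qed.

Lemma linked_add F b b' : linked F -> A b -> b' \in F -> towards b b' ->
  linked (b |` F)%fset.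
Proof.
move=> [aF FA Fl] Ab b'F bb'; split; first by rewrite !inE aF orbT.
  by move=> x /=; rewrite !inE => /orP[/eqP ->//|/FA].
move=> c; rewrite !inE => /orP[/eqP -> _|/Fl cl /cl[c' c'F cc']].
  by exists b' => //; rewrite !inE b'F orbT.
by exists c' => //; rewrite !inE c'F orbT.
Qed.

Lemma linked_mem b : A b -> exists2 F, linked F & b \in F.
Proof.
move=> Ab.
(* [m] bounds the number of hops: far from [a0], each hop supplied by [dense] shortens the distance
   by at least [r / 2]. *)
have [m bm] : exists m : nat, `|pos b - pos a0| <= m%:R * (r / 2).
  exists (Num.truncn (2 * `|pos b - pos a0| / r)).+1.
  rewrite mulrA ler_pdivlMr// mulrC -ler_pdivrMr//.
  exact/ltW/truncnS_gt.
elim: m b Ab bm => [|m IH] b Ab.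
  rewrite mul0r normr_le0 subr_eq0 => /eqP /(pos_inj Ab Aa0) ->.
  by exists [fset a0]%fset; [exact: linked1|rewrite inE].
move=> bm; have [close|far] := leP `|pos b - pos a0| r.
  have [->|ba] := eqVneq b a0.
    by exists [fset a0]%fset; [exact: linked1|rewrite inE].
  exists (b |` [fset a0])%fset; last by rewrite !inE eqxx.
  apply: (linked_add linked1 Ab (b' := a0)); first by rewrite inE.
  split=> //; have : pos b != pos a0.
    by apply: contra_neq ba; exact: pos_inj.
  by rewrite neq_lt => /orP[?|?]; [right|left]; rewrite lexx ?andbT.
have [b' [Ab' bb' lo]] := dense Ab far.
have [|F lF b'F] := IH b' Ab'.
  move: bm lo; rewrite -natr1 mulrDl mul1r; case: bb'.2 => /andP[b1 b2].
    have [p1 p2 p3] : [/\ 0 <= pos b - pos a0, 0 <= pos b - pos b'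
      & 0 <= pos b' - pos a0] by split; lra.
    by rewrite !ger0_norm// => ? ?; lra.
  have [p1 p2 p3] : [/\ pos b - pos a0 <= 0, pos b - pos b' <= 0
    & pos b' - pos a0 <= 0] by split; lra.
  by rewrite !ler0_norm// => ? ?; lra.
exists (b |` F)%fset; last by rewrite !inE eqxx.
exact: linked_add lF Ab b'F bb'.
Qed.

Lemma linked_seq (l : seq V) : (forall x, x \in l -> A x) ->
  exists2 F, linked F & {subset l <= F}.
Proof.
elim: l => [|b l IH] lA; first by exists [fset a0]%fset => //; exact: linked1.
have [F lF lsub] : exists2 F, linked F & {subset l <= F}.
  by apply: IH => x xl; apply: lA; rewrite in_cons xl orbT.
have [F' lF' bF'] := linked_mem (lA b (mem_head _ _)).
exists (F' `|` F)%fset; first exact: linkedU.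
by move=> x; rewrite !inE => /orP[/eqP ->|/lsub ->]; rewrite ?bF' ?orbT.
Qed.

(* In a linked set the point farthest from a0 is dominated by the point it is
   linked to, so it can be removed. *)
Lemma linked_relative (F : {fset V}) n (c : chain k V) : linked F ->
  is_chain (VR d [set` F] r) n c -> carried (at_base a0) (boundary c) ->
  exists e a, [/\ carried (fun s => size s = n.+1 /\ at_base a0 s) e,
    is_chain (VR d [set` F] r) n.+1 a & c = e + boundary a].
Proof.
have [N] := ubnP #|` F|; elim: N F c => [//|N IH] F c /ltnSE FN lF Fc bc.
have [aF FA Fl] := lF.
have [Fa|] := pselect (forall x, x \in F -> x = a0).
  exists c, 0; split; last by rewrite linear0 addr0.
    move=> s /Fc[sn [_ sF _]]; split=> // x xs; apply: Fa; apply: sF.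
    by rewrite /= mem_fset_seq.
  exact: is_chain0.
move=> /existsNP[x0 /not_implyP[x0F x0a]].
pose dist x := `|pos x - pos a0|.
have [b [bF b_far]] : exists b, b \in F /\ forall x, x \in F -> dist x <= dist b.
  pose i0 : F := [` x0F]%fset.
  have [i _ iP] := @arg_maxP _ R F i0 xpredT (fun i => dist (val i)) isT.
  exists (val i); split; first exact: valP.
  by move=> x xF; exact: (iP [` xF]%fset).
have posE x : x \in F -> x != a0 -> pos x != pos a0.
  by move=> xF; apply: contra_neq => /pos_inj; apply; exact: FA.
have ba : b != a0.
  apply/eqP => ba; have := b_far _ x0F; rewrite /dist ba subrr normr0 normr_le0.
  by rewrite subr_eq0; apply/negP/posE => //; exact/eqP.
have [b' b'F [bb' dir]] := Fl _ bF ba.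
have b'b : b' != b.
  by apply/eqP => e; move: dir; rewrite e !ltxx andbF /= => -[].
pose F' := (F `\ b)%fset.
have F'F : (F' `<=` F)%fset by exact: fsubD1set.
(* No point needs [b] as its link, since it would be farther from [a0] than [b] is. *)
have lF' : linked F'.
  split; first by rewrite !inE eq_sym ba.
    by move=> x /=; rewrite !inE => /andP[_ /FA].
  move=> x; rewrite !inE => /andP[xb xF] xa.
  have [y yF [xy dxy]] := Fl _ xF xa; exists y => //.
  rewrite !inE yF andbT; apply/eqP => yb.
  have := b_far _ xF; rewrite /dist; move: dxy; rewrite yb => -[/andP[b1 b2]|/andP[b1 b2]].
    have [p1 p2] : 0 <= pos b - pos a0 /\ 0 <= pos x - pos a0 by split; lra.
    by rewrite !ger0_norm// lerD2r leNgt b2.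
  have [p1 p2] : pos b - pos a0 <= 0 /\ pos x - pos a0 <= 0 by split; lra.
  by rewrite !ler0_norm// lerN2 lerD2r leNgt b1.
(* No point of [F] lies beyond [b], so [x] and [b'] both lie in the segment of length [r] that
   starts at [b] in the direction of [a0]. *)
have dom x : x \in F -> `|pos x - pos b| <= r -> `|pos x - pos b'| <= r.
  move=> xF; have := b_far _ xF; rewrite /dist.
  move: bb'; rewrite !ler_norml => /andP[? ?] + /andP[? ?].
  case: dir => /andP[? ?].
    rewrite (ger0_norm (_ : 0 <= pos b - pos a0)); last by lra.
    by move=> /andP[? ?]; apply/andP; split; lra.
  rewrite (ler0_norm (_ : pos b - pos a0 <= 0)); last by lra.
  by move=> /andP[? ?]; apply/andP; split; lra.
(* Only [b] lies outside [F'], so the bad simplices are those containing [b]; they form a single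
   group, with apex [b']. *)
pose good := [set T : {fset V} | T = fset0].
have [||||l [a [Fl' gl Fa cE]]] := @collapse k V (VR d [set` F] r) [set` F'] good
    (fun=> b') _ _ _ n c Fc.
- by move=> T T' ->; rewrite fsubset0 => /eqP ->.
- by [].
- move=> s Fs; set ty := [fset x in s | _]%fset => bad.
  have s0 : s != [::].
    apply: contra_not_neq bad => s0; apply/fsetP => x.
    by rewrite mem_fset_seq_if s0 inE.
  have /vr_simplexP[_ sF' sr'] := Fs.
  have sF x : x \in s -> x \in F by move=> xs; apply: sF'; rewrite mem_fset_seq.
  have sr x y : x \in s -> y \in s -> (d x y <= r%:E)%E.
    by move=> xs ys; apply: sr'; rewrite mem_fset_seq.
  have bs : b \in s.
    apply: contrapT => /negP bs; apply: bad; apply/fsetP => x.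
    rewrite mem_fset_seq_if inE; apply/negbTE; rewrite negb_and negbK.
    case: (boolP (x \in s)) => //= xs; apply/mem_set; rewrite /= !inE.
    by rewrite (sF _ xs) andbT; apply: contraNneq bs => <-.
  split; first by rewrite /= !inE b'b.
  have xb' x : x \in s -> (d x b' <= r%:E)%E.
    move=> xs; have xF := sF _ xs; rewrite d_pos ?lee_fin; [|exact: FA|exact: FA].
    apply: dom => //; have := sr _ _ xs bs.
    by rewrite d_pos ?lee_fin//; exact: FA.
  apply/vr_simplexP; split; first exact: fset_seq_neq0.
    by move=> x; rewrite mem_fset_seq in_cons => /orP[/eqP ->//|/sF].
  have dC x : x \in F -> d b' x = d x b'.
    by move=> xF; rewrite !d_pos 1?distrC//; exact: FA.
  move=> x y; rewrite !mem_fset_seq !in_cons.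
  move=> /orP[/eqP ->|xs] /orP[/eqP ->|ys].
  + by rewrite d_pos ?subrr ?normr0 ?lee_fin ?ltW//; exact: FA.
  + by rewrite dC; [exact: xb'|exact: sF].
  + exact: xb'.
  + exact: sr.
- move=> s /bc sa; apply/fsetP => x; rewrite mem_fset_seq_if inE.
  apply/negbTE; rewrite negb_and negbK; case: (boolP (x \in s)) => //= xs.
  by apply/mem_set; rewrite /= (sa _ xs) !inE aF eq_sym ba.
have F'l : is_chain (VR d [set` F'] r) n l.
  move=> s sl; have [sn [s0 sF sr]] := Fl' _ sl; split=> //; split=> //.
  move=> x xs; have := gl _ sl => /fsetP /(_ x).
  rewrite mem_fset_seq_if inE; rewrite /= mem_fset_seq in xs; rewrite xs /=.
  by move/negbFE => /set_mem.
have [||e [a' [ea F'a' lE]]] := IH F' l _ lF' F'l.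
- by apply: leq_trans FN; apply: fproper_ltn_card; exact: fproperD1.
- have : boundary c = boundary l by rewrite cE linearD /= (boundaryK Fa) addr0.
  by move=> <-.
exists e, (a' + a); split=> //.
  apply: is_chainD => // s /F'a'[sn [s0 sF sr]]; split=> //; split=> //.
  by move=> x /sF /(fsubsetP F'F).
by rewrite linearD /= addrA -lE.
Qed.

Lemma vr_line_relative n (c : chain k V) : is_chain (VR d A r) n c ->
  carried (at_base a0) (boundary c) ->
  exists e a, [/\ carried (fun s => size s = n.+1 /\ at_base a0 s) e,
    is_chain (VR d A r) n.+1 a & c = e + boundary a].
Proof.
move=> Ac bc; have [x|F lF sF] := linked_seq (l := flatten (msupp c)).
  move=> /flattenP[s sc xs]; have [_ [_ sA _]] := Ac _ sc.
  by apply: sA; rewrite /= mem_fset_seq.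
have [|e [a [ea Fa cE]]] := @linked_relative F n c lF _ bc.
  move=> s sc; have [sn [s0 _ sr]] := Ac _ sc; split=> //; split=> // x.
  rewrite /= mem_fset_seq => xs; apply: sF; apply/flattenP; by exists s.
exists e, a; split=> // s /Fa[sn [s0 sF' sr]]; split=> //; split=> //.
by have [_ FA _] := lF; move=> x /sF' /FA.
Qed.

End VRLine.

(** * The apex of a mixed simplex *)

(** Two points reached through the same end both lie within [r] of it. If they are reached through
    different ends, either alternative for [p] and [q] forces [alpha <= r]; the factor 2 enters
    here. *)
Lemma two_ends_diam (R : realFieldType) (alpha p q r s t : R) :
  0 <= s <= alpha -> 0 <= t <= alpha -> 0 <= p -> 0 <= q ->
  2 * alpha <= p + q \/ `|p - q| = alpha ->
  (p + s <= r) || (q + (alpha - s) <= r) ->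
  (p + t <= r) || (q + (alpha - t) <= r) -> `|s - t| <= r.
Proof.
move=> /andP[s0 s1] /andP[t0 t1] p0 q0 far sr tr; rewrite ler_norml.
have {}far : 2 * alpha <= p + q \/ (p = q + alpha \/ q = p + alpha).
  case: far => [|e]; first by left.
  right; have [pq0|pq0] := leP 0 (p - q).
    by move: e; rewrite ger0_norm// => e; left; lra.
  by move: e; rewrite ltr0_norm// => e; right; lra.
have [ra|ar] := ltP r alpha; last by apply/andP; split; lra.
by case/orP: sr => ?; case/orP: tr => ?; case: far => [?|[?|?]];
  apply/andP; split; lra.
Qed.

Section StarCenter.
Context {R : realType} {P : choiceType} (dX dY : P -> P -> \bar R).
Context (X Y A : set P) (gm : R -> P) (alpha : R).
Hypothesis alpha0 : 0 <= alpha.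
Hypothesis dX0 : forall s t, (0 <= dX s t)%E.
Hypothesis dY0 : forall s t, (0 <= dY s t)%E.
Hypothesis dXC : forall s t, dX s t = dX t s.
Hypothesis dYC : forall s t, dY s t = dY t s.
Hypothesis dX_triangle : forall s t z, (dX s z <= dX s t + dX t z)%E.
Hypothesis dY_triangle : forall s t z, (dY s z <= dY s t + dY t z)%E.
Hypothesis XYA : X `&` Y = A.
Hypothesis A_gm : forall a, A a -> exists2 t, 0 <= t <= alpha & a = gm t.
Hypothesis A_gm0 : A (gm 0).
Hypothesis A_gm1 : A (gm alpha).
Hypothesis dX_gm : forall s t, 0 <= s <= alpha -> 0 <= t <= alpha ->
  dX (gm s) (gm t) = `|s - t|%:E.
Hypothesis dY_gm : forall s t, 0 <= s <= alpha -> 0 <= t <= alpha ->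
  dY (gm s) (gm t) = `|s - t|%:E.
Hypothesis A_dense : forall s t, 0 <= s -> s < t -> t <= alpha ->
  exists2 c, s <= c <= t & A (gm c).
Hypothesis dX_via : forall x t, X x -> ~ A x -> 0 <= t <= alpha ->
  (mine (dX x (gm 0) + dX (gm 0) (gm t))
        (dX x (gm alpha) + dX (gm alpha) (gm t)) <= dX x (gm t))%E.
Hypothesis dX_ends : forall x p q t, X x -> ~ A x -> dX x (gm 0) = p%:E ->
  dX x (gm alpha) = q%:E -> 0 <= t <= alpha ->
  dX x (gm t) = (Num.min (p + t) (q + (alpha - t)))%:E.
Hypothesis dX_far : forall x p q, X x -> ~ A x -> dX x (gm 0) = p%:E ->
  dX x (gm alpha) = q%:E -> 2 * alpha <= p + q \/ `|p - q| = alpha.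
Hypothesis dY_near : forall y m n, Y y -> ~ A y -> dY y (gm 0) = m%:E ->
  dY y (gm alpha) = n%:E -> m < alpha -> n < alpha ->
  alpha < m + n /\
  forall t, 0 <= t <= alpha -> (dY y (gm t) <= (Num.max m n)%:E)%E.

Let D := glue_dist dX dY X Y A.

Let in0 : 0 <= (0 : R) <= alpha. Proof. by rewrite lexx. Qed.
Let in1 : 0 <= alpha <= alpha. Proof. by rewrite lexx andbT. Qed.

Let AX a : A a -> X a. Proof. by rewrite -XYA => -[]. Qed.
Let AY a : A a -> Y a. Proof. by rewrite -XYA => -[]. Qed.

Lemma glue_distXX s t : X s -> X t -> D s t = dX s t.
Proof. by move=> Xs Xt; rewrite /D /glue_dist; case: asboolP => // -[]. Qed.

Lemma glue_distYY s t : Y s -> Y t -> D s t = dY s t.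
Proof.
move=> Ys Yt; rewrite /D /glue_dist; case: asboolP => [[Xs Xt]|_].
  have As : A s by rewrite -XYA.
  have At : A t by rewrite -XYA.
  have [a aP ->] := A_gm As; have [b bP ->] := A_gm At.
  by rewrite dX_gm// dY_gm.
by case: asboolP => // -[].
Qed.

Lemma glue_distXY s t : X s -> ~ A s -> Y t -> ~ A t ->
  D s t = ereal_inf [set (dX s a + dY a t)%E | a in A].
Proof.
move=> Xs As Yt At; rewrite /D /glue_dist.
case: asboolP => [[_ Xt]|_]; first by case: At; rewrite -XYA.
case: asboolP => [[Ys _]|_]; first by case: As; rewrite -XYA.
by case: asboolP => // -[].
Qed.

Let fin_le (c : \bar R) (r : R) : (0 <= c)%E -> (c <= r%:E)%E ->
  exists2 p, c = p%:E & 0 <= p <= r.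
Proof.
by case: c => [p|//|//]; rewrite !lee_fin => p0 pr; exists p => //; rewrite p0.
Qed.

(** A glued path leaves [x] through an end of G_A, and the stretch from there to the gluing point
    [a] is equally long in [dY], so the Y side absorbs it. The distances may still be infinite at
    this stage. *)
Let cross x y (r : R) : X x -> ~ A x -> Y y -> ~ A y -> (D x y <= r%:E)%E ->
  (dX x (gm 0) + dY y (gm 0) <= r%:E)%E \/
  (dX x (gm alpha) + dY y (gm alpha) <= r%:E)%E.
Proof.
move=> Xx Ax Yy Ay; rewrite glue_distXY// => xy.
have : (mine (dX x (gm 0) + dY y (gm 0)) (dX x (gm alpha) + dY y (gm alpha))
    <= r%:E)%E.
  apply: le_trans xy; apply/ereal_infP => _ [a Aa <-].
  have [t tP ->] := A_gm Aa.
  have step s : 0 <= s <= alpha ->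
      (dX x (gm s) + dX (gm s) (gm t) <= dX x (gm t))%E ->
      (dX x (gm s) + dY y (gm s) <= dX x (gm t) + dY (gm t) y)%E.
    move=> sP st; apply: le_trans (leeD st (lexx _)).
    rewrite -addeA; apply: leeD => //; rewrite dX_gm// -dY_gm// dYC.
    exact: dY_triangle.
  rewrite ge_min; have := dX_via Xx Ax tP.
  by rewrite ge_min => /orP[/step ->|/step ->]; rewrite ?orbT.
by rewrite ge_min => /orP[?|?]; [left|right].
Qed.

Lemma star_center (T : {fset P}) (r : R) : 0 <= r ->
  (forall t, t \in T -> (X t \/ Y t) /\ ~ A t) ->
  (exists2 x, x \in T & X x) -> (exists2 y, y \in T & Y y) ->
  (forall s t, s \in T -> t \in T -> (D s t <= r%:E)%E) ->
  exists a, [/\ A a, forall t, t \in T -> (D a t <= r%:E)%E &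
    forall b, A b -> (forall t, t \in T -> (D b t <= r%:E)%E) ->
      (D a b <= r%:E)%E].
Proof.
move=> r0 TP [x0 x0T Xx0] [y0 y0T Yy0] Tr.
have TA t : t \in T -> ~ A t by move=> /TP[].
have crossT x y : x \in T -> X x -> y \in T -> Y y ->
    (dX x (gm 0) + dY y (gm 0) <= r%:E)%E \/
    (dX x (gm alpha) + dY y (gm alpha) <= r%:E)%E.
  by move=> xT Xx yT Yy; apply: cross => //; [exact: TA|exact: TA|exact: Tr].
have d01 : dX (gm 0) (gm alpha) = alpha%:E.
  by rewrite dX_gm// sub0r normrN ger0_norm.
have e01 : dY (gm 0) (gm alpha) = alpha%:E.
  by rewrite dY_gm// sub0r normrN ger0_norm.
(* Closeness to [y0] bounds one of the two distances by [r]; the triangle inequality along G_A makes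
   the other finite. *)
have xreal x : x \in T -> X x -> exists p q, [/\ dX x (gm 0) = p%:E,
    dX x (gm alpha) = q%:E, 0 <= p /\ 0 <= q & p <= q + alpha /\ q <= p + alpha].
  move=> xT Xx.
  have t1 : (dX x (gm alpha) <= dX x (gm 0) + alpha%:E)%E.
    by rewrite -d01; exact: dX_triangle.
  have t2 : (dX x (gm 0) <= dX x (gm alpha) + alpha%:E)%E.
    by rewrite -d01 (dXC (gm 0)); exact: dX_triangle.
  case: (crossT x y0) => // le.
    have [|p pE /andP[p0 _]] := @fin_le (dX x (gm 0)) r (dX0 _ _).
      by apply: le_trans le; rewrite leeDl.
    rewrite pE -EFinD in t1.
    have [q qE /andP[q0 qp]] := fin_le (dX0 _ _) t1.
    exists p, q; split=> //; split=> //.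
    by move: t2; rewrite pE qE -EFinD lee_fin.
  have [|q qE /andP[q0 _]] := @fin_le (dX x (gm alpha)) r (dX0 _ _).
    by apply: le_trans le; rewrite leeDl.
  rewrite qE -EFinD in t2.
  have [p pE /andP[p0 qp]] := fin_le (dX0 _ _) t2.
  exists p, q; split=> //; split=> //.
  by move: t1; rewrite pE qE -EFinD lee_fin.
have yreal y : y \in T -> Y y -> exists m n, [/\ dY y (gm 0) = m%:E,
    dY y (gm alpha) = n%:E, 0 <= m /\ 0 <= n & m <= n + alpha /\ n <= m + alpha].
  move=> yT Yy.
  have t1 : (dY y (gm alpha) <= dY y (gm 0) + alpha%:E)%E.
    by rewrite -e01; exact: dY_triangle.
  have t2 : (dY y (gm 0) <= dY y (gm alpha) + alpha%:E)%E.
    by rewrite -e01 (dYC (gm 0)); exact: dY_triangle.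
  case: (crossT x0 y) => // le.
    have [|p pE /andP[p0 _]] := @fin_le (dY y (gm 0)) r (dY0 _ _).
      by apply: le_trans le; rewrite leeDr.
    rewrite pE -EFinD in t1.
    have [q qE /andP[q0 qp]] := fin_le (dY0 _ _) t1.
    exists p, q; split=> //; split=> //.
    by move: t2; rewrite pE qE -EFinD lee_fin.
  have [|q qE /andP[q0 _]] := @fin_le (dY y (gm alpha)) r (dY0 _ _).
    by apply: le_trans le; rewrite leeDr.
  rewrite qE -EFinD in t2.
  have [p pE /andP[p0 qp]] := fin_le (dY0 _ _) t2.
  exists p, q; split=> //; split=> //.
  by move: t1; rewrite pE qE -EFinD lee_fin.
have crossR x y p q m n : x \in T -> X x -> y \in T -> Y y ->
    dX x (gm 0) = p%:E -> dX x (gm alpha) = q%:E ->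
    dY y (gm 0) = m%:E -> dY y (gm alpha) = n%:E -> p + m <= r \/ q + n <= r.
  move=> xT Xx yT Yy pE qE mE nE.
  by have := crossT _ _ xT Xx yT Yy; rewrite pE qE mE nE -!EFinD !lee_fin.
have DX a x : A a -> X x -> D a x = dX x a.
  by move=> Aa Xx; rewrite glue_distXX// ?dXC//; exact: AX.
have DY a y : A a -> Y y -> D a y = dY y a.
  by move=> Aa Yy; rewrite glue_distYY// ?dYC//; exact: AY.
have near_T a : A a -> (forall x, x \in T -> X x -> (dX x a <= r%:E)%E) ->
    (forall y, y \in T -> Y y -> (dY y a <= r%:E)%E) ->
    forall t, t \in T -> (D a t <= r%:E)%E.
  move=> Aa aX aY t tT; have [[Xt|Yt] _] := TP _ tT.
    by rewrite DX//; exact: aX.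
  by rewrite DY//; exact: aY.
(* The single point [x0] settles the third condition on the apex, so that only closeness to [T]
   remains to be achieved. *)
have diam_near a b : A a -> A b -> (forall t, t \in T -> (D a t <= r%:E)%E) ->
    (forall t, t \in T -> (D b t <= r%:E)%E) -> (D a b <= r%:E)%E.
  move=> Aa Ab /(_ _ x0T) + /(_ _ x0T); rewrite (DX a x0)// (DX b x0)//.
  have [p [q [pE qE [p0 q0] [pq qp]]]] := xreal _ x0T Xx0.
  have Ax0 := TA _ x0T; rewrite glue_distXX; [|exact: AX|exact: AX].
  have [s sP ->] := A_gm Aa; have [t tP ->] := A_gm Ab.
  rewrite (dX_ends Xx0 Ax0 pE qE sP) (dX_ends Xx0 Ax0 pE qE tP) dX_gm//.
  rewrite !lee_fin !ge_min.
  exact: two_ends_diam sP tP p0 q0 (dX_far Xx0 Ax0 pE qE).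
suff [a [Aa aX aY]] : exists a, [/\ A a,
    forall x, x \in T -> X x -> (dX x a <= r%:E)%E &
    forall y, y \in T -> Y y -> (dY y a <= r%:E)%E].
  exists a; split=> //; first exact: near_T.
  by move=> b Ab bT; apply: diam_near => //; exact: near_T.
pose fail s := (exists x, [/\ x \in T, X x & (r%:E < dX x (gm s))%E]) \/
               (exists y, [/\ y \in T, Y y & (r%:E < dY y (gm s))%E]).
have ok_or_fail s : A (gm s) -> (exists a, [/\ A a,
    forall x, x \in T -> X x -> (dX x a <= r%:E)%E &
    forall y, y \in T -> Y y -> (dY y a <= r%:E)%E]) \/ fail s.
  move=> As; have [?|nf] := pselect (fail s); [by right|left].
  exists (gm s); split=> // [x xT Xx|y yT Yy];
    rewrite leNgt; apply/negP => lt; apply: nf.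
    by left; exists x.
  by right; exists y.
have [//|f0] := ok_or_fail _ A_gm0; have [//|f1] := ok_or_fail _ A_gm1.
(* A point too far from one end must communicate with the opposite side through the other end.
   Failures on different sides contradict each other; two failures in Y put both ends within [alpha]
   of [x0], against [dX_far]. Only two failures in X are possible. *)
case: f0 => [[x1 [x1T Xx1 lt0]]|[y1 [y1T Yy1 lt0]]];
  case: f1 => [[x2 [x2T Xx2 lt1]]|[y2 [y2T Yy2 lt1]]].
- have [p1 [q1 [p1E q1E [p10 q10] [pq1 qp1]]]] := xreal _ x1T Xx1.
  have [p2 [q2 [p2E q2E [p20 q20] [pq2 qp2]]]] := xreal _ x2T Xx2.
  rewrite p1E lte_fin in lt0; rewrite q2E lte_fin in lt1.
  have yclose y : y \in T -> Y y -> exists m n, [/\ dY y (gm 0) = m%:E,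
      dY y (gm alpha) = n%:E, m < alpha /\ n < alpha & m <= r /\ n <= r].
    move=> yT Yy; have [m [n [mE nE [m0 n0] _]]] := yreal _ yT Yy.
    have qn : q1 + n <= r.
      by case: (crossR _ _ _ _ _ _ x1T Xx1 yT Yy p1E q1E mE nE) => // ?; lra.
    have pm : p2 + m <= r.
      by case: (crossR _ _ _ _ _ _ x2T Xx2 yT Yy p2E q2E mE nE) => // ?; lra.
    by exists m, n; split=> //; split; lra.
  have [m0 [n0 [m0E n0E [m0a n0a] [m0r n0r]]]] := yclose _ y0T Yy0.
  have [mn _] := dY_near Yy0 (TA _ y0T) m0E n0E m0a n0a.
  have m0_ge0 : 0 <= m0 by have := dY0 y0 (gm 0); rewrite m0E lee_fin.
  (* [c <= m0] serves the points of X that reach [y0] through the end 0, and [alpha - c <= n0] those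
     that reach it through the end [alpha]. *)
  have [|||c /andP[c0 c1] Ac] := @A_dense (alpha - n0) m0; [lra|lra|lra|].
  have cP : 0 <= c <= alpha by apply/andP; split; lra.
  exists (gm c); split=> // [x xT Xx|y yT Yy].
    have [p [q [pE qE _ _]]] := xreal _ xT Xx.
    rewrite (dX_ends Xx (TA _ xT) pE qE cP) lee_fin ge_min.
    by case: (crossR _ _ _ _ _ _ xT Xx y0T Yy0 pE qE m0E n0E) => ?;
      apply/orP; [left|right]; lra.
  have [m [n [mE nE [ma na] [mr nr]]]] := yclose _ yT Yy.
  have [_ nearE] := dY_near Yy (TA _ yT) mE nE ma na.
  by apply: le_trans (nearE _ cP) _; rewrite lee_fin ge_max mr nr.
- have [p1 [q1 [p1E q1E [p10 q10] [pq1 qp1]]]] := xreal _ x1T Xx1.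
  have [m2 [n2 [m2E n2E [m20 n20] _]]] := yreal _ y2T Yy2.
  rewrite p1E lte_fin in lt0; rewrite n2E lte_fin in lt1.
  by case: (crossR _ _ _ _ _ _ x1T Xx1 y2T Yy2 p1E q1E m2E n2E) => ?; lra.
- have [p2 [q2 [p2E q2E [p20 q20] [pq2 qp2]]]] := xreal _ x2T Xx2.
  have [m1 [n1 [m1E n1E [m10 n10] _]]] := yreal _ y1T Yy1.
  rewrite m1E lte_fin in lt0; rewrite q2E lte_fin in lt1.
  by case: (crossR _ _ _ _ _ _ x2T Xx2 y1T Yy1 p2E q2E m1E n1E) => ?; lra.
- have [p [q [pE qE [p0 q0] _]]] := xreal _ x0T Xx0.
  have [m1 [n1 [m1E n1E [m10 n10] [mn1 nm1]]]] := yreal _ y1T Yy1.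
  have [m2 [n2 [m2E n2E [m20 n20] [mn2 nm2]]]] := yreal _ y2T Yy2.
  rewrite m1E lte_fin in lt0; rewrite n2E lte_fin in lt1.
  have qn : q + n1 <= r.
    by case: (crossR _ _ _ _ _ _ x0T Xx0 y1T Yy1 pE qE m1E n1E) => // ?; lra.
  have pm : p + m2 <= r.
    by case: (crossR _ _ _ _ _ _ x0T Xx0 y2T Yy2 pE qE m2E n2E) => // ?; lra.
  have [pa qa] : p < alpha /\ q < alpha by split; lra.
  have [far|/eqP] := dX_far Xx0 (TA _ x0T) pE qE; first by lra.
  by rewrite eq_le => /andP[_]; rewrite leNgt ltr_norml => /negP[]; lra.
Qed.

End StarCenter.

(** * Exits from the path under the degree condition *)

Section DegreeTwo.
Context {R : realType} {G : metric_graph R} (H K : subgraph G).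
Context (u : vertex G) (vs : seq (vertex G)) (es : seq (edge G)).
Hypothesis pathK : is_path K u vs es.
Hypothesis edgesKH : sedges K `<=` sedges H.
Hypothesis deg2 : forall v, sverts K v -> v != u -> v != last u vs ->
  degree_is H v 2.

(** An inner vertex already carries the path edges before and after it, so an edge outside [K] would
    be a third incident one. *)
Lemma degree2_ends e x : sedges (outside H K) e -> src e = x \/ tgt e = x ->
  sverts K x -> x = u \/ x = last u vs.
Proof.
move=> [He Ke] ex Kx; have [->|xu] := eqVneq x u; first by left.
have [->|xv] := eqVneq x (last u vs); first by right.
exfalso; have [p [up pvs pes]] := path_opath pathK.
move: (Kx); rewrite (path_verts pathK) -pvs => /(opath_split up).
move=> [p1 [p2 [pE p1P p1x p2P]]].
have [a1 [p1' p1E]] : exists a p', p1 = rcons p' a.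
  case: (lastP p1) p1x => [ux|p' a _]; last by exists a, p'.
  by move: xu; rewrite -ux eqxx.
have [a2 [p2' p2E]] : exists a p', p2 = a :: p'.
  case: (p2) pE => [|a p'] pE; last by exists a, p'.
  by move: xv; rewrite -pvs pE cats0 -p1x eqxx.
have a1x : src a1.1 = x \/ tgt a1.1 = x.
  move: p1x; rewrite p1E /olast map_rcons last_rcons /oend.
  by case: a1.2; [right|left].
have a2x : src a2.1 = x \/ tgt a2.1 = x.
  move: p2P; rewrite p2E /= => /andP[/eqP + _].
  by rewrite /ostart; case: a2.2; [left|right].
have upe : uniq (map fst p) by rewrite pes; exact: path_uniq_edges pathK.
have a12 : a1.1 != a2.1.
  move: upe; rewrite pE p1E p2E map_cat map_rcons cat_rcons cat_uniq.
  by move=> /and3P[_ _ /= /andP[+ _]]; rewrite inE negb_or => /andP[].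
have Ka a : a \in p -> sedges K a.1.
  by move=> ap; rewrite (path_edges pathK) -pes map_f.
have K1 : sedges K a1.1.
  by apply: Ka; rewrite pE p1E cat_rcons mem_cat mem_head orbT.
have K2 : sedges K a2.1 by apply: Ka; rewrite pE p2E mem_cat mem_head orbT.
have e1 : e != a1.1 by apply: contra_notN Ke => /eqP ->.
have e2 : e != a2.1 by apply: contra_notN Ke => /eqP ->.
pose F := [fset x in [:: e; a1.1; a2.1]]%fset.
have FI : [set` F] `<=` incident_edges H x.
  move=> f; rewrite /= mem_fset_seq !inE => /or3P[]/eqP ->; split=> //;
    exact: edgesKH.
have F3 : ([set` F] #= `I_3)%card.
  apply/card_eq_fsetP; rewrite card_fseq undup_id//.
  by rewrite /= !inE !negb_or e1 e2 a12.
have /card_eqPle[_ le3] := F3; have /card_eqPle[le2 _] := deg2 Kx xu xv.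
have := card_le_trans le3 (card_le_trans (subset_card_le FI) le2).
by rewrite card_le_II.
Qed.

End DegreeTwo.

(** * Relative acyclicity of the union, density, and assembly *)

Lemma lt_third (R : realType) (a : R) (c : \bar R) :
  (a%:E < c / 3%:E)%E -> ((3 * a)%:E < c)%E.
Proof.
have n3 : (3 : R) != 0 by rewrite pnatr_eq0.
case: c => [c| |]; rewrite ?inver (negbTE n3).
- by rewrite -EFinM !lte_fin; lra.
- by rewrite ltry.
- by rewrite mulNyr gtr0_sg ?invr_gt0// mul1e.
Qed.

(** The condition on the apex quantifies over all points of A near the group, not over those of a
    given simplex. The choice by [xget] is thereby a function of the group alone, as [collapse]
    demands. *)
Lemma vr_union_relative (R : realType) (k : fieldType) (V : choiceType)
    (D dX dY : V -> V -> \bar R) (X Y A : set V) (r : R) (a0 : V) :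
  A `<=` X -> A `<=` Y ->
  (forall s t, X s -> X t -> D s t = dX s t) ->
  (forall s t, Y s -> Y t -> D s t = dY s t) ->
  (forall a t, A a -> X t \/ Y t -> D a t = D t a) ->
  (forall T : {fset V}, (forall t, t \in T -> (X t \/ Y t) /\ ~ A t) ->
    (exists2 x, x \in T & X x) -> (exists2 y, y \in T & Y y) ->
    (forall s t, s \in T -> t \in T -> (D s t <= r%:E)%E) ->
    exists a, [/\ A a, forall t, t \in T -> (D a t <= r%:E)%E &
      forall b, A b -> (forall t, t \in T -> (D b t <= r%:E)%E) ->
        (D a b <= r%:E)%E]) ->
  forall n (c : chain k V), is_chain (VR D (X `|` Y) r) n c ->
  carried (union_simplex (VR dX X r) (VR dY Y r)) (boundary c) ->
  exists l b, [/\ is_chain (VR D (X `|` Y) r) n l,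
    carried (union_simplex (VR dX X r) (VR dY Y r)) l,
    is_chain (VR D (X `|` Y) r) n.+1 b & c = l + boundary b].
Proof.
move=> AX AY DX DY DC star n c Kc uc.
pose good := [set T : {fset V} | (forall t, t \in T -> X t) \/
                                 (forall t, t \in T -> Y t)].
pose center (T : {fset V}) := [set a | [/\ A a,
  forall t, t \in T -> (D a t <= r%:E)%E &
  forall b, A b -> (forall t, t \in T -> (D b t <= r%:E)%E) ->
    (D a b <= r%:E)%E]].
pose type (s : seq V) := [fset x in s | x \notin A]%fset.
have typeP s x : reflect (x \in s /\ ~ A x) (x \in type s).
  rewrite /type mem_fset_seq_if; apply: (iffP andP) => -[-> xA]; split=> //.
    by move=> Ax; move: xA; rewrite (mem_set Ax).
  by apply/negP => /set_mem.
have [||||l [b [Kl gl Kb cE]]] := @collapse k V (VR D (X `|` Y) r) A good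
    (fun T => xget a0 (center T)) _ _ _ n c Kc.
- by move=> T T' [gT|gT] /fsubsetP T'T; [left|right] => t /T'T /gT.
- by left.
- rewrite -/type => s /vr_simplexP[_ sXY sr] bad.
  have : center (type s) !=set0.
    apply: star.
    + by move=> t /typeP[ts At]; split=> //; apply: sXY; rewrite mem_fset_seq.
    + apply: contrapT => noX; apply: bad; right => t ts.
      have /typeP[ts' _] := ts.
      have [Xt|//] : X t \/ Y t by apply: sXY; rewrite mem_fset_seq.
      by case: noX; exists t.
    + apply: contrapT => noY; apply: bad; left => t ts.
      have /typeP[ts' _] := ts.
      have [//|Yt] : X t \/ Y t by apply: sXY; rewrite mem_fset_seq.
      by case: noY; exists t.
    + by move=> x y /typeP[xs _] /typeP[ys _]; apply: sr; rewrite mem_fset_seq.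
  move=> /(xgetPex a0); set a := xget a0 _ => -[Aa aT a_star]; split=> //.
  have as_le x : x \in s -> (D a x <= r%:E)%E.
    move=> xs; have [Ax|Ax] := pselect (A x); last by apply: aT; apply/typeP.
    apply: a_star => // t /typeP[ts _].
    by apply: sr; rewrite mem_fset_seq.
  have sXY' x : x \in s -> X x \/ Y x.
    by move=> xs; apply: sXY; rewrite mem_fset_seq.
  apply/vr_simplexP; split.
  + exact: fset_seq_neq0.
  + move=> x; rewrite mem_fset_seq in_cons => /orP[/eqP ->|/sXY'//].
    by left; exact: AX.
  + move=> x y; rewrite !mem_fset_seq !in_cons.
    move=> /orP[/eqP ->|xs] /orP[/eqP ->|ys].
    (* The case [b := a] of the condition on the apex bounds [D a a]. *)
    * exact: a_star.
    * exact: as_le.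
    * by rewrite -DC ?as_le//; exact: sXY'.
    * by apply: sr; rewrite mem_fset_seq.
- rewrite -/type => s /uc[] /vr_simplexP[_ sZ _]; [left|right] => t /typeP[ts _];
    by apply: sZ; rewrite mem_fset_seq.
exists l, b; split=> // s sl; have [sn /vr_simplexP[s0 sXY sr]] := Kl _ sl.
have [gX|gY] : good (type s) := gl _ sl; [left|right].
  have sX x : x \in [fset y in s]%fset -> X x.
    rewrite mem_fset_seq => xs; have [/AX//|Ax] := pselect (A x).
    by apply: gX; apply/typeP.
  by apply/vr_simplexP; split=> // x y xs ys; rewrite -DX ?sr//; exact: sX.
have sY x : x \in [fset y in s]%fset -> Y x.
  rewrite mem_fset_seq => xs; have [/AY//|Ax] := pselect (A x).
  by apply: gY; apply/typeP.
by apply/vr_simplexP; split=> // x y xs ys; rewrite -DY ?sr//; exact: sY.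
Qed.

(* Contractibility for every r > 0 enters only through connectedness. *)
Lemma contractible_VR_dense (R : realType) (V : choiceType)
    (d : V -> V -> \bar R) (A : set V) (gm : R -> V) (alpha : R) :
  (forall r, 0 < r -> contractible R (realization R (VR d A r))) ->
  (forall a, A a -> exists2 t, 0 <= t <= alpha & a = gm t) ->
  A (gm 0) -> A (gm alpha) ->
  (forall s t, 0 <= s <= alpha -> 0 <= t <= alpha ->
    d (gm s) (gm t) = `|s - t|%:E) ->
  forall s t, 0 <= s -> s < t -> t <= alpha ->
  exists2 c, s <= c <= t & A (gm c).
Proof.
move=> contr Agm A0 A1 dgm s t s0 st ta; apply: contrapT => gap.
have gapP c : A (gm c) -> c < s \/ t < c.
  move=> Ac; have [cs|sc] := ltP c s; first by left.
  have [ct|] := leP c t; last by right.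
  by case: gap; exists c => //; rewrite sc ct.
(* At a scale below the gap [t - s], no simplex has vertices on both sides of it. *)
pose r := (t - s) / 2.
have r0 : 0 < r by rewrite divr_gt0// subr_gt0.
have in0 : 0 <= (0 : R) <= alpha by apply/andP; split; lra.
have in1 : 0 <= alpha <= alpha by apply/andP; split; lra.
pose D : set V := [set z | exists c, [/\ 0 <= c <= alpha, z = gm c & c < s]].
have vertex_simplex c : 0 <= c <= alpha -> A (gm c) ->
    simplex (VR d A r) [fset gm c]%fset.
  move=> cP Ac; apply/vr_simplexP; split.
  - by apply/fset0Pn; exists (gm c); rewrite inE.
  - by move=> x; rewrite inE => /eqP ->.
  - move=> x y; rewrite !inE => /eqP -> /eqP ->.
    by rewrite dgm// subrr normr0 lee_fin ltW.
have D0 : D (gm 0).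
  by exists 0; split=> //; have [//|] := gapP _ A0; lra.
have D1 : D (gm alpha).
  apply: (contractible_no_split (contr r r0)) (vertex_simplex _ in0 A0)
    (vertex_simplex _ in1 A1) D0.
  move=> sg /vr_simplexP[_ sA sr] x y xs ys [c [cP xE cs]].
  have [c' c'P yE] := Agm _ (sA _ ys).
  exists c'; split=> //.
  have [|//|tc'] := gapP c'; first by rewrite -yE; exact: sA.
  have := sr _ _ ys xs; rewrite xE yE dgm// lee_fin => /(le_trans (ler_norm _)).
  by rewrite /r; lra.
have [c [cP cE cs]] := D1; have := dgm _ _ in1 cP.
rewrite -cE dgm// subrr normr0 => -[] /esym/eqP.
by rewrite normr_eq0 subr_eq0 => /eqP; lra.
Qed.

Theorem corollary3p17 (R : realType) (k : fieldType) (i : nat)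
  (G : metric_graph R) (GX GY GA : subgraph G)
  (vertsG : sverts GX `|` sverts GY = setT)
  (edgesG : sedges GX `|` sedges GY = setT)
  (defGA : GA = subgraphI GX GY)
  (isomA : forall a b, carrier GA a -> carrier GA b ->
     gdist GX a b = gdist GY a b)
  (u : vertex G) (vs : seq (vertex G)) (es : seq (edge G))
  (pathA : is_path GA u vs es)
  (alpha : R) (def_alpha : alpha = \sum_(e <- es) len e)
  (deg2 : forall v, sverts GA v -> v != u -> v != last u vs ->
     degree_is GX v 2)
  (ell : \bar R)
  (def_ell : ell =
     mine (shortest_cycle_through GX GA) (shortest_cycle_meeting GY GA))
  (alpha_lt : (alpha%:E < ell / 3%:E)%E)
  (X Y A : set (gpoint G))
  (subX : X `<=` carrier GX) (subY : Y `<=` carrier GY)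
  (XGY : X `&` carrier GY = A) (YGX : Y `&` carrier GX = A)
  (XY : X `&` Y = A)
  (Au : A (inl u)) (Av : A (inl (last u vs)))
  (contrA : forall r : R, 0 < r ->
     contractible R (realization R (VR (gdist GX) A r)))
  (a0 : gpoint G) (Aa0 : A a0) :
  pm_iso
    (PH k (wedge_filtration (VR_filtration (gdist GX) X)
                            (VR_filtration (gdist GY) Y) a0 a0) i)
    (PH k (VR_filtration (glue_dist (gdist GX) (gdist GY) X Y A)
                         (X `|` Y)) i).
Proof.
have vAX : sverts GA `<=` sverts GX by rewrite defGA => x [].
have vAY : sverts GA `<=` sverts GY by rewrite defGA => x [].
have eAX : sedges GA `<=` sedges GX by rewrite defGA => x [].
have eAY : sedges GA `<=` sedges GY by rewrite defGA => x [].
have carrierA z : carrier GA z <-> carrier GX z /\ carrier GY z.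
  by rewrite defGA; case: z.
have AX : A `<=` X by rewrite -XY => z [].
have AY : A `<=` Y by rewrite -XY => z [].
have AGA z : A z -> carrier GA z.
  by move=> Az; apply/carrierA; split; [exact/subX/AX|exact/subY/AY].
have XA x : X x -> ~ A x -> ~ carrier GA x.
  by move=> Xx Ax /carrierA[_ Yx]; apply: Ax; rewrite -XGY.
have YA y : Y y -> ~ A y -> ~ carrier GA y.
  by move=> Yy Ay /carrierA[Xy _]; apply: Ay; rewrite -YGX.
have [p [up pvs pes]] := path_opath pathA.
pose gm := curve u p.
have alpha0 : 0 <= alpha by rewrite def_alpha; exact: (path_length_ge0 pes).
have := lt_third alpha_lt; rewrite def_ell lt_min => /andP[shortX shortY].
rewrite def_alpha in shortX shortY.
have gm0 : gm 0 = inl u by exact: curve_path0.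
have gm1 : gm alpha = inl (last u vs).
  by rewrite def_alpha; exact: curve_path_end.
have meeting := excursion_meeting pathA eAY shortY.
have dY_gm s t : 0 <= s <= alpha -> 0 <= t <= alpha ->
    gdist GY (gm s) (gm t) = `|s - t|%:E.
  rewrite def_alpha; apply: (gdist_curve_path pathA up pvs pes vAY eAY).
  move=> x y w Kx Ky xy /(meeting _ _ _ Kx Ky xy); rewrite -def_alpha; lra.
have gmA s : 0 <= s <= alpha -> carrier GA (gm s).
  by rewrite def_alpha; exact: (carrier_curve_path pathA up pvs pes).
(* In [GX] only cycles through all of G_A are known to be long, so the formula is carried over from
   [GY] by the isometry. *)
have dX_gm s t : 0 <= s <= alpha -> 0 <= t <= alpha ->
    gdist GX (gm s) (gm t) = `|s - t|%:E.
  by move=> sP tP; rewrite isomA ?dY_gm//; exact: gmA.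
have A_gm a : A a -> exists2 t, 0 <= t <= alpha & a = gm t.
  by move=> /AGA; rewrite def_alpha; exact: (curve_path_surj pathA up pvs pes).
have A_gm0 : A (gm 0) by rewrite gm0.
have A_gm1 : A (gm alpha) by rewrite gm1.
have A_dense := contractible_VR_dense contrA A_gm A_gm0 A_gm1 dX_gm.
have ends := degree2_ends pathA eAX deg2.
have dX_via x t : X x -> ~ A x -> 0 <= t <= alpha ->
    (mine (gdist GX x (gm 0%R) + gdist GX (gm 0%R) (gm t))
       (gdist GX x (gm alpha) + gdist GX (gm alpha) (gm t))
     <= gdist GX x (gm t))%E.
  move=> Xx Ax tP; rewrite gm0 gm1.
  exact: (gdist_via_ends ends (XA _ Xx Ax) (gmA _ tP)).
have dX_gm' := dX_gm; have dY_gm' := dY_gm.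
rewrite def_alpha in dX_gm' dY_gm'.
have dX_ends x px qx t : X x -> ~ A x -> gdist GX x (gm 0) = px%:E ->
    gdist GX x (gm alpha) = qx%:E -> 0 <= t <= alpha ->
    gdist GX x (gm t) = (Num.min (px + t) (qx + (alpha - t)))%:E.
  rewrite gm0 gm1 def_alpha => Xx Ax.
  exact: (gdist_ends pathA up pvs pes dX_gm' ends (XA _ Xx Ax)).
have dX_far x px qx : X x -> ~ A x -> gdist GX x (gm 0) = px%:E ->
    gdist GX x (gm alpha) = qx%:E -> 2 * alpha <= px + qx \/ `|px - qx| = alpha.
  rewrite gm0 gm1 def_alpha => Xx Ax.
  apply: (gdist_ends_far pathA up pvs pes dX_gm' ends _ (XA _ Xx Ax)).
  exact: (excursion_through pathA eAX shortX ends).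
have dY_near y m n : Y y -> ~ A y -> gdist GY y (gm 0) = m%:E ->
    gdist GY y (gm alpha) = n%:E -> m < alpha -> n < alpha ->
    alpha < m + n /\
    forall t, 0 <= t <= alpha -> (gdist GY y (gm t) <= (Num.max m n)%:E)%E.
  rewrite gm0 gm1 def_alpha => Yy Ay.
  exact: (gdist_near_both pathA up pvs pes dY_gm' meeting (YA _ Yy Ay)).
pose D := glue_dist (gdist GX) (gdist GY) X Y A.
have DX s t : X s -> X t -> D s t = gdist GX s t by exact: glue_distXX.
have DY s t : Y s -> Y t -> D s t = gdist GY s t.
  exact: (glue_distYY XY A_gm dX_gm dY_gm).
have star := star_center alpha0 (@gdist_ge0 _ _ GX) (@gdist_ge0 _ _ GY)
  (@gdistC _ _ GX) (@gdistC _ _ GY) (@gdist_triangle _ _ GX)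
  (@gdist_triangle _ _ GY) XY A_gm A_gm0 A_gm1 dX_gm dY_gm A_dense dX_via
  dX_ends dX_far dY_near.
apply: wedge_fold_pm_iso.
- move=> r s /vr_simplexP[s0 sX sr]; apply/vr_simplexP; split=> //.
    by move=> x xs; left; exact: sX.
  by move=> x y xs ys; rewrite -/D DX ?sr//; exact: sX.
- move=> r s /vr_simplexP[s0 sY sr]; apply/vr_simplexP; split=> //.
    by move=> x xs; right; exact: sY.
  by move=> x y xs ys; rewrite -/D DY ?sr//; exact: sY.
- move=> r n c; apply: (vr_union_relative a0 AX AY DX DY).
    move=> a t Aa [Xt|Yt].
      by rewrite !DX 1?gdistC//; exact: AX.
    by rewrite !DY 1?gdistC//; exact: AY.
  by move=> T; apply: star.
move=> r n c cA cb.
pose pos z := xget (0 : R) [set t | 0 <= t <= alpha /\ z = gm t].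
have posP z : A z -> 0 <= pos z <= alpha /\ z = gm (pos z).
  move=> /A_gm[t tP zE].
  apply: (@xgetPex _ (0 : R) [set t | 0 <= t <= alpha /\ z = gm t]).
  by exists t.
have d_pos a b : A a -> A b -> gdist GX a b = `|pos a - pos b|%:E.
  move=> /posP[aP aE] /posP[bP bE]; rewrite {1}aE {1}bE; exact: dX_gm.
have pos_inj a b : A a -> A b -> pos a = pos b -> a = b.
  by move=> /posP[_ {2}->] /posP[_ {2}->] ->.
have pos_gm t : 0 <= t <= alpha -> A (gm t) -> pos (gm t) = t.
  move=> tP /posP[sP e]; have := dX_gm _ _ tP sP.
  rewrite -e dX_gm// subrr normr0 => -[] /esym/eqP.
  by rewrite normr_eq0 subr_eq0 => /eqP.
have r0 : 0 < r%:num by [].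
(* The vertex sets meet in A, where the two metrics agree. *)
have interE s :
    inter_simplex (VR (gdist GX) X r%:num) (VR (gdist GY) Y r%:num) s <-> simplex (VR (gdist GX) A r%:num) [fset x in s]%fset.
  split=> [[/vr_simplexP[s0 sX sr] /vr_simplexP[_ sY _]]|/vr_simplexP[s0 sA sr]].
    apply/vr_simplexP; split=> // x xs; rewrite -XY; split; [exact: sX|exact: sY].
  split; apply/vr_simplexP; split=> //.
  - by move=> x /sA /AX.
  - by move=> x /sA /AY.
  - by move=> x y xs ys; rewrite -isomA ?sr//; apply/AGA/sA.
have [||e [a [ea Aa cE]]] := @vr_line_relative R k _ (gdist GX) A pos a0
  Aa0 d_pos pos_inj r%:num r0 _ n c _ cb.
- move=> b Ab far; have [/andP[b0 b1] _] := posP _ Ab.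
  have [/andP[z0 z1] _] := posP _ Aa0.
  move: far; have [ab|ba] := leP (pos a0) (pos b).
    rewrite ger0_norm ?subr_ge0// => far.
    (* A hop into this interval has length between [r / 2] and [r], and [far] keeps it from passing
       [a0]. *)
    have [|||c' /andP[c0 c1] Ac] := A_dense (pos b - r%:num) (pos b - r%:num / 2);
      [lra|lra|lra|].
    have c'P : 0 <= c' <= alpha by apply/andP; split; lra.
    exists (gm c'); rewrite /towards pos_gm// ger0_norm; last by lra.
    by split=> //; [split; [lra|left; apply/andP; split; lra]|lra].
  rewrite ltr0_norm ?subr_lt0// => far.
  have [|||c' /andP[c0 c1] Ac] := A_dense (pos b + r%:num / 2) (pos b + r%:num);
    [lra|lra|lra|].
  have c'P : 0 <= c' <= alpha by apply/andP; split; lra.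
  exists (gm c'); rewrite /towards pos_gm// ler0_norm; last by lra.
  by split=> //; [split; [lra|right; apply/andP; split; lra]|lra].
- by move=> s /cA[sn /interE].
exists e, a; split=> // s /Aa[sn /interE]; by [].
Qed.
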